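(* Let $d\ge 1$ be an integer, let $0<\alpha\le d+1$, and let $1\le p,q\le\infty$. Then the following conditions are equivalent: (1) $K_\alpha:L^p\to L^q$ is bounded; (2) $K_\alpha^+:L^p\to L^q$ is bounded; (3) $p,q$ satisfy one of the following: (a) $p=1$ and $q<\frac{d+1}{\alpha}$; (b) $1<p<\frac{d+1}{d+1-\alpha}$ and $\frac1q\ge\frac1p+\frac{\alpha}{d+1}-1$; (c) $p=\frac{d+1}{d+1-\alpha}$ and $q<\infty$; (d) $\frac{d+1}{d+1-\alpha}<p\le\infty$.
   Context: $\mathbb{B}^d$ is the open unit ball of $\mathbb{C}^d$ with Lebesgue measure $dv$ normalized so that $v(\mathbb{B}^d)=1$; $\langle z,w\rangle=\sum_j z_j\overline{w_j}$; $L^p=L^p(\mathbb{B}^d,dv)$. For $\alpha\in\mathbb{R}$ and $f\in L^1(\mathbb{B}^d,dv)$, $$K_\alpha f(z)=\int_{\mathbb{B}^d}\frac{f(w)}{(1-\langle z,w\rangle)^\alpha}\,dv(w),\qquad K_\alpha^+f(z)=\int_{\mathbb{B}^d}\frac{f(w)}{|1-\langle z,w\rangle|^\alpha}\,dv(w),\qquad z\in\mathbb{B}^d$$ (principal branch of the power). Conventions: $1/\infty=0$, and $\frac{d+1}{d+1-\alpha}=\infty$ when $\alpha=d+1$. *)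

(* Defs.v *)
(* MathComp-Analysis over an arbitrary realType R; complex numbers are the
   R[i] of the real-closed library. *)
From HB Require Import structures.
From mathcomp Require Import all_boot all_order all_algebra.
From mathcomp Require Import all_classical all_reals all_analysis.
From mathcomp Require Import measurable_realfun ess_sup_inf zify.
From mathcomp.real_closed Require Import complex.

Set Implicit Arguments.
Unset Strict Implicit.
Unset Printing Implicit Defensive.

Import Order.TTheory GRing.Theory Num.Theory.
Import numFieldNormedType.Exports.

Local Open Scope classical_set_scope.
Local Open Scope ring_scope.
Local Open Scope complex_scope.

Section transport.
Context d1 d2 (T1 : measurableType d1) (T2 : measurableType d2) (R : realType).
Variable m : {sigma_finite_measure set T1 -> \bar R}.
Variables (f : T1 -> T2) (g : T2 -> T1).

(* The measurable left inverse g makes the image measure sigma-finite. *)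
Definition transport of measurable_fun [set: T1] f
    & measurable_fun [set: T2] g & cancel f g : set T2 -> \bar R :=
  pushforward m f.

Hypotheses (mf : measurable_fun [set: T1] f) (mg : measurable_fun [set: T2] g).
Hypothesis fK : cancel f g.

Let image_measure : {measure set T2 -> \bar R} :=
  measure_function_pushforward__canonical__measure_function_Measure m mf.

Let transport0 : transport mf mg fK set0 = 0%E.
Proof. exact: (measure0 image_measure). Qed.

Let transport_ge0 A : (0 <= transport mf mg fK A)%E.
Proof. exact: (measure_ge0 image_measure). Qed.

Let transport_sigma_additive : semi_sigma_additive (transport mf mg fK).
Proof. exact: (@measure_semi_sigma_additive _ _ _ image_measure). Qed.

HB.instance Definition _ := isMeasure.Build _ _ _ (transport mf mg fK)
  transport0 transport_ge0 transport_sigma_additive.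

Let transport_sigma_finite : sigma_finite [set: T2] (transport mf mg fK).
Proof.
have [F FT Foo] := sigma_finiteT m.
exists (fun n => g @^-1` F n).
  by rewrite -preimage_bigcup -FT preimage_setT.
move=> n; have [mFn Fnoo] := Foo n; split.
  by rewrite -[X in measurable X]setTI; exact: mg.
by rewrite /transport /pushforward -comp_preimage (_ : g \o f = id) //;
  apply/funext => x /=; rewrite fK.
Qed.

HB.instance Definition _ := Measure_isSigmaFinite.Build _ _ _
  (transport mf mg fK) transport_sigma_finite.

End transport.

Section prod_measure.
Local Open Scope ereal_scope.
Context d1 d2 (T1 : measurableType d1) (T2 : measurableType d2) (R : realType).
Variables (m1 : {sigma_finite_measure set T1 -> \bar R})
  (m2 : {sigma_finite_measure set T2 -> \bar R}).

(* The library declares m1 \x m2 as sigma-finite only for probabilities; this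
   alias carries the general instance. *)
Definition prod_measure : set (T1 * T2) -> \bar R := m1 \x m2.

HB.instance Definition _ := Measure.on prod_measure.

Let prod_measure_sigma_finite : sigma_finite setT prod_measure.
Proof.
have /sigma_finiteP[F [TF ndF Foo]] := sigma_finiteT m1.
have /sigma_finiteP[G [TG ndG Goo]] := sigma_finiteT m2.
exists (fun n => F n `*` G n).
  rewrite -setXTT TF TG predeqE => -[x y]; split.
    move=> [/= [n _ Fnx] [k _ Gky]]; exists (maxn n k) => //; split.
    - by move: x Fnx; exact/subsetPset/ndF/leq_maxl.
    - by move: y Gky; exact/subsetPset/ndG/leq_maxr.
  by move=> [n _ []/= ? ?]; split; exists n.
move=> k; have [? ?] := Foo k; have [? ?] := Goo k.
split; first exact: measurableX.
by rewrite /prod_measure product_measure1E// lte_mul_pinfty// ge0_fin_numE.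
Qed.

HB.instance Definition _ := Measure_isSigmaFinite.Build _ _ _ prod_measure
  prod_measure_sigma_finite.

End prod_measure.

Section tuple_measure.
Context d (T : measurableType d) (R : realType).
Variable m : {sigma_finite_measure set T -> \bar R}.

Definition tcons n (p : T * n.-tuple T) : n.+1.-tuple T :=
  [tuple of p.1 :: p.2].
Definition tuncons n (t : n.+1.-tuple T) : T * n.-tuple T :=
  (thead t, [tuple of behead t]).

Lemma tconsK n : cancel (@tcons n) (@tuncons n).
Proof. by case=> x t; congr pair; apply/val_inj. Qed.

Lemma measurable_tcons n : measurable_fun [set: T * n.-tuple T] (@tcons n).
Proof. by apply: measurable_cons. Qed.

Lemma measurable_tuncons n : measurable_fun [set: n.+1.-tuple T] (@tuncons n).
Proof.
apply: measurable_fun_pair; last exact: measurable_behead.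
exact: measurable_tnth.
Qed.

Fixpoint tuple_measure n : {sigma_finite_measure set (n.-tuple T) -> \bar R} :=
  match n with
  | 0 => dirac [tuple]
  | n'.+1 => transport (prod_measure m (tuple_measure n'))
      (@measurable_tcons n') (@measurable_tuncons n') (@tconsK n')
  end.

Lemma measurable_box n (A : 'I_n -> set T) : (forall i, measurable (A i)) ->
  measurable [set t : n.-tuple T | forall i, A i (tnth t i)].
Proof.
move=> mA.
rewrite (_ : mkset _ = \bigcap_(i in [set: 'I_n]) (@tnth n T ^~ i) @^-1` A i).
  apply: fin_bigcap_measurable => [|i _]; first exact: finite_finset.
  by rewrite -[X in measurable X]setTI; apply: measurable_tnth.
by apply/seteqP; split => [t At i _|t At i]; [exact: At|exact: (At i I)].
Qed.

Lemma tuple_measure_box n (A : 'I_n -> set T) : (forall i, measurable (A i)) ->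
  tuple_measure n [set t | forall i, A i (tnth t i)] =
  (\prod_(i < n) m (A i))%E.
Proof.
elim: n A => [|n IHn] A mA.
  by rewrite big_ord0 /= diracE mem_set// => -[].
rewrite big_ord_recl -(IHn (fun i => A (lift ord0 i)))//.
rewrite -[RHS]product_measure1E//; last first.
  exact: (measurable_box (fun i => mA (lift ord0 i))).
rewrite /= /transport /pushforward /prod_measure; congr (_ _).
apply/seteqP; split => -[x t] /=.
  move=> At; split => [|i]; first exact: (At ord0).
  by have := At (lift ord0 i); rewrite tnthS.
move=> [Ax At] i; case: (unliftP ord0 i) => [j ->|->]; last exact: Ax.
rewrite tnthS; exact: At.
Qed.

End tuple_measure.

Section complex_measure.
Variable R : realType.

(* Borel sets and Lebesgue measure of C, carried over from R x R by
   (x, y) |-> x + iy. *)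
Definition pair_complex (p : measurableTypeR R * measurableTypeR R) : R[i] :=
  p.1 +i* p.2.
Definition complex_pair (z : R[i]) : measurableTypeR R * measurableTypeR R :=
  (complex.Re z, complex.Im z).

Definition measurable_complex : set (set R[i]) :=
  [set A | measurable (pair_complex @^-1` A)].

Let measurable_complex0 : measurable_complex set0.
Proof.
by rewrite /measurable_complex/= preimage_set0; exact: measurable0.
Qed.

Let measurable_complexC A : measurable_complex A -> measurable_complex (~` A).
Proof.
rewrite /measurable_complex/= => mA; rewrite -preimage_setC.
exact: measurableC.
Qed.

Let measurable_complex_bigcup (F : (set R[i])^nat) :
  (forall i, measurable_complex (F i)) -> measurable_complex (\bigcup_i F i).
Proof.
move=> mF; rewrite /measurable_complex/= preimage_bigcup.
by apply: bigcup_measurable => i _; exact: mF.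
Qed.

HB.instance Definition _ := isPointed.Build R[i] 0.
HB.instance Definition _ := @isMeasurable.Build default_measure_display R[i]
  measurable_complex measurable_complex0 measurable_complexC
  measurable_complex_bigcup.

Lemma measurable_pair_complex : measurable_fun setT pair_complex.
Proof. by move=> _ A; rewrite setTI. Qed.

Lemma complex_pairK : cancel complex_pair pair_complex.
Proof. by case. Qed.

Lemma pair_complexK : cancel pair_complex complex_pair.
Proof. by case. Qed.

Lemma measurable_complex_pair : measurable_fun setT complex_pair.
Proof.
move=> _ A mA; rewrite setTI.
rewrite (_ : measurable _ =
  measurable (pair_complex @^-1` (complex_pair @^-1` A)))//.
rewrite -comp_preimage (_ : _ \o _ = id)//.
by apply/funext; exact: pair_complexK.
Qed.

Definition complex_lebesgue : {sigma_finite_measure set R[i] -> \bar R} :=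
  transport (prod_measure lebesgue_measure lebesgue_measure)
    measurable_pair_complex measurable_complex_pair pair_complexK.

End complex_measure.

Notation Cn R d := (d.-tuple R[i]).

Section ball.
Variables (R : realType) (d : nat).

Definition dotc (z w : Cn R d) : R[i] :=
  \sum_(j < d) tnth z j * conjc (tnth w j).

Definition cball : set (Cn R d) :=
  [set z | \sum_(j < d) Normc.normc (tnth z j) ^+ 2 < 1].

Definition Cn_lebesgue : {sigma_finite_measure set (Cn R d) -> \bar R} :=
  tuple_measure (@complex_lebesgue R) d.

Lemma measurable_normc2 :
  measurable_fun [set: R[i]] (fun z => Normc.normc z ^+ 2 : measurableTypeR R).
Proof.
rewrite (_ : (fun z => _) =
    (fun p => p.1 ^+ 2 + p.2 ^+ 2 : measurableTypeR R) \o @complex_pair R).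
  apply: measurableT_comp; last exact: measurable_complex_pair.
  by apply: measurable_funD; apply: measurable_funX.
by apply/funext => -[x y] /=; rewrite sqr_sqrtr// addr_ge0// sqr_ge0.
Qed.

Lemma measurable_cball : measurable cball.
Proof.
have mf : measurable_fun setT
    (fun z : Cn R d =>
      \sum_(j < d) Normc.normc (tnth z j) ^+ 2 : measurableTypeR R).
  apply: measurable_sum => j.
  exact: (measurableT_comp measurable_normc2 (measurable_tnth j)).
rewrite (_ : cball = setT `&` (fun z : Cn R d =>
  \sum_(j < d) Normc.normc (tnth z j) ^+ 2) @^-1` `]-oo, 1[); first exact: mf.
by rewrite setTI; apply/seteqP; split => z /=; rewrite in_itv.
Qed.

Let square (r : R) : set R[i] :=
  [set z | `|complex.Re z| < r /\ `|complex.Im z| < r].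

Let squareE r : pair_complex (R := R) @^-1` square r =
  `]- r, r[%classic `*` `]- r, r[%classic.
Proof.
by apply/seteqP; split => -[x y] /=; rewrite !in_itv/= -!ltr_norml.
Qed.

Let measurable_square r : measurable (square r).
Proof.
rewrite (_ : measurable _ = measurable (pair_complex (R := R) @^-1` square r))//.
by rewrite squareE; apply: measurableX; exact: measurable_itv.
Qed.

Let complex_lebesgue_square r : 0 < r ->
  complex_lebesgue R (square r) = ((r *+ 2) ^+ 2)%:E.
Proof.
move=> r0; rewrite /complex_lebesgue/= /transport /pushforward squareE.
rewrite /prod_measure product_measure1E//= lebesgue_measure_itv/= lte_fin.
by rewrite gtrN// -EFinD opprK -EFinM -mulr2n expr2.
Qed.

Let cube r : set (Cn R d) := [set z | forall j, square r (tnth z j)].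

Let Cn_lebesgue_cube r : 0 < r ->
  Cn_lebesgue (cube r) = (((r *+ 2) ^+ 2) ^+ d)%:E.
Proof.
move=> r0; rewrite /Cn_lebesgue (tuple_measure_box _ (A := fun=> square r))//.
under eq_bigr do rewrite complex_lebesgue_square//.
by rewrite prodEFin prodr_const card_ord.
Qed.

Lemma Cn_lebesgue_cball : (0 < Cn_lebesgue cball < +oo)%E.
Proof.
have mcube r : measurable (cube r).
  by exact: (@measurable_box _ _ d (fun=> square r)).
apply/andP; split.
  pose r : R := (2 * d.+1%:R)^-1.
  have r0 : 0 < r by rewrite invr_gt0 mulr_gt0.
  apply: (@lt_le_trans _ _ (Cn_lebesgue (cube r))).
    by rewrite Cn_lebesgue_cube// lte_fin !exprn_gt0// mulrn_wgt0.
  apply: le_measure; rewrite ?inE//; first exact: measurable_cball.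
  move=> z zr; rewrite /cball/=.
  apply: (@le_lt_trans _ _ (\sum_(j < d) r ^+ 2 *+ 2)).
    apply: ler_sum => j _; case: (tnth z j) (zr j) => x y [/= xr yr].
    rewrite sqr_sqrtr ?addr_ge0 ?sqr_ge0// mulr2n -(real_normK (num_real x)).
    rewrite -(real_normK (num_real y)).
    by apply: lerD; rewrite lerXn2r// ?nnegrE ?ltW.
  rewrite sumr_const card_ord -mulrnA -mulr_natl /r exprVn.
  rewrite ltr_pdivrMr ?mul1r ?exprn_gt0 ?mulr_gt0//.
  by rewrite -natrM -natrX ltr_nat; nia.
apply: (@le_lt_trans _ _ (Cn_lebesgue (cube 1))); last first.
  by rewrite Cn_lebesgue_cube// ltry.
apply: le_measure; rewrite ?inE//; first exact: measurable_cball.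
move=> z zB j; rewrite /square/=.
have {zB} : Normc.normc (tnth z j) ^+ 2 < 1.
  apply: le_lt_trans zB; rewrite (bigD1 j)//= lerDl sumr_ge0// => k _.
  exact: sqr_ge0.
case: (tnth z j) => x y /=; rewrite sqr_sqrtr ?addr_ge0 ?sqr_ge0// => xy.
split; rewrite -(@ltr_pXn2r _ 2)// ?nnegrE// expr1n real_normK ?num_real//.
  by apply: le_lt_trans xy; rewrite lerDl sqr_ge0.
by apply: le_lt_trans xy; rewrite lerDr sqr_ge0.
Qed.

Let cball_scale_ge0 : 0 <= (fine (Cn_lebesgue cball))^-1.
Proof. by rewrite invr_ge0 fine_ge0. Qed.

(* Lebesgue measure on the unit ball, normalized, and extended by zero to the
   complement of the ball. *)
Definition ball_measure : set (Cn R d) -> \bar R :=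
  mscale (NngNum cball_scale_ge0) (mrestr Cn_lebesgue measurable_cball).

HB.instance Definition _ := Measure.on ball_measure.

Lemma ball_measureE A :
  ball_measure A = (Cn_lebesgue (A `&` cball) / Cn_lebesgue cball)%E.
Proof.
have /andP[l0 loo] := Cn_lebesgue_cball.
have lfin : Cn_lebesgue cball \is a fin_num by rewrite ge0_fin_numE.
rewrite /ball_measure /mscale/= /mrestr muleC -[in RHS](fineK lfin) inver.
have f0 : 0 < fine (Cn_lebesgue cball) by rewrite fine_gt0// l0.
by case: eqP => // f00; rewrite f00 ltxx in f0.
Qed.

Let ball_measure_setT : ball_measure [set: Cn R d] = 1%E.
Proof.
have /andP[l0 loo] := Cn_lebesgue_cball.
have lfin : Cn_lebesgue cball \is a fin_num by rewrite ge0_fin_numE.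
by rewrite ball_measureE setTI divee// gt_eqF.
Qed.

HB.instance Definition _ :=
  Measure_isProbability.Build _ _ _ ball_measure ball_measure_setT.

End ball.

Section operators.
Variable R : realType.

Definition cintegral dd (T : measurableType dd) (mu : {measure set T -> \bar R})
    (D : set T) (f : T -> R[i]) : R[i] :=
  (\int[mu]_(x in D) complex.Re (f x)) +i* (\int[mu]_(x in D) complex.Im (f x)).

(* Principal argument, in ]-pi, pi]; only used for u != 0. *)
Definition carg (u : R[i]) : R :=
  let t := acos (complex.Re u / Normc.normc u) in
  if 0 <= complex.Im u then t else - t.

Definition clog (u : R[i]) : R[i] := ln (Normc.normc u) +i* carg u.

Definition cexp (u : R[i]) : R[i] :=
  (expR (complex.Re u))%:C * (cos (complex.Im u) +i* sin (complex.Im u)).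

Definition cpow (u : R[i]) (a : R) : R[i] := cexp (a%:C * clog u).

Variable d : nat.

Definition Kop (alpha : R) (f : Cn R d -> R[i]) (z : Cn R d) : R[i] :=
  cintegral (@ball_measure R d) (@cball R d)
    (fun w => f w / cpow (1 - dotc z w) alpha).

Definition Kop_plus (alpha : R) (f : Cn R d -> R[i]) (z : Cn R d) : R[i] :=
  cintegral (@ball_measure R d) (@cball R d)
    (fun w => f w / (Normc.normc (1 - dotc z w) `^ alpha)%:C).

Definition Lp_norm (p : \bar R) (f : Cn R d -> R[i]) : \bar R :=
  Lnorm (@ball_measure R d) p (fun z => (Normc.normc (f z))%:E).

(* Elements of L^p are functions, not a.e. classes; they are defined on all of
   C^d, but their values off the ball, a null set of ball_measure, are ignored. *)
Definition in_Lp (p : \bar R) (f : Cn R d -> R[i]) : Prop :=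
  measurable_fun (@cball R d) f /\ (Lp_norm p f < +oo)%E.

Definition Lp_bounded (p q : \bar R)
    (K : (Cn R d -> R[i]) -> (Cn R d -> R[i])) : Prop :=
  exists C : R, forall f, in_Lp p f ->
    in_Lp q (K f) /\ (Lp_norm q (K f) <= C%:E * Lp_norm p f)%E.

(* (d+1)/(d+1-alpha); the extended inverse of 0 is +oo, which covers
   alpha = d+1. *)
Definition crit_exponent (alpha : R) : \bar R :=
  (d.+1%:R%:E / (d.+1%:R - alpha)%:E)%E.

Lemma crit_exponent_top : crit_exponent d.+1%:R = +oo%E.
Proof. by rewrite /crit_exponent subrr inve0 gt0_muley// lte_fin. Qed.

End operators.

(* Main.v *)
Require Import Defs.
From mathcomp Require Import all_boot all_order all_algebra.
From mathcomp Require Import all_classical all_reals all_analysis.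
From mathcomp Require Import measurable_realfun ess_sup_inf zify ring lra.
From mathcomp.real_closed Require Import complex.

(* Everything is proved for an operator with an arbitrary kernel k(z, w) of
   modulus |1 - <z, w>|^(-alpha) whose real part is comparable to its modulus
   when 1 - <z, w> lies in a narrow sector around the positive axis; both
   operators are of this kind.

   Sufficiency. From 2 - 2 Re <z, w> = (1 - |z|^2) + (1 - |w|^2) + |z - w|^2 one
   bounds the volume of {w : |1 - <z, w>| < delta, 1 - |w|^2 < t} by
   C delta^d t; dyadic summation gives the integrability of
   |1 - <z, w>|^(-c) for c < d + 1 and the Forelli-Rudin estimate with exponent
   d + 1.  The cases p = 1 and p > (d + 1)/(d + 1 - alpha) follow from Hoelder's
   inequality, the critical line 1/q = 1/p + alpha/(d + 1) - 1 from a Schur test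
   with the weights (1 - |w|^2)^(-s), and the rest from the inclusions between
   the spaces L^p.

   Necessity. Let Q_n be the box of size 4^(-n) in the first coordinate and
   2^(-n) in the others around the point (1 - 4^(-n), 0, ..., 0), so that
   v(Q_n) is of the order of 4^(-n(d+1)) and Re k is at least of the order of
   max(v(Q_m), v(Q_n))^(-alpha/(d+1)) on Q_m x Q_n.  Indicators of the Q_n give
   the inequality between the exponents; the two excluded endpoints fail by a
   logarithmic divergence, visible on the normalized indicator of Q_N for p = 1
   and on the sum over n < N of the v(Q_n)^(-1/p) 1_{Q_n} for q = oo. *)

Set Implicit Arguments.
Unset Strict Implicit.
Unset Printing Implicit Defensive.
Import Order.TTheory GRing.Theory Num.Theory.
Import numFieldNormedType.Exports.
Local Open Scope classical_set_scope.
Local Open Scope ring_scope.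
Local Open Scope complex_scope.

(** * Measurability and the geometry of the ball *)

(** A ball of radius delta for |1 - <z, w>| has extent delta in one complex direction and
    sqrt(delta) in the d - 1 others, hence volume of order delta^(d+1); this is the origin of d + 1
    in every exponent and of the two sizes in Q_n.

    The point z is never rotated to a coordinate axis. Instead, a coordinate of w is singled out
    whose real or imaginary part has modulus at least 1/(2d). Along it, the kernel confines w to a
    set of diameter of order delta, and the condition on 1 - |w|^2 confines it to an annulus of
    thickness of order t. The area of such a slice is of order delta t, and each of the d - 1 other
    coordinates stays in a disc of area of order delta.

    In the necessity the obstacle is cancellation: a lower bound for |k| gives none for |K f|. The
    boxes are therefore shrunk by a constant c, small enough that alpha times the argument of 1 -
    <z, w> has modulus at most 1 on any two of them; there the cosine is at least cos 1, and
    nonnegative test functions suffer no cancellation.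

    The equivalence of (1) and (2) is obtained through (3), not by comparing the operators. *)

Section measurability.
Variable R : realType.

Lemma measurable_complex_Re : measurable_fun setT (@complex.Re R : R[i] -> R).
Proof.
have := measurableT_comp (@measurable_fst _ _ _ _) (@measurable_complex_pair R).
exact.
Qed.

Lemma measurable_complex_Im : measurable_fun setT (@complex.Im R : R[i] -> R).
Proof.
have := measurableT_comp (@measurable_snd _ _ _ _) (@measurable_complex_pair R).
exact.
Qed.

Lemma measurable_normc : measurable_fun setT (@Normc.normc R : R[i] -> R).
Proof.
rewrite (_ : @Normc.normc R = (@powR R ^~ 2^-1) \o (fun z => Normc.normc z ^+ 2)).
  by apply: measurableT_comp (measurable_powR _) _; exact: measurable_normc2.
apply/funext => -[x y] /=.
have xy0 : 0 <= x ^+ 2 + y ^+ 2 by rewrite addr_ge0// sqr_ge0.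
by rewrite sqr_sqrtr// powR12_sqrt.
Qed.

Lemma measurable_fun_complex d (T : measurableType d) (D : set T) (f : T -> R[i]) :
  measurable D ->
  measurable_fun D (fun x => complex.Re (f x)) ->
  measurable_fun D (fun x => complex.Im (f x)) -> measurable_fun D f.
Proof.
move=> mD mr mi.
(* Extended by zero, both parts are measurable everywhere, so [pair_complex] can be composed with
   them. *)
pose h x := ((fun x => complex.Re (f x)) \_ D) x +i* ((fun x => complex.Im (f x)) \_ D) x.
apply: (@eq_measurable_fun _ _ _ _ _ h).
  by move=> x xD; rewrite /h /patch xD; case: (f x).
apply: (@measurable_funS _ _ _ _ setT) => //.
pose g x : measurableTypeR R * measurableTypeR R :=
  (((fun x => complex.Re (f x)) \_ D) x, ((fun x => complex.Im (f x)) \_ D) x).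
rewrite (_ : h = @pair_complex R \o g)//.
apply: measurableT_comp; first exact: measurable_pair_complex.
by apply: measurable_fun_pair; apply/(measurable_restrictT _ mD).
Qed.

Lemma complex_ReM (x y : R[i]) :
  complex.Re (x * y) = complex.Re x * complex.Re y - complex.Im x * complex.Im y.
Proof. by case: x y => [a b] [c e]. Qed.

Lemma complex_ImM (x y : R[i]) :
  complex.Im (x * y) = complex.Re x * complex.Im y + complex.Im x * complex.Re y.
Proof. by case: x y => [a b] [c e]. Qed.

Lemma complex_Re_sum (I : Type) (r : seq I) (P : pred I) (F : I -> R[i]) :
  complex.Re (\sum_(i <- r | P i) F i) = \sum_(i <- r | P i) complex.Re (F i).
Proof. exact: raddf_sum. Qed.

Lemma complex_Im_sum (I : Type) (r : seq I) (P : pred I) (F : I -> R[i]) :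
  complex.Im (\sum_(i <- r | P i) F i) = \sum_(i <- r | P i) complex.Im (F i).
Proof. exact: raddf_sum. Qed.

End measurability.

Section geometry.
Variables (R : realType) (d : nat).
Implicit Types z w : Cn R d.

(** [cball] is by conversion the set where this is below 1, so membership in the ball serves
    directly as a bound on [nrm2]. *)
Definition nrm2 z : R := \sum_(j < d) Normc.normc (tnth z j) ^+ 2.

Lemma normc_sqr (u : R[i]) : Normc.normc u ^+ 2 = complex.Re u ^+ 2 + complex.Im u ^+ 2.
Proof. by case: u => x y /=; rewrite sqr_sqrtr// addr_ge0// sqr_ge0. Qed.

Lemma normc_ge0 (u : R[i]) : 0 <= Normc.normc u.
Proof. by case: u => x y /=; exact: sqrtr_ge0. Qed.

Lemma Re_le_normc (u : R[i]) : `|complex.Re u| <= Normc.normc u.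
Proof.
rewrite -(@ler_pXn2r _ 2)// ?nnegrE ?normc_ge0// normc_sqr.
by rewrite real_normK ?num_real// lerDl sqr_ge0.
Qed.

Lemma Im_le_normc (u : R[i]) : `|complex.Im u| <= Normc.normc u.
Proof.
rewrite -(@ler_pXn2r _ 2)// ?nnegrE ?normc_ge0// normc_sqr.
by rewrite real_normK ?num_real// lerDr sqr_ge0.
Qed.

Lemma normc_le_ReIm (u : R[i]) : Normc.normc u <= `|complex.Re u| + `|complex.Im u|.
Proof.
rewrite -(@ler_pXn2r _ 2)// ?nnegrE ?normc_ge0 ?addr_ge0// normc_sqr sqrrD.
rewrite !real_normK ?num_real// addrAC lerDl mulrn_wge0//.
Qed.

Lemma Re_dotc z w : 2 * complex.Re (dotc z w) =
  nrm2 z + nrm2 w - \sum_(j < d) Normc.normc (tnth z j - tnth w j) ^+ 2.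
Proof.
rewrite /dotc complex_Re_sum mulr_sumr /nrm2 -big_split/= -sumrB.
apply: eq_bigr => j _; rewrite complex_ReM !normc_sqr.
by case: (tnth z j) => a b; case: (tnth w j) => c e /=; ring.
Qed.

(** By the polarization identity [Re_dotc] the left side is twice the real part of 1 - <z, w>. On
    the ball its three summands are nonnegative, so the modulus controls each defect and the
    Euclidean distance separately. *)
Lemma two_dist_ge z w :
  (1 - nrm2 z) + (1 - nrm2 w) + \sum_(j < d) Normc.normc (tnth z j - tnth w j) ^+ 2
  <= 2 * Normc.normc (1 - dotc z w).
Proof.
apply: (@le_trans _ _ (2 * complex.Re (1 - dotc z w))).
  rewrite (_ : complex.Re (1 - dotc z w) = 1 - complex.Re (dotc z w)).
    by rewrite mulrBr Re_dotc; lra.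
  by case: (dotc z w).
by rewrite ler_pM2l// (le_trans (ler_norm _))// Re_le_normc.
Qed.

Lemma normc_coord_le z w j : nrm2 z <= 1 -> Normc.normc (tnth z j) <= 1.
Proof.
move=> z1; rewrite -(@ler_pXn2r _ 2)// ?nnegrE ?normc_ge0// expr1n.
apply: le_trans z1; rewrite /nrm2 (bigD1 j)//= lerDl.
by apply: sumr_ge0 => k _; exact: sqr_ge0.
Qed.

Lemma normc_sum (I : Type) (r : seq I) (P : pred I) (F : I -> R[i]) :
  Normc.normc (\sum_(i <- r | P i) F i) <= \sum_(i <- r | P i) Normc.normc (F i).
Proof.
elim/big_rec2 : _ => [|i y x _ yx]; first by rewrite Normc.normc0.
by rewrite (le_trans (le_normcD _ _))// lerD2l.
Qed.

Lemma normc_conj (u : R[i]) : Normc.normc (conjc u) = Normc.normc u.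
Proof. by case: u => x y /=; rewrite sqrrN. Qed.

(** Coordinatewise estimate in place of Cauchy-Schwarz; the value only serves as the largest scale
    in a dyadic sum. *)
Lemma dist_le z w : nrm2 z <= 1 -> nrm2 w <= 1 ->
  Normc.normc (1 - dotc z w) <= d.+1%:R.
Proof.
move=> z1 w1; rewrite (le_trans (le_normcD _ _))// Normc.normc1 -natr1 addrC lerD2r.
rewrite normcN (le_trans (normc_sum _ _ _))//.
apply: (@le_trans _ _ (\sum_(j < d) 1)).
  apply: ler_sum => j _; rewrite Normc.normcM normc_conj.
  by rewrite mulr_ile1 ?normc_ge0// normc_coord_le.
by rewrite sumr_const card_ord.
Qed.

Lemma dist_gt0 z w : nrm2 z < 1 -> nrm2 w < 1 -> 0 < Normc.normc (1 - dotc z w).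
Proof.
move=> z1 w1; have := two_dist_ge z w.
have : 0 <= \sum_(j < d) Normc.normc (tnth z j - tnth w j) ^+ 2.
  by apply: sumr_ge0 => k _; exact: sqr_ge0.
lra.
Qed.

Lemma Re_dist_gt0 z w : nrm2 z < 1 -> nrm2 w < 1 -> 0 < complex.Re (1 - dotc z w).
Proof.
move=> z1 w1; have := Re_dotc z w.
have : 0 <= \sum_(j < d) Normc.normc (tnth z j - tnth w j) ^+ 2.
  by apply: sumr_ge0 => k _; exact: sqr_ge0.
rewrite (_ : complex.Re (1 - dotc z w) = 1 - complex.Re (dotc z w)); last by case: (dotc z w).
lra.
Qed.

End geometry.

Section measurability2.
Variables (R : realType) (d : nat).

Lemma measurable_nrm2 : measurable_fun setT (@nrm2 R d).
Proof.
apply: measurable_sum => j.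
exact: (measurableT_comp (@measurable_normc2 R) (measurable_tnth j)).
Qed.

Let mtnth1 j dd (T : measurableType dd) (f : T -> Cn R d) : measurable_fun setT f ->
  measurable_fun setT (fun x => complex.Re (tnth (f x) j)).
Proof.
move=> mf.
apply: (measurableT_comp (@measurable_complex_Re R)).
exact: (measurableT_comp (measurable_tnth j)).
Qed.

Let mtnth2 j dd (T : measurableType dd) (f : T -> Cn R d) : measurable_fun setT f ->
  measurable_fun setT (fun x => complex.Im (tnth (f x) j)).
Proof.
move=> mf.
apply: (measurableT_comp (@measurable_complex_Im R)).
exact: (measurableT_comp (measurable_tnth j)).
Qed.

Lemma measurable_Re_dist :
  measurable_fun setT (fun p : Cn R d * Cn R d => complex.Re (1 - dotc p.1 p.2)).
Proof.
rewrite (_ : (fun p => _) = (fun p : Cn R d * Cn R d => 1 - \sum_(j < d)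
   (complex.Re (tnth p.1 j) * complex.Re (tnth p.2 j) +
    complex.Im (tnth p.1 j) * complex.Im (tnth p.2 j)))); last first.
  apply/funext => p; rewrite -[RHS]/(complex.Re (1 : R[i]) - _).
  transitivity (complex.Re (1 : R[i]) - complex.Re (dotc p.1 p.2)).
    by case: (dotc p.1 p.2).
  congr (_ - _); rewrite /dotc complex_Re_sum; apply: eq_bigr => j _.
  rewrite complex_ReM; case: (tnth p.2 j) => a b /=; ring.
apply: measurable_funB; first exact: measurable_cst.
apply: measurable_sum => j; apply: measurable_funD; apply: measurable_funM.
- by apply: mtnth1; exact: measurable_fst.
- by apply: mtnth1; exact: measurable_snd.
- by apply: mtnth2; exact: measurable_fst.
- by apply: mtnth2; exact: measurable_snd.
Qed.

Lemma measurable_Im_dist :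
  measurable_fun setT (fun p : Cn R d * Cn R d => complex.Im (1 - dotc p.1 p.2)).
Proof.
rewrite (_ : (fun p => _) = (fun p : Cn R d * Cn R d => \sum_(j < d)
   (complex.Re (tnth p.1 j) * complex.Im (tnth p.2 j) -
    complex.Im (tnth p.1 j) * complex.Re (tnth p.2 j)))); last first.
  apply/funext => p.
  transitivity (- complex.Im (dotc p.1 p.2)).
    by case: (dotc p.1 p.2) => a b /=; rewrite sub0r.
  rewrite /dotc complex_Im_sum -sumrN; apply: eq_bigr => j _.
  rewrite complex_ImM; case: (tnth p.2 j) => a b /=; ring.
apply: measurable_sum => j; apply: measurable_funB; apply: measurable_funM.
- by apply: mtnth1; exact: measurable_fst.
- by apply: mtnth2; exact: measurable_snd.
- by apply: mtnth2; exact: measurable_fst.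
- by apply: mtnth1; exact: measurable_snd.
Qed.

Lemma measurable_dist_pair :
  measurable_fun setT (fun p : Cn R d * Cn R d => 1 - dotc p.1 p.2).
Proof.
apply: measurable_fun_complex => //.
- exact: measurable_Re_dist.
- exact: measurable_Im_dist.
Qed.

Lemma measurable_dist :
  measurable_fun setT (fun p : Cn R d * Cn R d => Normc.normc (1 - dotc p.1 p.2)).
Proof. exact: (measurableT_comp (@measurable_normc R) measurable_dist_pair). Qed.

End measurability2.

(** * Slicing the Lebesgue measure of C^d *)

Section slices.
Local Open Scope ereal_scope.

Lemma product_measure_le1 d1 d2 (T1 : measurableType d1) (T2 : measurableType d2)
    (R : realType) (m1 : {sigma_finite_measure set T1 -> \bar R})
    (m2 : {sigma_finite_measure set T2 -> \bar R}) (G : set (T1 * T2))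
    (D : set T1) (N : \bar R) :
  measurable G -> measurable D -> 0 <= N -> G `<=` D `*` setT ->
  (forall x, D x -> m2 (xsection G x) <= N) -> (m1 \x m2) G <= N * m1 D.
Proof.
move=> mG mD N0 GD GN; rewrite /product_measure1.
have -> : \int[m1]_x (m2 \o xsection G) x = \int[m1]_(x in D) (m2 \o xsection G) x.
  rewrite [RHS]integral_mkcond; apply: eq_integral => x _.
  rewrite patchE; case: ifPn => // /negP; rewrite inE => nDx /=.
  rewrite (_ : xsection G x = set0) ?measure0//; apply/seteqP; split => // y.
  by rewrite /xsection/= inE => /GD[].
rewrite -integral_cst//; apply: ge0_le_integral => //.
by apply: (measurable_funS measurableT) => //; exact: measurable_fun_xsection.
Qed.

Lemma product_measure_le2 d1 d2 (T1 : measurableType d1) (T2 : measurableType d2)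
    (R : realType) (m1 : {sigma_finite_measure set T1 -> \bar R})
    (m2 : {sigma_finite_measure set T2 -> \bar R}) (G : set (T1 * T2))
    (D : set T2) (N : \bar R) :
  measurable G -> measurable D -> 0 <= N -> G `<=` setT `*` D ->
  (forall y, D y -> m1 (ysection G y) <= N) -> (m1 \x m2) G <= N * m2 D.
Proof.
move=> mG mD N0 GD GN.
(* [\x] is defined through sections over the first factor; uniqueness on rectangles permits slicing
   over the second. *)
rewrite (@product_measure_unique _ _ _ _ _ _ _ (m1 \x^ m2))//; last first.
  by move=> A B mA mB; exact: product_measure2E.
rewrite /= /product_measure2.
have -> : \int[m2]_x (m1 \o ysection G) x = \int[m2]_(x in D) (m1 \o ysection G) x.
  rewrite [RHS]integral_mkcond; apply: eq_integral => x _.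
  rewrite patchE; case: ifPn => // /negP; rewrite inE => nDx /=.
  rewrite (_ : ysection G x = set0) ?measure0//; apply/seteqP; split => // y.
  by rewrite /ysection/= inE => /GD[].
rewrite -integral_cst//; apply: ge0_le_integral => //.
by apply: (measurable_funS measurableT) => //; exact: measurable_fun_ysection.
Qed.

Definition tuple_update (T : Type) n (t : n.-tuple T) (j : 'I_n) (u : T) : n.-tuple T :=
  [tuple if k == j then u else tnth t k | k < n].

Lemma tuple_updateS (T : Type) n (x : T) (t : n.-tuple T) (j : 'I_n) (u : T) :
  tuple_update [tuple of x :: t] (lift ord0 j) u = [tuple of x :: tuple_update t j u].
Proof.
apply: eq_from_tnth => k; rewrite tnth_mktuple.
case: (unliftP ord0 k) => [k' ->|->].
  by rewrite !tnthS tnth_mktuple (inj_eq lift_inj).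
by rewrite -val_eqE.
Qed.

Lemma tuple_update0 (T : Type) n (x : T) (t : n.-tuple T) (u : T) :
  tuple_update [tuple of x :: t] ord0 u = [tuple of u :: t].
Proof.
apply: eq_from_tnth => k; rewrite tnth_mktuple.
case: (unliftP ord0 k) => [k' ->|->]; last by rewrite eqxx.
by rewrite -val_eqE/= !tnthS.
Qed.

(** Fubini for one distinguished coordinate: slices along j have measure at most N whatever the
    other entries, and each of these is confined to a set of measure at most M. Induction brings j
    to the head. *)
Lemma tuple_measure_slice d (T : measurableType d) (R : realType)
    (m : {sigma_finite_measure set T -> \bar R}) (M N : R) n (j : 'I_n)
    (E : set (n.-tuple T)) (D : 'I_n -> set T) :
  (0 <= M)%R -> (0 <= N)%R -> measurable E -> (forall k, measurable (D k)) ->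
  (forall k, m (D k) <= M%:E) ->
  (forall t, E t -> forall k, k != j -> D k (tnth t k)) ->
  (forall t, m [set u | E (tuple_update t j u)] <= N%:E) ->
  tuple_measure m n E <= (N * M ^+ n.-1)%:E.
Proof.
move=> M0 N0; elim: n j E D => [[]//|n IH] j E D mE mD DM ED EN.
have mF : measurable (@tcons _ T n @^-1` E).
  by rewrite -[X in measurable X]setTI; exact: (@measurable_tcons _ T n).
rewrite /= /transport /pushforward /prod_measure.
(* If j is in the tail, the head ranges over [D ord0] and induction bounds the sections. If j is the
   head, the order of integration is reversed and the tail ranges over a box. *)
case: (unliftP ord0 j) => [j' jE|jE].
  case: n j j' jE IH E D mE mD DM ED EN mF => [_ []//|n] j j' jE IH E D mE mD DM ED EN mF.
  rewrite /= exprSr mulrA EFinM.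
  apply: le_trans (_ : (N * M ^+ n)%:E * m (D ord0) <= _).
    apply: product_measure_le1 => //.
    - by rewrite lee_fin mulr_ge0// exprn_ge0.
    - move=> [x t] /= Ext; split => //=.
      have := ED _ Ext ord0; rewrite jE; apply.
      by rewrite -val_eqE.
    move=> x _.
    apply: (IH j' _ (fun k => D (lift ord0 k))) => //.
    - exact: measurable_xsection.
    - move=> t; rewrite /xsection/= inE => Ext k kj'.
      have := ED _ Ext (lift ord0 k); rewrite jE (inj_eq lift_inj) tnthS.
      exact.
    - move=> t; have := EN (tcons (x, t)); rewrite jE.
      congr (m _ <= _); apply/seteqP; split => u /=; rewrite /xsection/= inE/=;
      by rewrite /tcons/= tuple_updateS.
  by rewrite lee_wpmul2l// lee_fin mulr_ge0// exprn_ge0.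

rewrite /=.
pose D' := [set t : n.-tuple T | forall k, D (lift ord0 k) (tnth t k)].
have mD' : measurable D' by exact: (measurable_box (fun k => mD (lift ord0 k))).
rewrite EFinM.
apply: le_trans (_ : N%:E * tuple_measure m n D' <= _).
  apply: product_measure_le2 => //.
    move=> [x t] /= Ext; split => //= k.
    by have := ED _ Ext (lift ord0 k); rewrite jE tnthS; apply.
  (* [point] is a dummy head, overwritten by the update at [ord0]. *)
  move=> t _; have := EN (tcons (point, t)); rewrite jE.
  congr (m _ <= _); apply/seteqP; split => u /=; rewrite /ysection/= inE/=;
  by rewrite /tcons/= tuple_update0.
rewrite (tuple_measure_box _ (fun k => mD (lift ord0 k))) lee_wpmul2l//.
apply: (@le_trans _ _ (\prod_(k < n) M%:E)); last first.
  by rewrite prodEFin prodr_const card_ord.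
suff /andP[] : 0 <= \prod_(k < n) m (D (lift ord0 k)) <= \prod_(k < n) M%:E by [].
elim/big_rec2 : _ => [|k x y _ /andP[x0 xy]]; first by rewrite lee01 lexx.
by rewrite mule_ge0//= lee_pmul.
Qed.

End slices.

(** * Planar area from diameters *)

Section area.
Variable R : realType.

Lemma lebesgue_measure_diam (S : set R) (L : R) : 0 <= L -> measurable S ->
  (forall x y, S x -> S y -> x - y <= L) ->
  (lebesgue_measure S <= (2 * L)%:E)%E.
Proof.
move=> L0 mS SL; have [->|/set0P[a Sa]] := eqVneq S set0.
  by rewrite measure0 lee_fin mulr_ge0.
apply: (@le_trans _ _ (lebesgue_measure (`[a - L, a + L]%classic : set R))).
  apply: le_measure; rewrite ?inE//.
  move=> x Sx /=; rewrite in_itv/=.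
  have h1 := SL _ _ Sx Sa; have h2 := SL _ _ Sa Sx.
  by apply/andP; split; lra.
rewrite lebesgue_measure_itv/= lte_fin; case: ifPn => _; last first.
  by rewrite lee_fin mulr_ge0.
by rewrite -EFinB lee_fin; lra.
Qed.

(** The real parts fill at most an interval of length 2 L1 about one of them, and each vertical
    slice has measure at most 2 L2. The second diameter is required only within slices, which is
    what makes the bound effective for thin curved sets. *)
Lemma complex_lebesgue_diam_ReIm (F : set R[i]) (L1 L2 : R) :
  0 <= L1 -> 0 <= L2 -> measurable F ->
  (forall u v, F u -> F v -> complex.Re u - complex.Re v <= L1) ->
  (forall u v, F u -> F v -> complex.Re u = complex.Re v ->
    complex.Im u - complex.Im v <= L2) ->
  (complex_lebesgue R F <= (4 * L1 * L2)%:E)%E.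
Proof.
move=> L10 L20 mF F1 F2; have [->|/set0P[a Fa]] := eqVneq F set0.
  by rewrite measure0 lee_fin !mulr_ge0.
rewrite /complex_lebesgue/= /transport /pushforward /prod_measure.
pose D : set (measurableTypeR R) := `[complex.Re a - L1, complex.Re a + L1]%classic.
apply: (@le_trans _ _ ((2 * L2)%:E * lebesgue_measure D)%E).
  apply: product_measure_le1 => //.
  - exact: measurable_itv.
  - by rewrite lee_fin mulr_ge0.
  - move=> [x y] /= Fxy; split => //; rewrite /D/= in_itv/=.
    by have := F1 _ _ Fxy Fa; have := F1 _ _ Fa Fxy => /= *; apply/andP; split; lra.
  - move=> x _; apply: lebesgue_measure_diam => //.
      exact: measurable_xsection.
    move=> y y'; rewrite /xsection/= !inE/= => Fy Fy'.
    exact: (F2 _ _ Fy Fy').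
rewrite lebesgue_measure_itv/= lte_fin; case: ifPn => _; last first.
  by rewrite mule0 lee_fin !mulr_ge0.
by rewrite -EFinB -EFinM lee_fin; lra.
Qed.

Lemma complex_lebesgue_diam_ImRe (F : set R[i]) (L1 L2 : R) :
  0 <= L1 -> 0 <= L2 -> measurable F ->
  (forall u v, F u -> F v -> complex.Im u - complex.Im v <= L1) ->
  (forall u v, F u -> F v -> complex.Im u = complex.Im v ->
    complex.Re u - complex.Re v <= L2) ->
  (complex_lebesgue R F <= (4 * L1 * L2)%:E)%E.
Proof.
move=> L10 L20 mF F1 F2; have [->|/set0P[a Fa]] := eqVneq F set0.
  by rewrite measure0 lee_fin !mulr_ge0.
rewrite /complex_lebesgue/= /transport /pushforward /prod_measure.
pose D : set (measurableTypeR R) := `[complex.Im a - L1, complex.Im a + L1]%classic.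
apply: (@le_trans _ _ ((2 * L2)%:E * lebesgue_measure D)%E).
  apply: product_measure_le2 => //.
  - exact: measurable_itv.
  - by rewrite lee_fin mulr_ge0.
  - move=> [x y] /= Fxy; split => //; rewrite /D/= in_itv/=.
    by have := F1 _ _ Fxy Fa; have := F1 _ _ Fa Fxy => /= *; apply/andP; split; lra.
  - move=> x _; apply: lebesgue_measure_diam => //.
      exact: measurable_ysection.
    move=> y y'; rewrite /ysection/= !inE/= => Fy Fy'.
    exact: (F2 _ _ Fy Fy').
rewrite lebesgue_measure_itv/= lte_fin; case: ifPn => _; last first.
  by rewrite mule0 lee_fin !mulr_ge0.
by rewrite -EFinB -EFinM lee_fin; lra.
Qed.

Definition cdisc (c : R[i]) (r : R) : set R[i] := [set u | Normc.normc (u - c) < r].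

Lemma measurable_cdisc (c : R[i]) (r : R) : measurable (cdisc c r).
Proof.
have mf : measurable_fun setT (fun u : R[i] => Normc.normc (u - c)).
  apply: (measurableT_comp (@measurable_normc R)).
  apply: measurable_fun_complex => //.
    rewrite (_ : (fun _ => _) = fun u : R[i] => complex.Re u - complex.Re c).
      apply: measurable_funB => //; exact: measurable_complex_Re.
    by apply/funext => u; case: u c => [? ?] [].
  rewrite (_ : (fun _ => _) = fun u : R[i] => complex.Im u - complex.Im c).
    apply: measurable_funB => //; exact: measurable_complex_Im.
  by apply/funext => u; case: u c => [? ?] [].
rewrite (_ : cdisc c r = setT `&` (fun u : R[i] => Normc.normc (u - c)) @^-1` `]-oo, r[).
  exact: mf.
by rewrite setTI; apply/seteqP; split => u /=; rewrite in_itv.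
Qed.

Lemma complex_lebesgue_disc (c : R[i]) (r : R) : 0 <= r ->
  (complex_lebesgue R (cdisc c r) <= (16 * r ^+ 2)%:E)%E.
Proof.
(* A disc of radius r has extent at most 2 r in both directions. *)
move=> r0; rewrite (_ : 16 * r ^+ 2 = 4 * (2 * r) * (2 * r)); last by ring.
have diff (u v : R[i]) : Normc.normc (u - c) < r -> Normc.normc (v - c) < r ->
    Normc.normc (u - v) <= 2 * r.
  move=> ur vr; rewrite (_ : u - v = (u - c) - (v - c)); last by ring.
  by rewrite (le_trans (le_normcD _ _))// normcN; lra.
apply: complex_lebesgue_diam_ReIm.
- by rewrite mulr_ge0.
- by rewrite mulr_ge0.
- exact: measurable_cdisc.
- move=> u v /= ur vr; apply: le_trans (diff _ _ ur vr).
  apply: le_trans (Re_le_normc _); rewrite (le_trans _ (ler_norm _))//.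
  by case: u v {ur vr} => [? ?] [].
- move=> u v /= ur vr _; apply: le_trans (diff _ _ ur vr).
  apply: le_trans (Im_le_normc _); rewrite (le_trans _ (ler_norm _))//.
  by case: u v {ur vr} => [? ?] [].
Qed.

End area.

(** * Volume of the shells *)

Section volume.
Variable R : realType.

Lemma measure_bigsetU_le d (T : measurableType d) (m : {measure set T -> \bar R})
    (I : Type) (s : seq I) (A : I -> set T) : (forall i, measurable (A i)) ->
  (m (\big[setU/set0]_(i <- s) A i) <= \sum_(i <- s) m (A i))%E.
Proof.
move=> mA; elim: s => [|i s IH]; first by rewrite !big_nil measure0.
rewrite !big_cons (le_trans (measureU2 _ _ _))//.
  exact: bigsetU_measurable.
exact: leeD2l.
Qed.

(* The real numbers Re u, - Re u, Im u and - Im u, indexed by e. *)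
Definition side (e : bool * bool) (u : R[i]) : R :=
  (if e.1 then 1 else - 1) * (if e.2 then complex.Re u else complex.Im u).

Lemma measurable_side e : measurable_fun setT (side e).
Proof.
apply: measurable_funM; first exact: measurable_cst.
case: e.2; first exact: measurable_complex_Re.
exact: measurable_complex_Im.
Qed.

(** Both numbers have the same sign and modulus at least c, so |x + y| >= 2 c; divide x^2 - y^2 = (x
    - y)(x + y) by it. *)
Lemma sqr_gap (x y c t : R) (s : bool) : 0 < c ->
  c <= (if s then 1 else -1) * x -> c <= (if s then 1 else -1) * y ->
  x ^+ 2 - y ^+ 2 <= t -> y ^+ 2 - x ^+ 2 <= t -> x - y <= t / c.
Proof.
move=> c0 xc yc h h'; rewrite ler_pdivlMr//.
case: s xc yc => xc yc; nra.
Qed.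

(** Freeze the part of u not selected by e. The selected part then has its square in an interval of
    length t while staying at least c away from 0, so by [sqr_gap] it moves by at most t / c. In the
    other direction only the diameter L is used. *)
Lemma side_area (F : set R[i]) (e : bool * bool) (L c t a : R) :
  0 < c -> 0 <= t -> 0 <= L -> measurable F ->
  (forall u, F u -> c <= side e u) ->
  (forall u v, F u -> F v -> Normc.normc (u - v) <= L) ->
  (forall u, F u -> a - t < Normc.normc u ^+ 2 < a) ->
  (complex_lebesgue R F <= (4 * L * (t / c))%:E)%E.
Proof.
move=> c0 t0 L0 mF Fc FL Fa.
have tc0 : 0 <= t / c by rewrite divr_ge0// ltW.
case: e Fc => s [] Fc.
  apply: complex_lebesgue_diam_ImRe => //.
    move=> u v Fu Fv; apply: le_trans (FL _ _ Fu Fv).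
    apply: le_trans (Im_le_normc _); rewrite (le_trans _ (ler_norm _))//.
    by case: u v {Fu Fv} => [? ?] [].
  move=> u v Fu Fv uv; have := Fc _ Fu; have := Fc _ Fv; rewrite /side/=.
  have := Fa _ Fu; have := Fa _ Fv; rewrite !normc_sqr uv => /andP[? ?] /andP[? ?] h1 h2.
  apply: (sqr_gap c0 h2 h1); lra.
apply: complex_lebesgue_diam_ReIm => //.
  move=> u v Fu Fv; apply: le_trans (FL _ _ Fu Fv).
  apply: le_trans (Re_le_normc _); rewrite (le_trans _ (ler_norm _))//.
  by case: u v {Fu Fv} => [? ?] [].
move=> u v Fu Fv uv; have := Fc _ Fu; have := Fc _ Fv; rewrite /side/=.
have := Fa _ Fu; have := Fa _ Fv; rewrite !normc_sqr uv => /andP[? ?] /andP[? ?] h1 h2.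
apply: (sqr_gap c0 h2 h1); lra.
Qed.

Variable d : nat.
Local Notation m := (Cn_lebesgue R d).

Lemma measurable_tuple_update n (t : Cn R n) (j : 'I_n) :
  measurable_fun setT (fun u : R[i] => tuple_update t j u).
Proof.
apply/measurable_fun_tnthP => k.
rewrite (_ : _ \o _ = fun u => if k == j then u else tnth t k).
  by case: eqP => _; [exact: measurable_id|exact: measurable_cst].
by apply/funext => u /=; rewrite tnth_mktuple.
Qed.

Lemma nrm2_update (t : Cn R d) j u : nrm2 (tuple_update t j u) =
  Normc.normc u ^+ 2 + \sum_(k < d | k != j) Normc.normc (tnth t k) ^+ 2.
Proof.
rewrite /nrm2 (bigD1 j)//= tnth_mktuple eqxx; congr (_ + _).
by apply: eq_bigr => k kj; rewrite tnth_mktuple (negbTE kj).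
Qed.

Lemma dotc_update (z t : Cn R d) j u v :
  dotc z (tuple_update t j u) - dotc z (tuple_update t j v) = tnth z j * conjc (u - v).
Proof.
rewrite /dotc (bigD1 j)//= [X in _ - X](bigD1 j)//= !tnth_mktuple eqxx.
rewrite (eq_bigr (fun k => tnth z k * conjc (tnth t k))); last first.
  by move=> k kj; rewrite tnth_mktuple (negbTE kj).
rewrite [X in _ - (_ + X)](eq_bigr (fun k => tnth z k * conjc (tnth t k))); last first.
  by move=> k kj; rewrite tnth_mktuple (negbTE kj).
by rewrite opprD addrACA subrr addr0 -mulrBr rmorphB.
Qed.

(** Slicing along coordinate j turns the condition on 1 - |w|^2 into a thin planar annulus, to which
    [side_area] applies; this produces the factor t. *)
Lemma side_piece (E : set (Cn R d)) (D : 'I_d -> set R[i]) (j : 'I_d) (e : bool * bool)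
    (M L c t : R) :
  0 <= M -> 0 < c -> 0 <= t -> 0 <= L -> measurable E ->
  (forall k, measurable (D k)) -> (forall k, complex_lebesgue R (D k) <= M%:E)%E ->
  (forall w, E w -> [/\ c <= side e (tnth w j), 1 - nrm2 w < t & nrm2 w < 1]) ->
  (forall w, E w -> forall k, D k (tnth w k)) ->
  (forall w u v, E (tuple_update w j u) -> E (tuple_update w j v) ->
    Normc.normc (u - v) <= L) ->
  (m E <= (4 * L * (t / c) * M ^+ d.-1)%:E)%E.
Proof.
move=> M0 c0 t0 L0 mE mD DM Ew ED EL.
have tc0 : 0 <= t / c by rewrite divr_ge0// ltW.
apply: (tuple_measure_slice (j := j) (D := D)) => //.
- by apply: mulr_ge0 => //; apply: mulr_ge0.
- by move=> w Ew' k _; exact: ED.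
move=> w.
(* The squared outer radius of the annulus: the slice leaves the ball where |u|^2 = a. *)
pose a := 1 - \sum_(k < d | k != j) Normc.normc (tnth w k) ^+ 2.
apply: (@side_area _ e _ _ _ a) => //.
- rewrite -[X in measurable X]setTI.
  exact: (measurable_tuple_update w j).
- by move=> u /= /Ew[]; rewrite tnth_mktuple eqxx.
- by move=> u v /=; exact: EL.
- move=> u /= /Ew[_]; rewrite nrm2_update /a => h1 h2.
  by apply/andP; split; lra.
Qed.

(** A nonisotropic ball about z, cut down to a collar of the unit sphere. *)
Definition shell (z : Cn R d) (delta t : R) : set (Cn R d) :=
  [set w | [/\ nrm2 w < 1, Normc.normc (1 - dotc z w) < delta & 1 - nrm2 w < t]].

Lemma measurable_dist2 (z : Cn R d) :
  measurable_fun setT (fun w => Normc.normc (1 - dotc z w)).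
Proof.
exact: (measurableT_comp (@measurable_dist R d) (pair1_measurable z)).
Qed.

Lemma measurable_ltfun dd (T : measurableType dd) (f g : T -> R) :
  measurable_fun setT f -> measurable_fun setT g -> measurable [set x | f x < g x].
Proof.
move=> mf mg; rewrite (_ : mkset _ = setT `&` (fun x => f x < g x) @^-1` [set true]).
  exact: measurable_fun_ltr.
by rewrite setTI.
Qed.

Lemma measurable_lefun dd (T : measurableType dd) (f g : T -> R) :
  measurable_fun setT f -> measurable_fun setT g -> measurable [set x | f x <= g x].
Proof.
move=> mf mg; rewrite (_ : mkset _ = setT `&` (fun x => f x <= g x) @^-1` [set true]).
  exact: measurable_fun_ler.
by rewrite setTI.
Qed.

Lemma measurable_shell z delta t : measurable (shell z delta t).
Proof.
rewrite (_ : shell z delta t = [set w | nrm2 w < 1] `&`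
   ([set w | Normc.normc (1 - dotc z w) < delta] `&` [set w | 1 - nrm2 w < t])).
  apply: measurableI; first exact: measurable_cball.
  apply: measurableI; apply: measurable_ltfun => //.
    exact: measurable_dist2.
  by apply: measurable_funB => //; exact: measurable_nrm2.
by apply/seteqP; split => w /=; [move=> []|move=> [? []]].
Qed.

(** If all real and imaginary parts were below 1/(2d) in modulus, |w|^2 would be at most 2 d /
    (2d)^2 = 1/(2d) <= 1/2. *)
Lemma exists_side (w : Cn R d) : (0 < d)%N -> 1 / 2 < nrm2 w ->
  exists j e, (2 * d%:R)^-1 <= side e (tnth w j).
Proof.
move=> d0 hw; apply: contrapT => /forallNP h.
have {}h j e : side e (tnth w j) < (2 * d%:R)^-1.
  by rewrite ltNge; apply/negP => h'; apply: (h j); exists e.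
have dR : 1 <= d%:R :> R by rewrite ler1n.
have c0 : 0 < (2 * d%:R)^-1 :> R by rewrite invr_gt0 mulr_gt0// ltr0n.
have : nrm2 w <= \sum_(j < d) (2 * (2 * d%:R)^-1 ^+ 2).
  apply: ler_sum => j _; rewrite normc_sqr.
  have := h j (true, true); have := h j (false, true).
  have := h j (true, false); have := h j (false, false).
  rewrite /side/= => h1 h2 h3 h4.
  set c := _^-1 in h1 h2 h3 h4 c0 *; nra.
rewrite sumr_const card_ord => h'.
have : 2 * (2 * d%:R)^-1 ^+ 2 *+ d = (2 * d%:R)^-1 :> R.
  rewrite -mulr_natr; field; rewrite pnatr_eq0; lia.
have : (2 * d%:R)^-1 <= 1/2 :> R.
  by rewrite ler_pdivlMr// mulrC ler_pdivrMr ?mulr_gt0 ?ltr0n// mul1r; lra.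
lra.
Qed.

Definition shell_piece (z : Cn R d) (delta t : R) (i : 'I_d * (bool * bool)) :
    set (Cn R d) :=
  shell z delta t `&` [set w | (2 * d%:R)^-1 <= side i.2 (tnth w i.1)].

Lemma measurable_shell_piece z delta t i : measurable (shell_piece z delta t i).
Proof.
apply: measurableI; first exact: measurable_shell.
apply: measurable_lefun; first exact: measurable_cst.
exact: (measurableT_comp (measurable_side i.2) (measurable_tnth i.1)).
Qed.

Lemma shell_sides (z : Cn R d) (delta t : R) : (0 < d)%N -> t <= 1/2 ->
  shell z delta t `<=` \big[setU/set0]_(i <- enum [set: 'I_d * (bool * bool)])
    shell_piece z delta t i.
Proof.
move=> d0 t1 w [w1 wd wt].
have [|j [e je]] := exists_side (w := w) d0; first by lra.
rewrite -bigcup_seq; exists (j, e) => //=.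
by rewrite mem_enum inE.
Qed.

(** Changing only coordinate j moves <z, w> by z_j times the conjugate of u - v. When |z_j| is
    bounded below, the slice thus has diameter of order delta, against sqrt(delta) in
    [shell_near]. *)
Lemma shell_slice (z w : Cn R d) j u v (delta : R) :
  Normc.normc (1 - dotc z (tuple_update w j u)) < delta ->
  Normc.normc (1 - dotc z (tuple_update w j v)) < delta ->
  Normc.normc (tnth z j) * Normc.normc (u - v) <= 2 * delta.
Proof.
move=> hu hv; rewrite -(normc_conj (u - v)) -Normc.normcM -(dotc_update z w).
rewrite (_ : _ - _ = (1 - dotc z (tuple_update w j v)) - (1 - dotc z (tuple_update w j u))).
  by rewrite (le_trans (le_normcD _ _))// normcN; lra.
by ring.
Qed.

Lemma shell_near (z w : Cn R d) (delta : R) k : nrm2 z < 1 -> nrm2 w < 1 ->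
  Normc.normc (1 - dotc z w) < delta ->
  Normc.normc (tnth w k - tnth z k) ^+ 2 < 2 * delta.
Proof.
move=> z1 w1 hd; have := two_dist_ge z w.
rewrite (bigD1 k)//= => h.
have : 0 <= \sum_(i < d | i != k) Normc.normc (tnth z i - tnth w i) ^+ 2.
  by apply: sumr_ge0 => i _; exact: sqr_ge0.
by rewrite -(opprB (tnth z k)) normcN; lra.
Qed.

Lemma side_le_normc e (u : R[i]) : side e u <= Normc.normc u.
Proof.
have h1 := Re_le_normc u; have h2 := Im_le_normc u.
case: e => [] [] []; rewrite /side/= ?mul1r ?mulN1r.
- exact: le_trans (ler_norm _) h1.
- exact: le_trans (ler_norm _) h2.
- by apply: le_trans h1; rewrite -normrN ler_norm.
- by apply: le_trans h2; rewrite -normrN ler_norm.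
Qed.

Lemma normc_coord_lt (w : Cn R d) j : nrm2 w < 1 -> Normc.normc (tnth w j) < 1.
Proof.
move=> w1; rewrite -(@ltr_pXn2r _ 2)// ?nnegrE ?normc_ge0// expr1n.
apply: le_lt_trans w1; rewrite /nrm2 (bigD1 j)//= lerDl.
by apply: sumr_ge0 => k _; exact: sqr_ge0.
Qed.

(** The shell is covered by 4 d pieces, on each of which one part of one coordinate is large. The
    power delta^d is made of one delta from the slice along that coordinate and one from each of the
    d - 1 remaining discs. *)
Lemma shell_volume : (0 < d)%N -> exists2 C : R, 0 <= C &
  forall z delta t, nrm2 z < 1 -> 0 < delta -> 0 < t -> t <= 2 * delta ->
  (m (shell z delta t) <= (C * delta ^+ d * t)%:E)%E.
Proof.
move=> d0.
pose c : R := (2 * d%:R)^-1.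
have c0 : 0 < c by rewrite invr_gt0 mulr_gt0// ltr0n.
pose P : R := (size (enum [set: 'I_d * (bool * bool)]))%:R.
have P0 : 0 <= P by rewrite ler0n.
have sides z delta t B : 0 <= B -> t <= 1/2 ->
    (forall i, (m (shell_piece z delta t i) <= B%:E)%E) ->
    (m (shell z delta t) <= (P * B)%:E)%E.
  move=> B0 t1 mB; apply: le_trans.
    apply: (le_measure _ _ _ (shell_sides d0 t1)); rewrite ?inE//.
      exact: measurable_shell.
    by apply: bigsetU_measurable => i _; exact: measurable_shell_piece.
  apply: le_trans; first exact: measure_bigsetU_le (@measurable_shell_piece z delta t).
  apply: le_trans; first by apply: lee_sum => i _; exact: mB.
  rewrite sumEFin lee_fin big_const_seq count_predT iter_addr_0 /P mulr_natl.
  by [].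
have mle z delta t i M L D : 0 <= M -> 0 < t -> 0 <= L ->
  (forall k, measurable (D k)) -> (forall k, complex_lebesgue R (D k) <= M%:E)%E ->
  (forall w, shell_piece z delta t i w -> forall k, D k (tnth w k)) ->
  (forall w u v, shell_piece z delta t i (tuple_update w i.1 u) ->
    shell_piece z delta t i (tuple_update w i.1 v) -> Normc.normc (u - v) <= L) ->
  (m (shell_piece z delta t i) <= (4 * L * (t / c) * M ^+ d.-1)%:E)%E.
  move=> M0 t0 L0 mD DM ED EL; apply: (side_piece (j := i.1) (e := i.2) (D := D)) => //.
  - exact: ltW.
  - exact: measurable_shell_piece.
  - by move=> w [[? ? ?] ?]; split.
have /andP[_ Boo] := @Cn_lebesgue_cball R d.
pose K := fine (m (@cball R d)).
have KE : m (@cball R d) = K%:E by rewrite fineK// ge0_fin_numE.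
have K0 : 0 <= K by exact: fine_ge0.
(* With sqrt(2 delta0) = c / 2, a coordinate of w of modulus at least c forces the same coordinate
   of z to have modulus at least c / 2. *)
pose delta0 := c ^+ 2 / 8.
have delta00 : 0 < delta0 by rewrite divr_gt0// exprn_gt0.
(* One constant for each regime: t >= 1/2; t < 1/2 and delta < delta0; t < 1/2 and delta >=
   delta0. *)
pose C1 := K * 4 ^+ d * 2.
pose C2 := P * (16 / c ^+ 2 * 32 ^+ d.-1).
pose C3 := P * (8 / c * 16 ^+ d.-1 / delta0 ^+ d).
have C10 : 0 <= C1 by rewrite /C1 !mulr_ge0// exprn_ge0.
have C20 : 0 <= C2 by rewrite /C2 !mulr_ge0 ?exprn_ge0// invr_ge0 exprn_ge0// ltW.
have C30 : 0 <= C3.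
  by rewrite /C3 !mulr_ge0 ?exprn_ge0 ?invr_ge0 ?exprn_ge0// ltW.
exists (C1 + C2 + C3); first by rewrite !addr_ge0.
move=> z delta t z1 delta_gt0 t0 t2.
have dt0 : 0 <= delta ^+ d * t by rewrite mulr_ge0 ?exprn_ge0// ltW.
have final x : x <= C1 * (delta ^+ d * t) \/ x <= C2 * (delta ^+ d * t)
    \/ x <= C3 * (delta ^+ d * t) -> x <= (C1 + C2 + C3) * delta ^+ d * t.
  rewrite -mulrA !mulrDl.
  have := mulr_ge0 C10 dt0; have := mulr_ge0 C20 dt0; have := mulr_ge0 C30 dt0.
  by move=> ? ? ?; case=> [|[|]]; lra.
(* For t >= 1/2 also delta >= t / 2 >= 1/4, so (4 delta)^d (2 t) >= 1 and the volume K of the whole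
   ball suffices. *)
have [t1|t1] := leP (1/2) t.
  apply: (@le_trans _ _ (m (@cball R d))).
    apply: le_measure; rewrite ?inE//.
    - exact: measurable_shell.
    - exact: measurable_cball.
    - by move=> w [].
  rewrite KE lee_fin; apply: final; left.
  rewrite /C1 (_ : _ * _ = K * ((4 * delta) ^+ d * (2 * t))); last first.
    by rewrite exprMn; ring.
  rewrite ler_peMr// mulr_ege1 ?exprn_ege1//; lra.
have [hd|hd] := ltP delta delta0.
  (* The slice has diameter at most 4 delta / c and thickness t / c; the other coordinates lie in
     discs of radius sqrt(2 delta), of area at most 32 delta. *)
  apply: (@le_trans _ _
    (P * (4 * (4 * delta / c) * (t / c) * (32 * delta) ^+ d.-1))%:E); last first.
    rewrite lee_fin; apply: final; right; left; rewrite /C2 le_eqVlt; apply/orP; left; apply/eqP.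
    rewrite (_ : delta ^+ d = delta * delta ^+ d.-1); last by rewrite -exprS prednK.
    by rewrite exprMn; field; rewrite gt_eqF.
  apply: sides.
  - rewrite !mulr_ge0 ?exprn_ge0 ?mulr_ge0 ?invr_ge0//; exact: ltW.
  - exact: ltW.
  move=> i.
  apply: (mle _ _ _ _ _ _ (fun k => cdisc (tnth z k) (Num.sqrt (2 * delta)))) => //.
  - by rewrite mulr_ge0// ltW.
  - by rewrite !mulr_ge0 ?invr_ge0//; exact: ltW.
  - by move=> k; exact: measurable_cdisc.
  - move=> k; apply: le_trans; first exact/complex_lebesgue_disc/sqrtr_ge0.
    rewrite sqr_sqrtr ?lee_fin; first by lra.
    by rewrite mulr_ge0// ltW.
  - move=> w [[w1 wd wt] _] k; rewrite /cdisc/= -(@ltr_pXn2r _ 2)// ?nnegrE ?normc_ge0//.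
    rewrite sqr_sqrtr; last by rewrite mulr_ge0// ltW.
    exact: shell_near wd.
  - move=> w u v [[u1 ud ut] us] [[v1 vd vt] vs].
    have h := shell_slice ud vd.
    have hz : c / 2 <= Normc.normc (tnth z i.1).
      have := shell_near i.1 z1 u1 ud.
      move: us; rewrite /= tnth_mktuple eqxx -/c => us.
      have uc : c <= Normc.normc u by exact: le_trans us (side_le_normc _ _).
      have := le_normcD (tnth z i.1) (u - tnth z i.1).
      rewrite addrC subrK => h3 h4.
      have : Normc.normc (u - tnth z i.1) < c / 2.
        rewrite -(@ltr_pXn2r _ 2)// ?nnegrE ?normc_ge0//; last by rewrite divr_ge0// ltW.
        rewrite (_ : (c / 2) ^+ 2 = c ^+ 2 / 4); last by field.
        by apply: lt_trans h4 _; move: hd; rewrite /delta0; lra.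
      lra.
    rewrite ler_pdivlMr//.
    have := normc_ge0 (u - v); nra.
(* For large delta, slices of diameter 2 and unit discs of area at most 16 are enough; the factor
   (delta / delta0)^d >= 1 restores the power of delta. *)
apply: (@le_trans _ _ (P * (4 * 2 * (t / c) * 16 ^+ d.-1))%:E); last first.
  rewrite lee_fin; apply: final; right; right; rewrite /C3.
  rewrite (_ : _ * (delta ^+ d * t) =
    P * (4 * 2 * (t / c) * 16 ^+ d.-1) * (delta / delta0) ^+ d).
    rewrite ler_peMr//.
      rewrite !mulr_ge0 ?exprn_ge0 ?invr_ge0//; exact: ltW.
    by rewrite exprn_ege1// ler_pdivlMr// mul1r.
  have : delta0 ^+ d != 0 by rewrite gt_eqF// exprn_gt0.
  rewrite (expr_div_n delta delta0); move: (delta0 ^+ d) (delta ^+ d) (16 ^+ d.-1) => a b e a0.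
  by field; rewrite a0 gt_eqF.
apply: sides.
- rewrite !mulr_ge0 ?exprn_ge0 ?mulr_ge0 ?invr_ge0//; exact: ltW.
- exact: ltW.
move=> i.
apply: (mle _ _ _ _ _ _ (fun k => cdisc 0 1)) => //.
- by move=> k; exact: measurable_cdisc.
- move=> k; apply: le_trans; first exact/complex_lebesgue_disc.
  by rewrite lee_fin expr1n mulr1.
- move=> w [[w1 _ _] _] k; rewrite /cdisc/= subr0.
  exact: normc_coord_lt.
- move=> w u v [[u1 _ _] _] [[v1 _ _] _].
  have := normc_coord_lt i.1 u1; have := normc_coord_lt i.1 v1.
  rewrite !tnth_mktuple eqxx => h1 h2.
  by rewrite (le_trans (le_normcD _ _))// normcN; lra.
Qed.

End volume.

(** * Dyadic summation *)

Section dyadic.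
Variable R : realType.

Lemma nneseries_geometric_le (c x : R) : 0 <= c -> 0 <= x < 1 ->
  (\sum_(k <oo) (c * x ^+ k)%:E <= (c / (1 - x))%:E)%E.
Proof.
move=> c0 /andP[x0 x1].
have cx k : (0 <= (c * x ^+ k)%:E)%E by rewrite lee_fin mulr_ge0// exprn_ge0.
apply: lime_le; first exact: is_cvg_nneseries.
apply: nearW => n /=; rewrite sumEFin lee_fin -mulr_sumr ler_wpM2l//.
rewrite -[leRHS]mul1r ler_pdivlMr ?subr_gt0// big_mkord mulrC.
by rewrite -opprB mulNr -subrX1 opprB gerBl exprn_ge0.
Qed.

Lemma powR_expR (x a : R) : 0 < x -> x `^ a = expR (a * ln x).
Proof. by move=> x0; rewrite /powR gt_eqF. Qed.

Lemma ln2_gt0 : 0 < ln 2 :> R.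
Proof. by rewrite ln_gt0// ltr1n. Qed.

Lemma two_powR_lt1 (a : R) : a < 0 -> 2 `^ a < 1 :> R.
Proof. by move=> a0; rewrite powR_expR// expR_lt1 pmulr_llt0// ln2_gt0. Qed.

Lemma ln_dyadic (M : R) k : 0 < M -> ln (M * 2 ^+ k) = ln M + k%:R * ln 2.
Proof. by move=> M0; rewrite lnM ?posrE ?exprn_gt0// lnXn// mulr_natl. Qed.

Lemma ln_dyadicV (M : R) k : 0 < M -> ln (M * 2^-1 ^+ k) = ln M - k%:R * ln 2.
Proof.
move=> M0; rewrite exprVn lnM ?posrE ?invr_gt0 ?exprn_gt0//.
by rewrite lnV ?posrE ?exprn_gt0// lnXn// mulr_natl.
Qed.

Lemma ex_dyadic_down (M x : R) : 0 < x -> x < M ->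
  exists k, M * 2^-1 ^+ k.+1 <= x < M * 2^-1 ^+ k.
Proof.
move=> x0 xM; have M0 : 0 < M by exact: lt_trans xM.
have ex : exists n, M * 2^-1 ^+ n.+1 <= x.
  have [n hn] : exists n, M / x <= n%:R.
    exists (Num.truncn (M / x)).+1; rewrite ltW// truncnS_gt//.
  exists n; rewrite exprVn ler_pdivrMr ?exprn_gt0// mulrC -ler_pdivrMr//.
  rewrite (le_trans hn)// -natrX ler_nat.
  by rewrite (leq_trans (ltnW (ltn_expl n (ltnSn 1))))// leq_exp2l.
case: (ex_minnP ex) => n hn nmin; exists n; rewrite hn/=.
case: n hn nmin => [|n] hn nmin; first by rewrite expr0 mulr1.
by rewrite ltNge; apply/negP => /nmin; rewrite ltnn.
Qed.

Lemma ex_dyadic_up (r x : R) : 0 < r -> r <= x ->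
  exists k, r * 2 ^+ k <= x < r * 2 ^+ k.+1.
Proof.
move=> r0 rx.
have ex : exists n, x < r * 2 ^+ n.+1.
  exists (Num.truncn (x / r)); rewrite mulrC -ltr_pdivrMr//.
  have /lt_le_trans -> // : x / r < (Num.truncn (x / r)).+1%:R by rewrite truncnS_gt.
  rewrite -natrX ler_nat; exact: ltnW (ltn_expl _ (ltnSn 1)).
case: (ex_minnP ex) => n hn nmin; exists n; rewrite hn andbT.
case: n hn nmin => [|n] hn nmin; first by rewrite expr0 mulr1.
by rewrite leNgt; apply/negP => /nmin; rewrite ltnn.
Qed.

Variables (dd : measure_display) (T : measurableType dd) (mu : {measure set T -> \bar R}).
Variables (E : set T) (G phi : T -> R) (b : R).
Hypotheses (mE : measurable E) (mG : measurable_fun setT G) (mphi : measurable_fun setT phi).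
Hypotheses (G0 : forall x, 0 <= G x) (b0 : 0 <= b).

(** Where phi lies between tau k and 2 tau k, the power phi^(-b) is at most tau_k^(-b). Each point
    needs one such k, the other terms being nonnegative; layers are enlarged to sublevel sets, so
    that bounds on the latter are all that enters. *)
Lemma dyadic_integral (tau : nat -> R) : (forall k, 0 < tau k) ->
  (forall x, E x -> exists k, tau k <= phi x < 2 * tau k) ->
  (\int[mu]_(x in E) (G x * phi x `^ (- b))%:E <=
   \sum_(k <oo) (tau k `^ (- b))%:E *
     \int[mu]_(x in E `&` [set x | (phi x < 2 * tau k)%R]) (G x)%:E)%E.
Proof.
move=> tau0 Etau.
pose S k := E `&` [set x | (phi x < 2 * tau k)%R].
have mS k : measurable (S k).
  by apply: measurableI => //; apply: measurable_ltfun.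
pose F k x := ((tau k `^ (- b))%:E * ((G x)%:E * (\1_(S k) x)%:E))%E.
have F0 k x : (0 <= F k x)%E.
  by rewrite /F -!EFinM lee_fin mulr_ge0 ?powR_ge0// mulr_ge0// indicE.
have mF k : measurable_fun setT (F k).
  apply: measurable_funeM; apply: emeasurable_funM; apply/measurable_EFinP => //.
apply: (@le_trans _ _ (\int[mu]_(x in E) \sum_(k <oo) F k x)%E).
  apply: ge0_le_integral => //.
  - by move=> x _; rewrite lee_fin mulr_ge0 ?powR_ge0.
  - apply: (measurable_funS measurableT) => //; apply/measurable_EFinP.
    apply: measurable_funM => //; exact: (measurableT_comp (measurable_powR _)).
  - by apply: (measurable_funS measurableT) => //; exact: ge0_emeasurable_sum.
  - move=> x Ex; have [k /andP[h1 h2]] := Etau x Ex.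
    have phi0 : 0 < phi x by exact: lt_le_trans h1.
    apply: le_trans (_ : F k x <= _)%E.
      rewrite /F -!EFinM lee_fin indicE mem_set ?mulr1//= mulrC ler_wpM2r//.
      by rewrite !powRN lef_pV2 ?posrE ?powR_gt0//; apply: ge0_ler_powR => //; rewrite nnegrE ltW.
    apply: le_trans (@nneseries_lim_ge _ (fun k => F k x) xpredT 0 k.+1 _) => //.
    by rewrite big_nat_recr//= leeDr// sume_ge0.
rewrite integral_nneseries//; last by move=> k; apply: (measurable_funS measurableT).
apply: lee_nneseries => [k _ _|k _]; first exact: integral_ge0.
rewrite /F ge0_integralZl//; last 3 first.
- by apply: (measurable_funS measurableT) => //; apply: emeasurable_funM; apply/measurable_EFinP.
- by move=> x _; rewrite -EFinM lee_fin mulr_ge0// indicE.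
- by rewrite lee_fin powR_ge0.
rewrite lee_wpmul2l ?lee_fin ?powR_ge0// integral_mkcondr le_eqVlt; apply/orP; left; apply/eqP.
apply: eq_integral => x; rewrite inE => Ex; rewrite patchE indicE.
have [xS|xS] := boolP (x \in [set x | phi x < 2 * tau k]).
  by rewrite mem_set ?mule1//; split => //; rewrite inE in xS.
rewrite memNset ?mule0// => -[_ /= xS']; move/negP: xS; apply; rewrite inE//.
Qed.

(** Singularity at phi = 0: the scales descend from M, and b < a makes the terms geometric of ratio
    2^(b - a), dominated by the largest scale. *)
Lemma dyadic_integral_down (A M a : R) : b < a -> 0 < M -> 0 <= A ->
  (forall x, E x -> 0 < phi x < M) ->
  (forall t, 0 < t <= M ->
    (\int[mu]_(x in E `&` [set x | (phi x < t)%R]) (G x)%:E <= (A * t `^ a)%:E)%E) ->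
  (\int[mu]_(x in E) (G x * phi x `^ (- b))%:E <=
    (2 `^ b / (1 - 2 `^ (b - a)) * A * M `^ (a - b))%:E)%E.
Proof.
move=> ba M0 A0 EM HA.
pose tau k : R := M * 2^-1 ^+ k.+1.
have tau0 k : 0 < tau k by rewrite mulr_gt0// exprn_gt0.
have tauE k : 2 * tau k = M * 2^-1 ^+ k by rewrite /tau exprS; field.
have x1 : 2 `^ (b - a) < 1 :> R.
  by apply: two_powR_lt1; rewrite subr_lt0.
apply: le_trans.
  apply: (@dyadic_integral tau) => // x /EM/andP[x0 xM].
  by have [k] := ex_dyadic_down x0 xM; exists k; rewrite tauE.
apply: (@le_trans _ _ (\sum_(k <oo) ((2 `^ b * A * M `^ (a - b)) * (2 `^ (b - a)) ^+ k)%:E)%E).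
  apply: lee_nneseries => [k _ _|k _].
    rewrite mule_ge0 ?lee_fin ?powR_ge0//; apply: integral_ge0 => x _; exact: G0.
  apply: le_trans.
    apply: lee_wpmul2l; first by rewrite lee_fin powR_ge0.
    apply: HA; rewrite mulr_gt0//= tauE ler_piMr ?(ltW M0)//.
    by rewrite exprn_ile1 ?invr_ge0// invf_le1// ler1n.
  rewrite -EFinM lee_fin tauE /tau le_eqVlt; apply/orP; left; apply/eqP.
  rewrite !powR_expR ?mulr_gt0 ?exprn_gt0 ?invr_gt0// ?ln_dyadicV ?ln_dyadic//.
  rewrite -expRM_natl -natr1 mulrCA -expRD [X in _ = X * _ * _]mulrC -!mulrA -!expRD.
  congr (_ * expR _).
  by ring.
apply: le_trans; first apply: nneseries_geometric_le.
- by rewrite !mulr_ge0 ?powR_ge0.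
- by rewrite powR_ge0.
by rewrite lee_fin le_eqVlt; apply/orP; left; apply/eqP; ring.
Qed.

(** Decay at large phi: the scales ascend from r, and a < b makes the smallest scale dominate,
    whence the power of r in the bound. *)
Lemma dyadic_integral_up (A r a : R) : a < b -> 0 < r -> 0 <= A ->
  (forall x, E x -> r <= phi x) ->
  (forall t, r <= t ->
    (\int[mu]_(x in E `&` [set x | (phi x < t)%R]) (G x)%:E <= (A * t `^ a)%:E)%E) ->
  (\int[mu]_(x in E) (G x * phi x `^ (- b))%:E <=
    (2 `^ a / (1 - 2 `^ (a - b)) * A * r `^ (a - b))%:E)%E.
Proof.
move=> ba r0 A0 Er HA.
pose tau k : R := r * 2 ^+ k.
have tau0 k : 0 < tau k by rewrite mulr_gt0// exprn_gt0.
have tauE k : 2 * tau k = r * 2 ^+ k.+1 by rewrite /tau exprS; ring.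
have x1 : 2 `^ (a - b) < 1 :> R.
  by apply: two_powR_lt1; rewrite subr_lt0.
apply: le_trans.
  apply: (@dyadic_integral tau) => // x /Er rx.
  by have [k] := ex_dyadic_up r0 rx; exists k; rewrite tauE.
apply: (@le_trans _ _ (\sum_(k <oo) ((2 `^ a * A * r `^ (a - b)) * (2 `^ (a - b)) ^+ k)%:E)%E).
  apply: lee_nneseries => [k _ _|k _].
    rewrite mule_ge0 ?lee_fin ?powR_ge0//; apply: integral_ge0 => x _; exact: G0.
  apply: le_trans.
    apply: lee_wpmul2l; first by rewrite lee_fin powR_ge0.
    apply: HA; rewrite tauE ler_peMr ?(ltW r0)// exprn_ege1 ?ler1n//.
  rewrite -EFinM lee_fin tauE /tau le_eqVlt; apply/orP; left; apply/eqP.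
  rewrite !powR_expR ?mulr_gt0 ?exprn_gt0 ?invr_gt0// ?ln_dyadicV ?ln_dyadic//.
  rewrite -expRM_natl -natr1 mulrCA -expRD [X in _ = X * _ * _]mulrC -!mulrA -!expRD.
  congr (_ * expR _).
  by ring.
apply: le_trans; first apply: nneseries_geometric_le.
- by rewrite !mulr_ge0 ?powR_ge0.
- by rewrite powR_ge0.
by rewrite lee_fin le_eqVlt; apply/orP; left; apply/eqP; ring.
Qed.

End dyadic.

(** * Kernel integrals *)

Section estimates.
Variables (R : realType) (d : nat).
Hypothesis d0 : (0 < d)%N.
Local Notation mu := (@ball_measure R d).
Local Notation B := (@cball R d).
Local Notation dist z w := (Normc.normc (1 - dotc z w)).
Implicit Types z w : Cn R d.

Lemma ball_measure_shell : exists2 C : R, 0 <= C &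
  forall z delta t, nrm2 z < 1 -> 0 < delta -> 0 < t -> t <= 2 * delta ->
  (mu (shell z delta t) <= (C * delta ^+ d * t)%:E)%E.
Proof.
have [C C0 HC] := shell_volume R d0.
have /andP[K0 Koo] := @Cn_lebesgue_cball R d.
have Kfin : Cn_lebesgue R d B \is a fin_num by rewrite ge0_fin_numE// ltW.
have k0 : 0 < fine (Cn_lebesgue R d B) by rewrite fine_gt0// K0.
exists (C / fine (Cn_lebesgue R d B)); first by rewrite divr_ge0// ltW.
move=> z delta t z1 de0 t0 t2.
rewrite ball_measureE (_ : shell z delta t `&` B = shell z delta t); last first.
  by apply/seteqP; split => [w []//|w [w1 wd wt]]; split.
rewrite -(fineK Kfin) inver gt_eqF// lee_pdivrMr//.
apply: le_trans (HC _ _ _ z1 de0 t0 t2) _.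
by rewrite -EFinM lee_fin le_eqVlt; apply/orP; left; apply/eqP; field; rewrite gt_eqF.
Qed.

Lemma measurable_defect : measurable_fun setT (fun w : Cn R d => 1 - nrm2 w).
Proof. by apply: measurable_funB => //; exact: measurable_nrm2. Qed.

Lemma distC z w : dist z w = dist w z.
Proof.
rewrite -(normc_conj (1 - dotc z w)); congr Normc.normc.
rewrite rmorphB rmorph1 /dotc; congr (_ - _).
rewrite rmorph_sum; apply: eq_bigr => j _.
by rewrite rmorphM mulrC; congr (_ * _); case: (tnth w j) => x y /=; rewrite opprK.
Qed.

Lemma dist_ge_defect z w : (1 - nrm2 z) / 2 + (1 - nrm2 w) / 2 <= dist z w.
Proof.
have := two_dist_ge z w.
have : 0 <= \sum_(j < d) Normc.normc (tnth z j - tnth w j) ^+ 2.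
  by apply: sumr_ge0 => k _; exact: sqr_ge0.
lra.
Qed.

(** On |1 - <z, w>| < t the defect of w is below 2 t, so this region is the shell with parameters t
    and 2 t, of measure O(t^(d+1)). Dyadic summation converges at small scales because c < d + 1. *)
Lemma kernel_integral_bounded (c : R) : 0 <= c < d.+1%:R -> exists2 C : R, 0 <= C &
  forall z, nrm2 z < 1 ->
  (\int[mu]_(w in B) (dist z w `^ (- c))%:E <= C%:E)%E.
Proof.
move=> /andP[c0 cd]; have [C C0 HC] := ball_measure_shell.
have K0 : 0 <= 2 `^ c / (1 - 2 `^ (c - d.+1%:R)) :> R.
  by rewrite divr_ge0 ?powR_ge0// subr_ge0 ltW// two_powR_lt1// subr_lt0.
(* C * 2 comes from the shell with width 2 t; [d.+2] strictly exceeds the bound of [dist_le]. *)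
exists (2 `^ c / (1 - 2 `^ (c - d.+1%:R)) * (C * 2) * d.+2%:R `^ (d.+1%:R - c)).
  by apply: mulr_ge0 (powR_ge0 _ _); apply: mulr_ge0 => //; apply: mulr_ge0.
move=> z z1; under eq_integral do rewrite -[X in X%:E]mul1r.
apply: (@dyadic_integral_down _ _ _ mu B (cst 1) (fun w => dist z w)) => //.
- exact: measurable_cball.
- exact: measurable_dist2.
- by rewrite mulr_ge0.
- move=> w wB; rewrite dist_gt0//= (le_lt_trans (dist_le (ltW z1) (ltW wB)))//.
  by rewrite ltr_nat.
- move=> t /andP[t0 _].
  have mS : measurable (B `&` [set x | dist z x < t]).
    apply: measurableI; first exact: measurable_cball.
    by apply: measurable_ltfun => //; exact: measurable_dist2.
  rewrite [X in (X <= _)%E](integral_cst mu mS 1%E) mul1e.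
  apply: (@le_trans _ _ (mu (shell z t (2 * t)))).
    apply: le_measure; rewrite ?inE//; first exact: measurable_shell.
    move=> w [w1 /= wt]; split => //.
    by have := dist_ge_defect z w; lra.
  apply: le_trans (HC _ _ _ z1 t0 _ _) _; rewrite ?mulr_gt0//.
  by rewrite lee_fin powR_mulrn ?(ltW t0)// exprS le_eqVlt; apply/orP; left; apply/eqP; ring.
Qed.

(** Dyadic summation in the defect of w, which is below 2 delta here: its sublevel sets are shells
    of measure O(delta^d t), and the exponent 1 of t exceeds s. The sum is O(delta^d delta^(1 -
    s)). *)
Lemma weight_integral_le (s : R) : 0 <= s < 1 -> exists2 C : R, 0 <= C &
  forall z delta, nrm2 z < 1 -> 0 < delta ->
  (\int[mu]_(w in B `&` [set w | (dist z w < delta)%R]) ((1 - nrm2 w) `^ (- s))%:E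
    <= (C * delta `^ (d.+1%:R - s))%:E)%E.
Proof.
move=> /andP[s0 s1]; have [C C0 HC] := ball_measure_shell.
have K0 : 0 <= 2 `^ s / (1 - 2 `^ (s - 1)) :> R.
  by rewrite divr_ge0 ?powR_ge0// subr_ge0 ltW// two_powR_lt1// subr_lt0.
exists (2 `^ s / (1 - 2 `^ (s - 1)) * C * 2 `^ (1 - s)).
  by apply: mulr_ge0 (powR_ge0 _ _); apply: mulr_ge0 => //; apply: mulr_ge0.
move=> z delta z1 de0; under eq_integral do rewrite -[X in X%:E]mul1r.
have mE : measurable (B `&` [set w | dist z w < delta]).
  apply: measurableI; first exact: measurable_cball.
  by apply: measurable_ltfun => //; exact: measurable_dist2.
apply: le_trans.
  apply: (@dyadic_integral_down _ _ _ mu (B `&` [set w | dist z w < delta]) (cst 1)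
     (fun w => 1 - nrm2 w) s _ _ _ _ _ (C * delta ^+ d) (2 * delta) 1) => //.
  - exact: measurable_defect.
  - by rewrite mulr_gt0.
  - by rewrite mulr_ge0// exprn_ge0// ltW.
  - move=> w [w1 /= wd]; apply/andP; split; first by rewrite subr_gt0.
    by have := dist_ge_defect z w; lra.
  - move=> t /andP[t0 t2].
    have mS : measurable ((B `&` [set w | dist z w < delta]) `&` [set x | 1 - nrm2 x < t]).
      by apply: measurableI => //; apply: measurable_ltfun => //; exact: measurable_defect.
    rewrite [X in (X <= _)%E](integral_cst mu mS 1%E) mul1e powRr1 ?(ltW t0)//.
    apply: le_trans (HC _ _ _ z1 de0 t0 t2).
    apply: le_measure; rewrite ?inE//; first exact: measurable_shell.
    by move=> w [[w1 wd] wt]; split.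
rewrite lee_fin le_eqVlt; apply/orP; left; apply/eqP.
rewrite powRM ?(ltW de0)// (_ : d.+1%:R - s = d%:R + (1 - s)); last by rewrite -natr1; ring.
rewrite (@powRD _ delta d%:R (1 - s)); last by rewrite (gt_eqF de0) implybT.
by rewrite powR_mulrn ?(ltW de0)//; ring.
Qed.

(* The Forelli--Rudin estimate. *)
Lemma forelli_rudin (s : R) : 0 < s < 1 -> exists2 C : R, 0 <= C &
  forall z, nrm2 z < 1 ->
  (\int[mu]_(w in B) ((1 - nrm2 w) `^ (- s) * dist z w `^ (- d.+1%:R))%:E
    <= (C * (1 - nrm2 z) `^ (- s))%:E)%E.
Proof.
move=> /andP[s0 s1]; have [|C C0 HC] := @weight_integral_le s; first by rewrite ltW.
have K0 : 0 <= 2 `^ (d.+1%:R - s) / (1 - 2 `^ (- s)) :> R.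
  by rewrite divr_ge0 ?powR_ge0// subr_ge0 ltW// two_powR_lt1// oppr_lt0.
exists (2 `^ (d.+1%:R - s) / (1 - 2 `^ (- s)) * C * 2^-1 `^ (- s)).
  by apply: mulr_ge0 (powR_ge0 _ _); apply: mulr_ge0 => //; apply: mulr_ge0.
move=> z z1; have hz0 : 0 < 1 - nrm2 z by rewrite subr_gt0.
apply: le_trans.
  (* The smallest scale is (1 - |z|^2) / 2, a lower bound for the kernel distance;
     [weight_integral_le] supplies the exponent d + 1 - s, below d + 1. *)
  apply: (@dyadic_integral_up _ _ _ mu B (fun w => (1 - nrm2 w) `^ (- s))
     (fun w => dist z w) d.+1%:R _ _ _ _ _ C ((1 - nrm2 z) / 2) (d.+1%:R - s)) => //.
  - exact: measurable_cball.
  - exact: (measurableT_comp (measurable_powR _) measurable_defect).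
  - exact: measurable_dist2.
  - by move=> w; exact: powR_ge0.
  - by rewrite ltrBlDr ltrDl.
  - by rewrite divr_gt0.
  - move=> w w1; apply: le_trans (dist_ge_defect z w).
    by rewrite lerDl divr_ge0// subr_ge0 ltW.
  - move=> t zt; apply: HC => //; apply: lt_le_trans zt.
    by rewrite divr_gt0.
rewrite lee_fin le_eqVlt; apply/orP; left; apply/eqP.
rewrite (_ : d.+1%:R - s - d.+1%:R = - s); last by ring.
by rewrite powRM ?(ltW hz0)//; ring.
Qed.

End estimates.

(** * Hoelder, Jensen and Tonelli *)

Section hoelder_jensen.
Context d (T : measurableType d) (R : realType).
Variables (mu : probability T R) (E : set T).
Hypotheses (mE : measurable E) (E1 : mu (~` E) = 0%E).
Local Open Scope ereal_scope.

(** Bridge between the operators, which integrate over the ball, and [Lnorm], which integrates over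
    the whole space. *)
Lemma integral_full (F : T -> \bar R) : measurable_fun setT F -> (forall x, 0 <= F x) ->
  \int[mu]_(x in E) F x = \int[mu]_x F x.
Proof.
move=> mF F0; rewrite [RHS](@ge0_negligible_integral _ _ _ mu setT (~` E))//.
  by rewrite setDE setCK setTI.
exact: measurableC.
Qed.

Lemma measurable_powRf (f : T -> R) (p : R) : measurable_fun setT f ->
  measurable_fun setT (fun x => f x `^ p)%R.
Proof. exact: (measurableT_comp (measurable_powR _)). Qed.

Lemma hoelder_integral (f g : T -> R) (p q : R) :
  measurable_fun setT f -> measurable_fun setT g ->
  (forall x, 0 <= f x)%R -> (forall x, 0 <= g x)%R ->
  (0 < p)%R -> (0 < q)%R -> (p^-1 + q^-1 = 1)%R ->
  \int[mu]_(x in E) (f x * g x)%:E <=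
  (\int[mu]_(x in E) (f x `^ p)%:E) `^ p^-1 * (\int[mu]_(x in E) (g x `^ q)%:E) `^ q^-1.
Proof.
move=> mf mg f0 g0 p0 q0 pq.
have mfp := measurable_powRf p mf.
have mgq := measurable_powRf q mg.
rewrite !integral_full//; try (by move=> x; rewrite lee_fin ?mulr_ge0 ?powR_ge0);
  try by apply/measurable_EFinP => //; exact: measurable_funM.
have e (h : T -> R) (r : R) : (forall x, 0 <= h x)%R ->
    (\int[mu]_x (h x `^ r)%:E) `^ r^-1 = 'N[mu]_r%:E[EFin \o h].
  move=> h0; rewrite unlock; congr poweR.
  by apply: eq_integral => x _; rewrite /= ger0_norm.
rewrite (e f p f0) (e g q g0).
rewrite (_ : \int[mu]_x (f x * g x)%:E = 'N[mu]_1[EFin \o (f \* g)%R]).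
  exact: hoelder.
by rewrite Lnorm1; apply: eq_integral => x _; rewrite /= ger0_norm// mulr_ge0.
Qed.

Lemma measurable_integral_section (F : T * T -> \bar R) :
  measurable_fun setT F -> (forall p, 0 <= F p) ->
  measurable_fun setT (fun z => \int[mu]_(w in E) F (z, w)).
Proof.
move=> mF F0; rewrite (_ : (fun z => _) = (fun z => \int[mu]_w F (z, w))).
  exact: (measurable_fun_fubini_tonelli_F _ mF).
apply/funext => z; apply: integral_full => //.
exact: (measurableT_comp mF (pair1_measurable z)).
Qed.

Lemma poweR_mulB1 (x : \bar R) (t : R) : 0 <= x -> (1 <= t)%R -> x `^ (t - 1) * x = x `^ t.
Proof.
case: x => [x| |]// x0 t1.
  by rewrite !poweR_EFin -EFinM mulrC mulr_powRB1// (lt_le_trans _ t1).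
rewrite le_eqVlt in t1; case/predU1P : t1 => [<-|t1].
  by rewrite subrr poweRe0 mul1e poweRe1.
rewrite !poweRyr ?gt_eqF ?subr_gt0//; last by rewrite (lt_trans _ t1).

Qed.

(** Jensen's inequality for the unnormalized measure f dmu, obtained from Hoelder with the splitting
    f g = f^(1/t') (f^(1/t) g). *)
Lemma jensen_integral (f g : T -> R) (t : R) :
  measurable_fun setT f -> measurable_fun setT g ->
  (forall x, 0 <= f x)%R -> (forall x, 0 <= g x)%R -> (1 <= t)%R ->
  (\int[mu]_(x in E) (f x * g x)%:E) `^ t <=
  (\int[mu]_(x in E) (f x)%:E) `^ (t - 1) * \int[mu]_(x in E) (f x * g x `^ t)%:E.
Proof.
move=> mf mg f0 g0; rewrite le_eqVlt => /predU1P[<-|t1].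
  rewrite subrr poweRe0 mul1e poweRe1; last first.
    by apply: integral_ge0 => x _; rewrite lee_fin mulr_ge0.
  by under [leRHS]eq_integral do rewrite powRr1//.
have t0 : (0 < t)%R by rewrite (lt_trans _ t1).
pose t' := (t / (t - 1))%R.
have t'0 : (0 < t')%R by rewrite divr_gt0// subr_gt0.
have tt' : (t'^-1 + t^-1 = 1)%R.
  by rewrite /t' invf_div; field; rewrite !gt_eqF// subr_gt0.
pose f1 x := (f x `^ t'^-1)%R.
pose g1 x := (f x `^ t^-1 * g x)%R.
have mf1 : measurable_fun setT f1 by exact: measurable_powRf.
have mg1 : measurable_fun setT g1 by apply: measurable_funM => //; exact: measurable_powRf.
have f10 x : (0 <= f1 x)%R by exact: powR_ge0.
have g10 x : (0 <= g1 x)%R by rewrite mulr_ge0// powR_ge0.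
have H := hoelder_integral mf1 mg1 f10 g10 t'0 t0 tt'.
have -> : \int[mu]_(x in E) (f x * g x)%:E = \int[mu]_(x in E) (f1 x * g1 x)%:E.
  apply: eq_integral => x _; rewrite /f1 /g1 mulrA -powRD ?tt' ?powRr1//.
  by rewrite oner_eq0.
apply: le_trans.
  apply: (@gt0_ler_poweR _ t _ _ _ _ _ H); first exact: ltW.
  - by rewrite in_itv/= leey andbT; apply: integral_ge0 => x _; rewrite lee_fin mulr_ge0.
  - by rewrite in_itv/= leey andbT mule_ge0// poweR_ge0.
rewrite poweRM ?poweR_ge0// -!poweRrM mulVf ?gt_eqF// poweRe1; last first.
  by apply: integral_ge0 => x _; rewrite lee_fin powR_ge0.
rewrite le_eqVlt; apply/orP; left; apply/eqP; congr (_ `^ _ * _).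
- by apply: eq_integral => x _; rewrite /f1 -powRrM mulVf ?gt_eqF// powRr1.
- by rewrite /t'; field; rewrite !gt_eqF// subr_gt0.
- apply: eq_integral => x _; rewrite /g1 powRM ?powR_ge0// -powRrM mulVf ?gt_eqF//.
  by rewrite powRr1.
Qed.

(** Jensen in w for each z, then an exchange of integrals: HC bounds the inner integral uniformly in
    w, and I^(t - 1) times I C is C I^t. Both the estimate from L^1 (a = 1, t = q) and the Schur
    test (t = q / p) are instances. *)
Lemma jensen_tonelli (f a : T -> R) (G : T * T -> R) (t C : R) :
  measurable_fun setT f -> measurable_fun setT a -> measurable_fun setT G ->
  (forall x, 0 <= f x)%R -> (forall x, 0 <= a x)%R -> (forall x, 0 <= G x)%R ->
  (1 <= t)%R -> (0 < C)%R ->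
  (forall w, E w -> \int[mu]_(z in E) (a z * G (z, w) `^ t)%:E <= C%:E) ->
  \int[mu]_(z in E) ((a z)%:E * (\int[mu]_(w in E) (f w * G (z, w))%:E) `^ t) <=
  C%:E * (\int[mu]_(w in E) (f w)%:E) `^ t.
Proof.
move=> mf ma mG f0 a0 G0 t1 C0 HC.
have mGz z : measurable_fun setT (fun w => G (z, w)).
  exact: (measurableT_comp mG (pair1_measurable z)).
set I := \int[mu]_(w in E) (f w)%:E.
have I0 : 0 <= I by apply: integral_ge0 => x _; rewrite lee_fin.
pose H (p : T * T) := ((a p.1)%:E * (f p.2 * G p `^ t)%:E).
have H0 p : 0 <= H p.
  by rewrite /H -EFinM lee_fin mulr_ge0// mulr_ge0// powR_ge0.
have mH : measurable_fun setT H.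
  apply: emeasurable_funM; apply/measurable_EFinP.
    exact: (measurableT_comp ma measurable_fst).
  apply: measurable_funM; first exact: (measurableT_comp mf measurable_snd).
  exact: (measurableT_comp (measurable_powR _) mG).
have HE z w : H (z, w) = (a z)%:E * (f w * G (z, w) `^ t)%:E by [].
clearbody H.
have mGw w : measurable_fun setT (fun z => G (z, w)).
  exact: (measurableT_comp mG (pair2_measurable w)).
have mFG : measurable_fun setT (fun p : T * T => (f p.2 * G p)%:E).
  apply/measurable_EFinP; apply: measurable_funM => //.
  exact: (measurableT_comp mf measurable_snd).
have mGf : measurable_fun setT (fun z => \int[mu]_w (f w * G (z, w))%:E).
  apply: (measurable_fun_fubini_tonelli_F _ mFG).
  by move=> p; rewrite lee_fin mulr_ge0.
have intGf z : \int[mu]_(w in E) (f w * G (z, w))%:E = \int[mu]_w (f w * G (z, w))%:E.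
  apply: integral_full; first by apply/measurable_EFinP; exact: measurable_funM.
  by move=> w; rewrite lee_fin mulr_ge0.
have mHz z : measurable_fun setT (fun w => H (z, w)).
  exact: (measurableT_comp mH (pair1_measurable z)).
have mHw w : measurable_fun setT (fun z => H (z, w)).
  exact: (measurableT_comp mH (pair2_measurable w)).
have intHz z : \int[mu]_(w in E) H (z, w) = \int[mu]_w H (z, w) by exact: integral_full.
have intHw w : \int[mu]_(z in E) H (z, w) = \int[mu]_z H (z, w) by exact: integral_full.
have mIHz : measurable_fun setT (fun z => \int[mu]_(w in E) H (z, w)).
  under eq_fun do rewrite intHz.
  exact: (measurable_fun_fubini_tonelli_F _ mH).
have mIHw : measurable_fun setT (fun w => \int[mu]_(z in E) H (z, w)).
  under eq_fun do rewrite intHw.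
  exact: (measurable_fun_fubini_tonelli_G _ mH).
have IHw w : \int[mu]_(z in E) H (z, w) =
    (f w)%:E * \int[mu]_(z in E) (a z * G (z, w) `^ t)%:E.
  rewrite -ge0_integralZl//.
  - by apply: eq_integral => z _; rewrite HE -!EFinM; congr EFin; ring.
  - apply: (measurable_funS measurableT) => //; apply/measurable_EFinP.
    by apply: measurable_funM => //; exact: measurable_powRf.
  - by move=> z _; rewrite lee_fin mulr_ge0// powR_ge0.
  - by rewrite lee_fin.
apply: (@le_trans _ _ (\int[mu]_(z in E) (I `^ (t - 1) * \int[mu]_(w in E) H (z, w)))).
  apply: ge0_le_integral => //.
  - by move=> z _; rewrite mule_ge0 ?lee_fin ?poweR_ge0.
  - apply: (measurable_funS measurableT) => //; apply: emeasurable_funM.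
      exact/measurable_EFinP.
    under eq_fun do rewrite intGf.
    exact: (measurableT_comp (measurable_poweR _)).
  - by apply: (measurable_funS measurableT) => //; apply: measurable_funeM; exact: mIHz.
  - move=> z Ez; rewrite (eq_integral _ _ (fun w _ => HE z w)) ge0_integralZl//; last 3 first.
    + apply: (measurable_funS measurableT) => //; apply/measurable_EFinP.
      by apply: measurable_funM => //; exact: measurable_powRf.
    + by move=> w _; rewrite lee_fin mulr_ge0// powR_ge0.
    + by rewrite lee_fin.
    rewrite muleCA lee_wpmul2l ?lee_fin//.
    exact: jensen_integral.
have mIHzE : measurable_fun E (fun z => \int[mu]_(w in E) H (z, w)).
  exact: (measurable_funS measurableT _ mIHz).
rewrite (ge0_integralZl mu mE mIHzE); last 2 first.
- by move=> z _; apply: integral_ge0 => w _; exact: H0.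
- exact: poweR_ge0.
have -> : \int[mu]_(z in E) \int[mu]_(w in E) H (z, w) =
    \int[mu]_(w in E) \int[mu]_(z in E) H (z, w).
  rewrite (integral_full mIHz); last by move=> x; apply: integral_ge0 => w _; exact: H0.
  rewrite (integral_full mIHw); last by move=> x; apply: integral_ge0 => z _; exact: H0.
  rewrite (eq_integral _ _ (fun z _ => intHz z)) (eq_integral _ _ (fun w _ => intHw w)).
  exact: (fubini_tonelli _ mH).
apply: (@le_trans _ _ (I `^ (t - 1) * (I * C%:E))).
  have mfE : measurable_fun E (fun w => (f w)%:E).
    by apply/measurable_EFinP; exact: (measurable_funS measurableT _ mf).
  apply: lee_wpmul2l; first exact: poweR_ge0.
  rewrite -(ge0_integralZr mu mE mfE); last 2 first.
  - by move=> w _; rewrite lee_fin.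
  - by rewrite lee_fin ltW.
  apply: (ge0_le_integral mu mE).
  - by move=> w _; apply: integral_ge0 => z _; exact: H0.
  - exact: (measurable_funS measurableT _ mIHw).
  - exact: emeasurable_funM.
  - by move=> w Ew; rewrite IHw; apply: lee_wpmul2l; rewrite ?lee_fin//; exact: HC.
by rewrite muleA poweR_mulB1// muleC.
Qed.

(** [jensen_integral] with constant weight 1, of total mass 1, applied to |f|^r with exponent s /
    r. *)
Lemma Lnorm_le_prob (f : T -> R) (r s : R) : measurable_fun setT f ->
  (0 < r)%R -> (r <= s)%R ->
  'N[mu]_r%:E[EFin \o f] <= 'N[mu]_s%:E[EFin \o f].
Proof.
move=> mf r0 rs; have s0 : (0 < s)%R by rewrite (lt_le_trans r0).
have t1 : (1 <= s / r)%R by rewrite ler_pdivlMr// mul1r.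
have ma : measurable_fun setT (fun x => `|f x|)%R by exact: measurableT_comp.
have mar : measurable_fun setT (fun x => `|f x| `^ r)%R by exact: measurable_powRf.
have mas : measurable_fun setT (fun x => `|f x| `^ s)%R by exact: measurable_powRf.
have H := @jensen_integral (fun=> 1%R) (fun x => `|f x| `^ r)%R (s / r)%R
  (measurable_cst _) mar (fun _ => ler01) (fun _ => powR_ge0 _ _) t1.
have e1 : \int[mu]_(x in E) (1 * `|f x| `^ r)%:E = \int[mu]_x `|(EFin \o f) x| `^ r.
  rewrite -integral_full.
  - by apply: eq_integral => x _; rewrite mul1r.
  - by apply/measurable_EFinP.
  - by move=> x; exact: poweR_ge0.
have e2 : \int[mu]_(x in E) 1%:E = 1.
  have mu1 : mu E = 1.
    by rewrite -(setCK E) probability_setC ?E1 ?sube0//; exact: measurableC.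
  by rewrite integral_cst// mul1e.
have e3 : \int[mu]_(x in E) (1 * (`|f x| `^ r) `^ (s / r))%:E =
    \int[mu]_x `|(EFin \o f) x| `^ s.
  rewrite -integral_full.
  - apply: eq_integral => x _; rewrite mul1r -powRrM.
    by rewrite /= (_ : r * (s / r) = s)%R//; field; rewrite gt_eqF.
  - by apply/measurable_EFinP.
  - by move=> x; exact: poweR_ge0.
rewrite e1 e2 e3 poweR1r mul1e in H; rewrite unlock.
have -> : r^-1%R = (s / r * s^-1)%R by field; rewrite !gt_eqF.
rewrite poweRrM; apply: gt0_ler_poweR H.
- by rewrite invr_ge0 ltW.
- by rewrite in_itv/= leey andbT poweR_ge0.
- by rewrite in_itv/= leey andbT; apply: integral_ge0 => x _; rewrite lee_fin powR_ge0.
Qed.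

Lemma Lnorm_le_sup (f : T -> R) (r : R) : measurable_fun setT f -> (0 < r)%R ->
  'N[mu]_r%:E[EFin \o f] <= 'N[mu]_+oo[EFin \o f].
Proof.
move=> mf r0; rewrite unlock /= probability_setT lte01.
set M := ess_sup _ _.
have M0 : 0 <= M.
  apply: ess_sup_gee; first by rewrite /= probability_setT lte01.
  by apply: nearW => x /=; rewrite lee_fin.
have h := ess_sup_ge mu (abse \o (EFin \o f)); rewrite -/M in h.
rewrite -[leRHS]poweRe1// -(divff (x := r)) ?gt_eqF// poweRrM; apply: gt0_ler_poweR.
- by rewrite invr_ge0 ltW.
- by rewrite in_itv/= leey andbT; apply: integral_ge0 => x _; rewrite lee_fin powR_ge0.
- by rewrite in_itv/= leey andbT poweR_ge0.
rewrite -[leRHS]mule1 -(probability_setT mu) -integral_cst//.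
apply: ae_ge0_le_integral => //.
- by apply/measurable_EFinP; apply: measurable_powRf; exact: measurableT_comp.
- by move=> x _; exact: poweR_ge0.
apply: filterS h => x /= hx _.
apply: (@gt0_ler_poweR _ r _ `|f x|%:E M) => //; first exact: ltW.
- by rewrite in_itv/= leey andbT lee_fin.
- by rewrite in_itv/= leey andbT.
Qed.

Lemma Lnorm_le_probe (f : T -> R) (p q : \bar R) : measurable_fun setT f ->
  1 <= p -> p <= q -> 'N[mu]_p[EFin \o f] <= 'N[mu]_q[EFin \o f].
Proof.
move=> mf; case: p q => [p| |] [q| |]//; rewrite ?leye_eq//.
- by rewrite !lee_fin => p1; apply: Lnorm_le_prob => //; exact: lt_le_trans p1.
- by rewrite lee_fin => p1 _; apply: Lnorm_le_sup => //; exact: lt_le_trans p1.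
Qed.

End hoelder_jensen.

(** * Bounds for the positive operator *)

Section operator_bounds.
Variables (R : realType) (d : nat).
Hypothesis d0 : (0 < d)%N.
Local Notation mu := (@ball_measure R d).
Local Notation B := (@cball R d).
Local Notation dist z w := (Normc.normc (1 - dotc z w)).
Implicit Types (z w : Cn R d) (g : Cn R d -> R) (alpha : R).

Lemma ball_measureC : mu (~` B) = 0%E.
Proof. by rewrite ball_measureE setICl measure0 mul0e. Qed.

Let mB : measurable B := @measurable_cball R d.

(** Extended-real values let the estimates be stated before any convergence is known. *)
Definition Top (alpha : R) (g : Cn R d -> R) z : \bar R :=
  (\int[mu]_(w in B) (g w * dist z w `^ (- alpha))%:E)%E.

Lemma Top_ge0 alpha g z : (forall w, 0 <= g w) -> (0 <= Top alpha g z)%E.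
Proof. by move=> g0; apply: integral_ge0 => w _; rewrite lee_fin mulr_ge0// powR_ge0. Qed.

Lemma measurable_dist_powR (a : R) z : measurable_fun setT (fun w => dist z w `^ a).
Proof. exact: measurable_powRf (measurable_dist2 z). Qed.

Lemma measurable_Top alpha g : measurable_fun setT g -> (forall w, 0 <= g w) ->
  measurable_fun setT (Top alpha g).
Proof.
move=> mg g0.
have mH : measurable_fun setT (fun p : Cn R d * Cn R d => (g p.2 * dist p.1 p.2 `^ (- alpha))%:E).
  apply/measurable_EFinP; apply: measurable_funM.
    exact: (measurableT_comp mg measurable_snd).
  exact: measurable_powRf (@measurable_dist R d).
rewrite (_ : Top alpha g = fun z => (\int[mu]_w (g w * dist z w `^ (- alpha))%:E)%E).
  apply: (measurable_fun_fubini_tonelli_F _ mH).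
  by move=> p; rewrite lee_fin mulr_ge0// powR_ge0.
apply/funext => z; apply: (integral_full mB ball_measureC).
  apply/measurable_EFinP; apply: measurable_funM => //; exact: measurable_dist_powR.
by move=> w; rewrite lee_fin mulr_ge0// powR_ge0.
Qed.

Lemma Lnorm_integral_ball (p : R) (g : Cn R d -> R) : p != 0 ->
  measurable_fun setT g -> (forall w, 0 <= g w) ->
  (\int[mu]_(w in B) (g w `^ p)%:E = 'N[mu]_p%:E[EFin \o g] `^ p)%E.
Proof.
move=> p0 mg g0; rewrite poweR_Lnorm//.
have mgp : measurable_fun setT (fun w => (g w `^ p)%:E).
  by apply/measurable_EFinP; exact: measurable_powRf.
have gp0 w : (0 <= (g w `^ p)%:E)%E by rewrite lee_fin powR_ge0.
rewrite (integral_full mB ball_measureC mgp gp0).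
by apply: eq_integral => w _; rewrite /= ger0_norm.
Qed.

(** Hoelder in w; beyond the critical exponent the conjugate power of the kernel is integrable
    uniformly in z. *)
Lemma Top_sup_bound (alpha : R) (p : \bar R) : 0 < alpha -> alpha <= d.+1%:R ->
  (crit_exponent d alpha < p)%E -> exists2 C : R, 0 <= C &
  forall g, measurable_fun setT g -> (forall w, 0 <= g w) ->
  forall z, B z -> (Top alpha g z <= C%:E * 'N[mu]_p[EFin \o g])%E.
Proof.
move=> a0; rewrite le_eqVlt => /predU1P[->|ad]; first by rewrite crit_exponent_top ltNge leey.
have da0 : 0 < d.+1%:R - alpha by rewrite subr_gt0.
rewrite /crit_exponent inver gt_eqF// -EFinM.
case: p => [p| |]// hp; last first.
  have [|C C0 HC] := @kernel_integral_bounded R d d0 alpha; first by rewrite ltW.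
  exists C => // g mg g0 z zB.
  have := ess_sup_ge mu (abse \o (EFin \o g)).
  rewrite unlock /= probability_setT lte01; set M := ess_sup _ _ => hM.
  have M0 : (0 <= M)%E.
    apply: ess_sup_gee; first by rewrite /= probability_setT lte01.
    by apply: nearW => x /=; rewrite lee_fin.
  apply: (@le_trans _ _ (\int[mu]_(w in B) (M * (dist z w `^ (- alpha))%:E))%E).
    apply: ae_ge0_le_integral => //.
    - by move=> w _; rewrite lee_fin mulr_ge0// powR_ge0.
    - apply: (measurable_funS measurableT) => //; apply/measurable_EFinP.
      by apply: measurable_funM => //; exact: measurable_dist_powR.
    - by move=> w _; rewrite mule_ge0// lee_fin powR_ge0.
    - apply: (measurable_funS measurableT) => //; apply: measurable_funeM.
      by apply/measurable_EFinP; exact: measurable_dist_powR.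
    apply: filterS hM => w /= hw _.
    rewrite EFinM lee_wpmul2r ?lee_fin ?powR_ge0//.
    by apply: le_trans hw; rewrite lee_fin ler_norm.
  rewrite ge0_integralZl//.
  - by rewrite muleC lee_wpmul2r// HC.
  - apply: (measurable_funS measurableT) => //.
    by apply/measurable_EFinP; exact: measurable_dist_powR.
  - by move=> w _; rewrite lee_fin powR_ge0.
rewrite lte_fin in hp.
have p1 : 1 < p.
  apply: le_lt_trans hp; rewrite ler_pdivlMr// mul1r; lra.
have p0 : 0 < p by lra.
pose p' := p / (p - 1).
have p'0 : 0 < p' by rewrite divr_gt0// subr_gt0.
have pp' : p^-1 + p'^-1 = 1 by rewrite /p' invf_div; field; rewrite gt_eqF.
(* This is the condition p > (d + 1)/(d + 1 - alpha) rewritten for the conjugate exponent p'. *)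
have hap : 0 <= alpha * p' < d.+1%:R.
  rewrite mulr_ge0 ?ltW//= /p' mulrA ltr_pdivrMr ?subr_gt0//.
  by move: hp; rewrite ltr_pdivrMr//; lra.
have [C C0 HC] := @kernel_integral_bounded R d d0 _ hap.
exists (C `^ p'^-1); first exact: powR_ge0.
move=> g mg g0 z zB.
apply: le_trans.
  apply: (hoelder_integral mB ball_measureC mg (measurable_dist_powR (- alpha) z) g0 _ p0 p'0 pp').
  by move=> w; exact: powR_ge0.
rewrite Lnorm_integral_ball ?gt_eqF// -poweRrM mulfV ?gt_eqF// poweRe1 ?Lnorm_ge0//.
rewrite muleC lee_wpmul2r ?Lnorm_ge0// -poweR_EFin; apply: gt0_ler_poweR.
- by rewrite invr_ge0 ltW.
- by rewrite in_itv/= leey andbT; apply: integral_ge0 => w _; rewrite lee_fin powR_ge0.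
- by rewrite in_itv/= leey andbT lee_fin.
apply: le_trans (HC z zB); rewrite le_eqVlt; apply/orP; left; apply/eqP.
by apply: eq_integral => w _; rewrite -powRrM mulNr.
Qed.

(** Minkowski-type bound: the kernel, as a function of z, has L^q norm bounded uniformly in w
    because alpha q < d + 1. The symmetry [distC] reduces this to [kernel_integral_bounded]. *)
Lemma Top_one_bound (alpha q : R) : 0 < alpha -> 1 <= q -> alpha * q < d.+1%:R ->
  exists2 C : R, 0 <= C &
  forall g, measurable_fun setT g -> (forall w, 0 <= g w) ->
  (\int[mu]_(z in B) (Top alpha g z `^ q) <= (C%:E * 'N[mu]_1[EFin \o g]) `^ q)%E.
Proof.
move=> a0 q1 aq; have q0 : 0 < q by lra.
have [|C C0 HC] := @kernel_integral_bounded R d d0 (alpha * q).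
  by rewrite aq mulr_ge0// ltW.
exists ((C + 1) `^ q^-1); first exact: powR_ge0.
move=> g mg g0.
have C1 : 0 < C + 1 by lra.
have mK : measurable_fun setT (fun p : Cn R d * Cn R d => dist p.1 p.2 `^ (- alpha)).
  exact: measurable_powRf (@measurable_dist R d).
have H := @jensen_tonelli _ _ R mu B mB ball_measureC g (fun=> 1)
  (fun p => dist p.1 p.2 `^ (- alpha)) q (C + 1) mg (measurable_cst _) mK g0
  (fun _ => ler01) (fun _ => powR_ge0 _ _) q1 C1.
rewrite poweRM ?lee_fin ?powR_ge0 ?Lnorm_ge0// poweR_EFin -powRrM mulVf ?gt_eqF//.
rewrite powRr1 ?(ltW C1)//.
have -> : 'N[mu]_1[EFin \o g]%E = (\int[mu]_(w in B) (g w)%:E)%E.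
  rewrite -[LHS]poweRe1 ?Lnorm_ge0// -Lnorm_integral_ball ?oner_eq0//.
  by apply: eq_integral => w _; rewrite powRr1.
apply: le_trans (H _).
  rewrite le_eqVlt; apply/orP; left; apply/eqP.
  by apply: eq_integral => z _; rewrite mul1e.
move=> w wB; apply: (@le_trans _ _ C%:E); last by rewrite lee_fin; lra.
apply: le_trans (HC w wB); rewrite le_eqVlt; apply/orP; left; apply/eqP.
by apply: eq_integral => z _; rewrite mul1r /= -powRrM mulNr distC.
Qed.

Lemma measurable_pair_defect2 (a : R) :
  measurable_fun setT (fun p : Cn R d * Cn R d => (1 - nrm2 p.2) `^ a).
Proof.
apply: measurable_powRf.
exact: (measurableT_comp (@measurable_defect R d) measurable_snd).
Qed.

(* Schur's test with the weight (1 - |w|^2)^(-s): the exponent of the kernel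
   splits as (d + 1)(1/p' + 1/q), so both halves are Forelli--Rudin integrals. *)
Lemma Top_schur_bound alpha p q : 1 < p -> p <= q ->
  alpha = d.+1%:R * (1 - p^-1 + q^-1) ->
  exists2 C : R, 0 <= C &
  forall g, measurable_fun setT g -> (forall w, 0 <= g w) ->
  (\int[mu]_(z in B) (Top alpha g z `^ q) <= (C%:E * 'N[mu]_p%:E[EFin \o g]) `^ q)%E.
Proof.
move=> p1 pq alphaE; have p0 : 0 < p by lra.
have q0 : 0 < q by lra.
have q1 : 1 < q by lra.
pose p' := p / (p - 1).
have p'0 : 0 < p' by rewrite divr_gt0// subr_gt0.
have pp' : p^-1 + p'^-1 = 1 by rewrite /p' invf_div; field; rewrite gt_eqF.
have ip' : p'^-1 = 1 - p^-1 by move: pp'; lra.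
(* Half the minimum keeps both s p' and s q strictly below 1, the range of [forelli_rudin]. *)
pose s := Num.min p'^-1 q^-1 / 2.
have s0 : 0 < s by rewrite divr_gt0// lt_min !invr_gt0 p'0.
have sp' : 0 < s * p' < 1.
  rewrite mulr_gt0//= -ltr_pdivlMr// div1r.
  have : Num.min p'^-1 q^-1 <= p'^-1 by rewrite ge_min lexx.
  by rewrite /s; have := invr_gt0 p'; rewrite p'0 => /idP; lra.
have sq : 0 < s * q < 1.
  rewrite mulr_gt0//= -ltr_pdivlMr// div1r.
  have : Num.min p'^-1 q^-1 <= q^-1 by rewrite ge_min lexx orbT.
  by rewrite /s; have := invr_gt0 q; rewrite q0 => /idP; lra.
have [C1 C10 H1] := @forelli_rudin R d d0 _ sp'.
have [C2 C20 H2] := @forelli_rudin R d d0 _ sq.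
pose C3 := C1 `^ (q / p') * C2 + 1.
have C30 : 0 < C3 by rewrite ltr_wpDl// mulr_ge0// powR_ge0.
exists (C3 `^ q^-1); first exact: powR_ge0.
move=> g mg g0.
(* [a] is the q-th power of the first Hoelder factor after Forelli-Rudin, and [G] the p-th power of
   the weight and kernel in the second. Then [G]^(q/p) carries the kernel to the exponent d + 1,
   ready for Forelli-Rudin in z. *)
pose a z := C1 `^ (q / p') * (1 - nrm2 z) `^ (- (s * q)).
pose G (u : Cn R d * Cn R d) :=
  (1 - nrm2 u.2) `^ (s * p) * dist u.1 u.2 `^ (- (d.+1%:R * (p / q))).
have ma : measurable_fun setT a.
  apply: measurable_funM => //; apply: measurable_powRf; exact: measurable_defect.
have mG : measurable_fun setT G.
  apply: measurable_funM; first exact: measurable_pair_defect2.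
  exact: measurable_powRf (@measurable_dist R d).
have a_ge0 z : 0 <= a z by rewrite mulr_ge0 ?powR_ge0.
have G_ge0 u : 0 <= G u by rewrite mulr_ge0 ?powR_ge0.
have qp1 : 1 <= q / p by rewrite ler_pdivlMr// mul1r.
have mgp := measurable_powRf p mg.
have H := @jensen_tonelli _ _ R mu B mB ball_measureC (fun w => g w `^ p) a
  G (q / p) C3 mgp ma mG (fun _ => powR_ge0 _ _) a_ge0 G_ge0 qp1 C30.
rewrite poweRM ?lee_fin ?powR_ge0 ?Lnorm_ge0// poweR_EFin -powRrM mulVf ?gt_eqF//.
rewrite powRr1 ?(ltW C30)//.
rewrite Lnorm_integral_ball ?gt_eqF// -poweRrM in H.
rewrite (_ : p * (q / p) = q) in H; last by field; rewrite gt_eqF.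
apply: le_trans (H _).
  apply: (ge0_le_integral mu mB).
  - by move=> z _; exact: poweR_ge0.
  - apply: (measurable_funS measurableT) => //.
    exact: (measurableT_comp (measurable_poweR _) (measurable_Top _ mg g0)).
  - apply: (measurable_funS measurableT) => //; apply: emeasurable_funM.
      exact/measurable_EFinP.
    apply: (measurableT_comp (measurable_poweR _)).
    apply: (measurable_integral_section mB ball_measureC
      (F := fun u => (g u.2 `^ p * G u)%:E)).
      apply/measurable_EFinP; apply: measurable_funM => //.
      exact: (measurableT_comp mgp measurable_snd).
    by move=> u; rewrite lee_fin mulr_ge0// powR_ge0.
  move=> z zB.
  have hz : 0 < 1 - nrm2 z by rewrite subr_gt0.
  (* The weights cancel in [f1 * g1], and the kernel exponents (d + 1)/p' and (d + 1)/q add up to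
     alpha. *)
  pose f1 w := (1 - nrm2 w) `^ (- s) * dist z w `^ (- (d.+1%:R / p')).
  pose g1 w := g w * ((1 - nrm2 w) `^ s * dist z w `^ (- (d.+1%:R / q))).
  have mf1 : measurable_fun setT f1.
    apply: measurable_funM; last exact: measurable_dist_powR.
    apply: measurable_powRf; exact: measurable_defect.
  have mg1 : measurable_fun setT g1.
    apply: measurable_funM => //; apply: measurable_funM; last exact: measurable_dist_powR.
    apply: measurable_powRf; exact: measurable_defect.
  have f10 w : 0 <= f1 w by rewrite mulr_ge0 ?powR_ge0.
  have g10 w : 0 <= g1 w by rewrite mulr_ge0// mulr_ge0 ?powR_ge0.
  have p'p : p'^-1 + p^-1 = 1 by rewrite addrC.
  have := hoelder_integral mB ball_measureC mf1 mg1 f10 g10 p'0 p0 p'p.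
  rewrite [X in (X <= _)%E](_ : _ = Top alpha g z); last first.
    apply: eq_integral => w; rewrite inE => wB; congr EFin.
    have hw : 1 - nrm2 w != 0 by rewrite gt_eqF// subr_gt0.
    have Dw : dist z w != 0 by rewrite gt_eqF// dist_gt0.
    rewrite /f1 /g1 mulrCA; congr (_ * _).
    rewrite mulrACA -powRD ?hw ?implybT// addNr powRr0 mul1r -powRD ?Dw ?implybT//.
    by rewrite alphaE -ip'; congr (_ `^ _); ring.
  rewrite [X in (_ <= X `^ _ * _)%E](_ : _ = \int[mu]_(w in B)
     ((1 - nrm2 w) `^ (- (s * p')) * dist z w `^ (- d.+1%:R))%:E)%E; last first.
    apply: eq_integral => w _; congr EFin.
    rewrite powRM ?powR_ge0// -!powRrM !mulNr; congr (_ * _ `^ (- _)).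
    by field; rewrite gt_eqF.
  rewrite [X in (_ <= _ * X `^ _)%E](_ : _ =
    \int[mu]_(w in B) (g w `^ p * G (z, w))%:E)%E; last first.
    apply: eq_integral => w _; congr EFin.
    rewrite powRM ?mulr_ge0 ?powR_ge0//; congr (_ * _).
    rewrite powRM ?powR_ge0// -!powRrM !mulNr; congr (_ * _ `^ (- _)).
    by field; rewrite gt_eqF.
  set I := (\int[mu]_(w in B) (g w `^ p * G (z, w))%:E)%E.
  have I0 : (0 <= I)%E.
    by apply: integral_ge0 => w _; rewrite lee_fin mulr_ge0// powR_ge0.
  move=> h.
  have {}h : (Top alpha g z <=
      ((C1 * (1 - nrm2 z) `^ (- (s * p')))%:E `^ p'^-1 * I `^ p^-1))%E.
    apply: le_trans h _; apply: lee_wpmul2r; first exact: poweR_ge0.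
    apply: gt0_ler_poweR (H1 z zB).
    - by rewrite invr_ge0 ltW.
    - rewrite in_itv/= leey andbT; apply: integral_ge0 => w _.
      by rewrite lee_fin mulr_ge0 ?powR_ge0.
    - by rewrite in_itv/= leey andbT lee_fin mulr_ge0 ?powR_ge0.
  apply: (@le_trans _ _ (((C1 * (1 - nrm2 z) `^ (- (s * p')))%:E `^ p'^-1 * I `^ p^-1) `^ q)%E).
    apply: gt0_ler_poweR h; first exact: ltW.
    - by rewrite in_itv/= leey andbT Top_ge0.
    - by rewrite in_itv/= leey andbT; apply: mule_ge0; rewrite ?poweR_ge0 ?lee_fin ?powR_ge0.
  rewrite poweRM ?poweR_ge0// -!poweRrM poweR_EFin (mulrC p^-1) (mulrC p'^-1).
  rewrite /a powRM ?powR_ge0// -powRrM mulNr.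
  by rewrite (_ : s * p' * (q / p') = s * q)//; field; rewrite gt_eqF.
(* Forelli-Rudin in z returns (1 - |w|^2)^(-s q), which cancels the weight (1 - |w|^2)^(s q) of
   [G]^(q/p). *)
move=> w wB; apply: (@le_trans _ _ (C1 `^ (q / p') * C2)%:E); last by rewrite lee_fin /C3; lra.
have hw : 0 < 1 - nrm2 w by rewrite subr_gt0.
apply: (@le_trans _ _ (\int[mu]_(z in B) ((C1 `^ (q / p') * (1 - nrm2 w) `^ (s * q))%:E *
    ((1 - nrm2 z) `^ (- (s * q)) * dist w z `^ (- d.+1%:R))%:E))%E).
  rewrite le_eqVlt; apply/orP; left; apply/eqP; apply: eq_integral => z _.
  rewrite -EFinM; congr EFin; rewrite /a /G /= powRM ?powR_ge0// -!powRrM distC mulNr.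
  rewrite (_ : s * p * (q / p) = s * q); last by field; rewrite gt_eqF.
  rewrite (_ : d.+1%:R * (p / q) * (q / p) = d.+1%:R); last by field; rewrite !gt_eqF.
  by ring.
have mI : measurable_fun B (fun z => ((1 - nrm2 z) `^ (- (s * q)) * dist w z `^ (- d.+1%:R))%:E).
  apply: (measurable_funS measurableT) => //; apply/measurable_EFinP.
  apply: measurable_funM; last exact: measurable_dist_powR.
  apply: measurable_powRf; exact: measurable_defect.
rewrite (ge0_integralZl mu mB mI); last 2 first.
- by move=> z _; rewrite lee_fin mulr_ge0 ?powR_ge0.
- by rewrite lee_fin mulr_ge0 ?powR_ge0.
apply: le_trans.
  by apply: lee_wpmul2l (H2 w wB); rewrite lee_fin mulr_ge0 ?powR_ge0.
rewrite -EFinM lee_fin powRN le_eqVlt; apply/orP; left; apply/eqP; field.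
by rewrite gt_eqF// powR_gt0.
Qed.

End operator_bounds.

(** * Operators with complex kernels *)

Section arbitrary_integrand.
Import HBNNSimple.
Context d (T : measurableType d) (R : realType).
Variables (mu : probability T R) (E : set T).
Hypotheses (mE : measurable E) (E1 : mu (~` E) = 0%E).
Local Open Scope ereal_scope.

(* No measurability: the values of F off the full set E are arbitrary. *)
Lemma integral_full_any (F : T -> \bar R) : (forall x, 0 <= F x) ->
  \int[mu]_x F x = \int[mu]_x (F \_ E) x.
Proof.
move=> F0; have FE0 x : 0 <= (F \_ E) x by rewrite patchE; case: ifPn.
rewrite !ge0_integralTE//; apply/eqP; rewrite eq_le; apply/andP; split.
  apply: ge_ereal_sup => _ [h /= hF <-].
  (* Cutting a simple function off outside E keeps its integral and puts it below the restriction of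
     F. *)
  apply: (@le_trans _ _ (sintegral mu (proj_nnsfun h mE))).
    rewrite -!integralT_nnsfun -(integral_full mE E1).
    - rewrite -[leRHS](integral_full mE E1).
      + rewrite le_eqVlt; apply/orP; left; apply/eqP; apply: eq_integral => x xE.
        by rewrite /proj_nnsfun/= mindicE xE mulr1.
      + by apply/measurable_EFinP.
      + by move=> x; rewrite lee_fin.
    - by apply/measurable_EFinP.
    - by move=> x; rewrite lee_fin.
  apply: ereal_sup_ubound; exists (proj_nnsfun h mE) => //= x.
  rewrite mindicE patchE; case: (x \in E) => /=; first by rewrite mulr1.
  by rewrite mulr0.
apply: ereal_sup_le => _ [h /= hF <-]; exists h => //= x.
by apply: le_trans (hF x) _; rewrite patchE; case: ifPn.
Qed.

(** The real integral is total: [fine] of a difference of two measurable extended functions. The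
    claim therefore covers also those z whose section is not integrable. *)
Lemma measurable_Rintegral_section (F : T * T -> R) : measurable_fun setT F ->
  measurable_fun setT (fun z => \int[mu]_(w in E) F (z, w))%R.
Proof.
move=> mF.
have mEF : measurable_fun setT (EFin \o F) by exact/measurable_EFinP.
rewrite /Rintegral; apply: (measurableT_comp (fine_measurable measurableT)).
rewrite (_ : (fun z => _) = (fun z => \int[mu]_(w in E) (EFin \o F)^\+ (z, w) -
   \int[mu]_(w in E) (EFin \o F)^\- (z, w))).
  apply: emeasurable_funB; apply: (measurable_integral_section mE E1) => //.
  - exact: measurable_funepos.
  - exact: measurable_funeneg.
apply/funext => z; rewrite [LHS]integralE.
by congr (_ - _); apply: eq_integral => w _; rewrite ?funeposE ?funenegE.
Qed.

End arbitrary_integrand.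

Lemma le_poweR_cancel (R : realType) (r : R) (x y : \bar R) : 0 < r ->
  (0 <= x)%E -> (0 <= y)%E -> (x `^ r <= y `^ r)%E -> (x <= y)%E.
Proof.
move=> r0 x0 y0 h; rewrite -(poweRe1 x0) -(poweRe1 y0) -(divff (x := r)) ?gt_eqF//.
rewrite !poweRrM; apply: gt0_ler_poweR h.
- by rewrite invr_ge0 ltW.
- by rewrite in_itv/= leey andbT poweR_ge0.
- by rewrite in_itv/= leey andbT poweR_ge0.
Qed.

Section complex_operators.
Variables (R : realType) (d : nat).
Local Notation mu := (@ball_measure R d).
Local Notation B := (@cball R d).
Local Notation dist z w := (Normc.normc (1 - dotc z w)).
Implicit Types (z w : Cn R d) (f : Cn R d -> R[i]) (g : Cn R d -> R) (alpha : R).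

Let mB : measurable B := @measurable_cball R d.
Let B1 : mu (~` B) = 0%E := @ball_measureC R d.

(** [in_Lp] makes f measurable only on the ball; extending its modulus by zero gives a globally
    measurable function with the same norms. *)
Definition absB f : Cn R d -> R := (fun w => Normc.normc (f w)) \_ B.

Lemma absB_ge0 f w : 0 <= absB f w.
Proof. by rewrite /absB patchE; case: ifPn => // _; exact: normc_ge0. Qed.

Lemma absBE f w : B w -> absB f w = Normc.normc (f w).
Proof. by move=> wB; rewrite /absB patchE mem_set. Qed.

Lemma measurable_absB f : measurable_fun B f -> measurable_fun setT (absB f).
Proof.
move=> mf; apply/(measurable_restrictT _ mB).
exact: (measurableT_comp (@measurable_normc R) mf).
Qed.

Lemma Lp_norm_absB (p : \bar R) f : (1 <= p)%E ->
  Lp_norm p f = 'N[mu]_p[EFin \o absB f]%E.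
Proof.
case: p => [p| |]//; rewrite ?lee_fin => p1.
  have p0 : 0 < p by lra.
  rewrite /Lp_norm unlock; congr poweR.
  rewrite (integral_full_any mB B1); last by move=> x; exact: poweR_ge0.
  apply: eq_integral => w _; rewrite patchE /= /absB patchE; case: ifPn => _.
    by [].
  by rewrite normr0 powR0// gt_eqF.
rewrite /Lp_norm unlock /= probability_setT lte01; apply: eq_ess_sup.
exists (~` B); split => //; first exact: measurableC.
move=> w /= h wB; apply: h; rewrite absBE//.
Qed.

Definition kernel_op (k : Cn R d -> Cn R d -> R[i]) f z : R[i] :=
  cintegral mu B (fun w => f w * k z w).

Section kernel.
Variables (alpha : R) (k : Cn R d -> Cn R d -> R[i]).
Hypothesis mk : measurable_fun (B `*` B) (fun p => k p.1 p.2).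
Hypothesis kE : forall z w, B z -> B w -> Normc.normc (k z w) = dist z w `^ (- alpha).

Let mBB : measurable (B `*` B). Proof. exact: measurableX. Qed.

Let F f (p : Cn R d * Cn R d) : R[i] := f p.2 * k p.1 p.2.

Let mfp f : measurable_fun B f -> measurable_fun (B `*` B) (fun p => f p.2).
Proof.
move=> mf; apply: (measurable_comp mB _ mf).
- by move=> _ [p [_ pB] <-].
- exact: measurable_funS measurable_snd.
Qed.

Let mReF f : measurable_fun B f -> measurable_fun (B `*` B) (fun p => complex.Re (F f p)).
Proof.
move=> mf; under eq_fun do rewrite /F complex_ReM.
apply: measurable_funB; apply: measurable_funM.
- exact: (measurableT_comp (@measurable_complex_Re R) (mfp mf)).
- exact: (measurableT_comp (@measurable_complex_Re R) mk).
- exact: (measurableT_comp (@measurable_complex_Im R) (mfp mf)).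
- exact: (measurableT_comp (@measurable_complex_Im R) mk).
Qed.

Let mImF f : measurable_fun B f -> measurable_fun (B `*` B) (fun p => complex.Im (F f p)).
Proof.
move=> mf; under eq_fun do rewrite /F complex_ImM.
apply: measurable_funD; apply: measurable_funM.
- exact: (measurableT_comp (@measurable_complex_Re R) (mfp mf)).
- exact: (measurableT_comp (@measurable_complex_Im R) mk).
- exact: (measurableT_comp (@measurable_complex_Im R) (mfp mf)).
- exact: (measurableT_comp (@measurable_complex_Re R) mk).
Qed.

Let sectionB (G : Cn R d * Cn R d -> R) z : B z -> measurable_fun (B `*` B) G ->
  measurable_fun B (fun w => G (z, w)).
Proof.
move=> zB mG; apply: (measurable_comp mBB _ mG).
- by move=> _ [w wB <-].
- exact: measurable_funS (pair1_measurable z).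
Qed.

Let Rint_measurable (G : Cn R d * Cn R d -> R) : measurable_fun (B `*` B) G ->
  measurable_fun B (fun z => \int[mu]_(w in B) G (z, w)).
Proof.
move=> mG.
have mG' : measurable_fun setT (G \_ (B `*` B)) by apply/(measurable_restrictT _ mBB).
apply: (@eq_measurable_fun _ _ _ _ _
   (fun z => \int[mu]_(w in B) (G \_ (B `*` B)) (z, w))).
  move=> z; rewrite inE => zB; rewrite /Rintegral; congr fine; apply: eq_integral => w.
  by rewrite inE => wB; rewrite patchE mem_set.
exact: (measurable_funS measurableT _ (measurable_Rintegral_section mB B1 mG')).
Qed.

Lemma measurable_kernel_op f : measurable_fun B f -> measurable_fun B (kernel_op k f).
Proof.
move=> mf; apply: measurable_fun_complex => //=.
- exact: (Rint_measurable (mReF mf)).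
- exact: (Rint_measurable (mImF mf)).
Qed.

Lemma measurable_Re_kernel f z : measurable_fun B f -> B z ->
  measurable_fun B (fun w => complex.Re (f w * k z w)).
Proof. by move=> mf zB; exact: (sectionB zB (mReF mf)). Qed.

Let Rintegral_abs_le (G : Cn R d -> R) : measurable_fun B G ->
  (`|\int[mu]_(w in B) G w|%:E <= \int[mu]_(w in B) `|G w|%:E)%E.
Proof.
move=> mG; apply: (@le_trans _ _ (`|\int[mu]_(w in B) (G w)%:E|)%E).
  (* An infinite integral has real value 0, so the inequality holds in that case too. *)
  by rewrite /Rintegral; case: (\int[mu]_(w in B) (G w)%:E)%E => //=; rewrite normr0 leey.
apply: le_trans (le_abse_integral mu mB _) _ => //; exact/measurable_EFinP.
Qed.

(** The factor 2 comes from estimating real and imaginary parts separately. *)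
Lemma kernel_op_le f z : measurable_fun B f -> B z ->
  ((Normc.normc (kernel_op k f z))%:E <= 2%:E * Top alpha (absB f) z)%E.
Proof.
move=> mf zB.
have mD : measurable_fun B (fun w => (absB f w * dist z w `^ (- alpha))%:E).
  apply: (measurable_funS measurableT) => //; apply/measurable_EFinP.
  apply: measurable_funM; first exact: measurable_absB.
  exact: measurable_dist_powR.
have leT (G : Cn R d -> R) : measurable_fun B G ->
    (forall w, B w -> `|G w| <= Normc.normc (F f (z, w))) ->
    (`|\int[mu]_(w in B) G w|%:E <= Top alpha (absB f) z)%E.
  move=> mG hG; apply: le_trans (Rintegral_abs_le mG) _.
  apply: (ge0_le_integral mu mB) => //.
  - by apply/measurable_EFinP; exact: measurableT_comp.
  - move=> w wB; rewrite lee_fin (le_trans (hG w wB))// /F Normc.normcM kE//.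
    by rewrite absBE.
apply: (@le_trans _ _ (`|complex.Re (kernel_op k f z)|%:E + `|complex.Im (kernel_op k f z)|%:E)%E).
  by rewrite -EFinD lee_fin normc_le_ReIm.
rewrite (_ : 2%:E = 1%:E + 1%:E)%E; last by rewrite -EFinD.
rewrite ge0_muleDl ?lee01// mul1e; apply: leeD.
- apply: leT; first exact: (sectionB zB (mReF mf)).
  by move=> w _; exact: Re_le_normc.
- apply: leT; first exact: (sectionB zB (mImF mf)).
  by move=> w _; exact: Im_le_normc.
Qed.

Lemma kernel_op_bounded_sup (p q : \bar R) (C : R) : (1 <= p)%E -> (1 <= q)%E -> 0 <= C ->
  (forall g, measurable_fun setT g -> (forall w, 0 <= g w) ->
    forall z, B z -> (Top alpha g z <= C%:E * 'N[mu]_p[EFin \o g])%E) ->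
  Lp_bounded p q (kernel_op k).
Proof.
move=> p1 q1 C0 HC; exists (2 * C) => f [mf fp].
have mg := measurable_absB mf; have mKf := measurable_kernel_op mf.
suff h : (Lp_norm q (kernel_op k f) <= (2 * C)%:E * Lp_norm p f)%E.
  split => //; split => //; apply: le_lt_trans h _.
  rewrite -[X in (_ * X < _)%E]fineK ?ge0_fin_numE ?Lp_norm_absB ?Lnorm_ge0//.
    by rewrite -EFinM ltry.
  by rewrite -Lp_norm_absB.
rewrite Lp_norm_absB//; apply: le_trans.
  by apply: (Lnorm_le_probe mB B1 (q := +oo%E)) => //; [exact: measurable_absB|exact: leey].
rewrite Lp_norm_absB//.
have key z : B z ->
    ((absB (kernel_op k f) z)%:E <= (2 * C)%:E * 'N[mu]_p[EFin \o absB f])%E.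
  move=> zB; rewrite absBE//; apply: le_trans (kernel_op_le mf zB) _.
  rewrite EFinM -muleA; apply: lee_wpmul2l => //.
  by apply: HC => // w; exact: absB_ge0.
move: (_ * 'N[mu]_p[_])%E key => M key.
rewrite unlock /= probability_setT lte01; apply/ess_supP.
exists (~` B); split => //; first exact: measurableC.
by move=> z /= h zB; apply: h; rewrite ger0_norm ?absB_ge0//; exact: key.
Qed.

(** On a probability space a bound from L^p1 to L^q1 passes to every larger p and smaller q. *)
Lemma kernel_op_bounded_pow (p p1 q : \bar R) (q1 C : R) :
  (1 <= p1)%E -> (p1 <= p)%E -> (1 <= q)%E -> (q <= q1%:E)%E -> 0 <= C ->
  (forall g, measurable_fun setT g -> (forall w, 0 <= g w) ->
   (\int[mu]_(z in B) (Top alpha g z `^ q1) <= (C%:E * 'N[mu]_p1[EFin \o g]) `^ q1)%E) ->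
  Lp_bounded p q (kernel_op k).
Proof.
move=> p11 p1p q1' qq1 C0 HC; have p1' : (1 <= p)%E by exact: le_trans p1p.
exists (2 * C) => f [mf fp].
have mg := measurable_absB mf; have mKf := measurable_kernel_op mf.
have q11 : 1 <= q1 by rewrite -lee_fin (le_trans q1').
have q10 : 0 < q1 by lra.
suff h : (Lp_norm q (kernel_op k f) <= (2 * C)%:E * Lp_norm p f)%E.
  split => //; split => //; apply: le_lt_trans h _.
  rewrite -[X in (_ * X < _)%E]fineK ?ge0_fin_numE ?Lp_norm_absB ?Lnorm_ge0//.
    by rewrite -EFinM ltry.
  by rewrite -Lp_norm_absB.
rewrite Lp_norm_absB//; apply: le_trans.
  by apply: (Lnorm_le_probe mB B1 (q := q1%:E)) => //; exact: measurable_absB.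
apply: (@le_trans _ _ ((2 * C)%:E * 'N[mu]_p1[EFin \o absB f])%E); last first.
  rewrite Lp_norm_absB//; apply: lee_wpmul2l; first by rewrite lee_fin mulr_ge0.
  exact: (Lnorm_le_probe mB B1).
have N0 : (0 <= (2 * C)%:E * 'N[mu]_p1[EFin \o absB f])%E.
  by rewrite mule_ge0 ?Lnorm_ge0// lee_fin mulr_ge0.
have gp0 w : 0 <= absB (kernel_op k f) w by exact: absB_ge0.
have mT := measurable_Top alpha mg (absB_ge0 f).
have T0 z : (0 <= Top alpha (absB f) z)%E by apply: Top_ge0; exact: absB_ge0.
suff : ('N[mu]_q1%:E[EFin \o absB (kernel_op k f)] `^ q1 <=
    ((2 * C)%:E * 'N[mu]_p1[EFin \o absB f]) `^ q1)%E.
  by apply: le_poweR_cancel => //; exact: Lnorm_ge0.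
rewrite -Lnorm_integral_ball ?gt_eqF//; last exact: measurable_absB.
apply: (@le_trans _ _ (\int[mu]_(z in B) ((2%:E * Top alpha (absB f) z) `^ q1))%E).
  apply: (ge0_le_integral mu mB).
  - by move=> z _; rewrite lee_fin powR_ge0.
  - apply: (measurable_funS measurableT) => //; apply/measurable_EFinP.
    by apply: measurable_powRf; exact: measurable_absB.
  - apply: (measurable_funS measurableT) => //.
    by apply: (measurableT_comp (measurable_poweR _)); exact: measurable_funeM.
  - move=> z zB; rewrite -poweR_EFin; apply: gt0_ler_poweR; first exact: ltW.
    + by rewrite in_itv/= leey andbT lee_fin.
    + by rewrite in_itv/= leey andbT mule_ge0.
    + by rewrite absBE//; exact: kernel_op_le.
rewrite (eq_integral (fun z => (2 `^ q1)%:E * Top alpha (absB f) z `^ q1)%E); last first.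
  by move=> z _; rewrite poweRM.
have mTq : measurable_fun B (fun z => Top alpha (absB f) z `^ q1)%E.
  apply: (measurable_funS measurableT) => //.
  exact: (measurableT_comp (measurable_poweR _) mT).
rewrite (ge0_integralZl mu mB mTq); last 2 first.
- by move=> z _; exact: poweR_ge0.
- by rewrite lee_fin powR_ge0.
apply: le_trans.
  by apply: lee_wpmul2l (HC _ mg (absB_ge0 f)); rewrite lee_fin powR_ge0.
rewrite -poweR_EFin -poweRM//; last by rewrite mule_ge0 ?Lnorm_ge0// lee_fin.
by rewrite muleA -EFinM.
Qed.

End kernel.
End complex_operators.

(** * Sufficiency *)

Section sufficiency.
Variables (R : realType) (d : nat) (alpha : R).
Hypotheses (d0 : (0 < d)%N) (alpha_gt0 : 0 < alpha) (alpha_le : alpha <= d.+1%:R).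
Local Notation B := (@cball R d).
Local Notation dist z w := (Normc.normc (1 - dotc z w)).
Variable k : Cn R d -> Cn R d -> R[i].
Hypothesis mk : measurable_fun (B `*` B) (fun p => k p.1 p.2).
Hypothesis kE : forall z w, B z -> B w -> Normc.normc (k z w) = dist z w `^ (- alpha).

Let N0 : 0 < d.+1%:R :> R. Proof. by rewrite ltr0n. Qed.

(** In reciprocal exponents the critical line reads 1/q = 1/p + x - 1 and the critical exponent has
    reciprocal 1 - x, with x = 1 covering the infinite case. *)
Let x : R := alpha / d.+1%:R.
Let x0 : 0 < x. Proof. by rewrite divr_gt0. Qed.
Let x1 : x <= 1. Proof. by rewrite ler_pdivrMr// mul1r. Qed.

Lemma le_crit_exponent (p : R) : 0 < p -> 1 - x <= p^-1 -> (p%:E <= crit_exponent d alpha)%E.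
Proof.
move=> p0; have [xE|xE] := eqVneq alpha d.+1%:R.
  by rewrite xE crit_exponent_top leey.
have da0 : 0 < d.+1%:R - alpha by rewrite subr_gt0 lt_neqAle xE.
rewrite /crit_exponent inver gt_eqF// -EFinM lee_fin ler_pdivlMr//.
move=> h; rewrite -ler_pdivlMl// mulrC.
have : (1 - x) * d.+1%:R <= p^-1 * d.+1%:R by rewrite ler_pM2r.
by rewrite (_ : (1 - x) * d.+1%:R = d.+1%:R - alpha) 1?mulrC// /x; field; rewrite gt_eqF.
Qed.

Lemma lt_crit_exponent (p : R) : 0 < p -> (p%:E < crit_exponent d alpha)%E -> 1 - x < p^-1.
Proof.
move=> p0; have [xE|xE] := eqVneq alpha d.+1%:R.
  by move=> _; rewrite /x xE divff ?gt_eqF// subrr invr_gt0.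
have da0 : 0 < d.+1%:R - alpha by rewrite subr_gt0 lt_neqAle xE.
rewrite /crit_exponent inver gt_eqF// -EFinM lte_fin ltr_pdivlMr// => h.
rewrite -(ltr_pM2r N0) (_ : (1 - x) * d.+1%:R = d.+1%:R - alpha); last first.
  by rewrite /x; field; rewrite gt_eqF.
by rewrite mulrC ltr_pdivlMr// mulrC.
Qed.

Lemma kernel_op_sufficient (p q : \bar R) : (1 <= p)%E -> (1 <= q)%E ->
  [\/ p = 1%E /\ (q < (d.+1%:R / alpha)%:E)%E,
      (1 < p < crit_exponent d alpha)%E /\
        (p^-1 + (alpha / d.+1%:R)%:E - 1 <= q^-1)%E,
      p = crit_exponent d alpha /\ (q < +oo)%E
    | (crit_exponent d alpha < p)%E /\ (p <= +oo)%E] ->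
  Lp_bounded p q (kernel_op k).
Proof.
have hx0 : 0 < x by exact: x0.
have hx1 : x <= 1 by exact: x1.
move=> p1 q1 [[-> hq]|[/andP[p1' pc] hpq]|[pc qoo]|[pc _]].
- case: q q1 hq => [q| |]//; rewrite lte_fin lee_fin => q1 hq.
  have [|C C0 HC] := @Top_one_bound R d d0 alpha q alpha_gt0 q1.
    by rewrite mulrC -ltr_pdivlMr.
  by apply: (kernel_op_bounded_pow mk kE (p1 := 1%E) (q1 := q) (C := C)) => //; exact: lexx.
- have poo : (p < +oo)%E by apply: lt_le_trans pc (leey _).
  case: p p1 p1' pc hpq poo => [p| |]// p1 p1' pc hpq _.
  rewrite lte_fin in p1'; have p0 : 0 < p by lra.
  have hp := lt_crit_exponent p0 pc.
  rewrite inver gt_eqF// -/x -EFinD in hpq.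
  (* The exponent 1/y lies on the critical line over p; the target q satisfies q <= 1/y, so Schur's
     test at (p, 1/y) suffices. *)
  pose y := p^-1 + x - 1.
  have {}hpq : (y%:E <= q^-1)%E by [].
  have y0 : 0 < y by rewrite /y; lra.
  have pq : p <= y^-1.
    rewrite -[p]invrK lef_pV2 ?posrE ?invr_gt0//; rewrite /y; lra.
  have aE : alpha = d.+1%:R * (1 - p^-1 + y^-1^-1).
    by rewrite invrK /y /x; field; rewrite !gt_eqF.
  have [C C0 HC] := @Top_schur_bound R d d0 alpha p y^-1 p1' pq aE.
  apply: (kernel_op_bounded_pow mk kE (p1 := p%:E) (q1 := y^-1) (C := C)) => //.
  case: q q1 hpq => [q| |]//.
    rewrite lee_fin => q1; have q0 : 0 < q by lra.
    rewrite inver gt_eqF// !lee_fin => h.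
    by rewrite -[q]invrK lef_pV2 ?posrE ?invr_gt0.
  by move=> _; rewrite invey => h; move: y0; rewrite -lte_fin ltNge h.
- case: q q1 qoo => [q| |]//; rewrite lee_fin => q1 _; have q0 : 0 < q by lra.
  (* At the critical exponent itself p is lowered to 1/y, whose partner on the critical line is 1/e
     >= q. The bound e <= x / 2 keeps y below 1, hence 1/y > 1. *)
  pose e := Num.min q^-1 (x / 2).
  have e0 : 0 < e by rewrite lt_min invr_gt0 q0 divr_gt0.
  have ex : e <= x / 2 by rewrite ge_min lexx orbT.
  have eq : e <= q^-1 by rewrite ge_min lexx.
  pose y := 1 - x + e.
  have y0 : 0 < y by rewrite /y; lra.
  have y1 : 1 < y^-1 by rewrite invf_gt1// /y; lra.
  have ye : y^-1 <= e^-1 by rewrite lef_pV2 ?posrE// /y; lra.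
  have aE : alpha = d.+1%:R * (1 - y^-1^-1 + e^-1^-1).
    by rewrite !invrK /y /x; field; rewrite !gt_eqF.
  have [C C0 HC] := @Top_schur_bound R d d0 alpha y^-1 e^-1 y1 ye aE.
  apply: (kernel_op_bounded_pow mk kE (p1 := y^-1%:E) (q1 := e^-1) (C := C)) => //.
  + by rewrite lee_fin ltW.
  + by rewrite pc; apply: le_crit_exponent; rewrite ?invr_gt0// invrK /y; lra.
  + by rewrite lee_fin -[q]invrK lef_pV2 ?posrE ?invr_gt0.
- have [C C0 HC] := Top_sup_bound d0 alpha_gt0 alpha_le pc.
  exact: (kernel_op_bounded_sup mk kE p1 q1 C0 HC).
Qed.

End sufficiency.

(** * Test functions *)

Section test_functions.
Variables (R : realType) (d : nat) (alpha : R).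
Hypothesis alpha_gt0 : 0 < alpha.
Local Notation mu := (@ball_measure R d).
Local Notation B := (@cball R d).
Local Notation dist z w := (Normc.normc (1 - dotc z w)).
Variable k : Cn R d -> Cn R d -> R[i].
Hypothesis mk : measurable_fun (B `*` B) (fun p => k p.1 p.2).
Hypothesis kE : forall z w, B z -> B w -> Normc.normc (k z w) = dist z w `^ (- alpha).

Variables (Q : nat -> set (Cn R d)) (t : nat -> R) (kap x : R).
Hypothesis mQ : forall n, measurable (Q n).
Hypothesis QB : forall n, Q n `<=` B.
Hypothesis Qdisj : forall m n w, Q m w -> Q n w -> m = n.
Hypothesis muQ : forall n, mu (Q n) = (t n)%:E.
Hypothesis t0 : forall n, 0 < t n.
Hypothesis t_small : forall e : R, 0 < e -> exists n, t n < e.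
Hypothesis t_le : forall m n, (m <= n)%N -> t n <= t m.
Hypothesis kap0 : 0 < kap.
Hypothesis kQ : forall m n z w, Q m z -> Q n w ->
  kap * (Num.max (t m) (t n)) `^ (- x) <= complex.Re (k z w).

Let mB : measurable B := @measurable_cball R d.
Let B1 : mu (~` B) = 0%E := @ball_measureC R d.

Implicit Types (a : nat -> R) (s : seq nat) (z w : Cn R d).

(** The sets Q_j being disjoint, powers and norms of such functions are computed termwise. A list of
    indices covers both a single box and an initial run of boxes. *)
Definition step (a : nat -> R) (s : seq nat) (w : Cn R d) : R :=
  \sum_(j <- s) a j * \1_(Q j) w.

Lemma step_in a s j w : uniq s -> j \in s -> Q j w -> step a s w = a j.
Proof.
move=> us js jw; rewrite /step (bigD1_seq j)//= indicE mem_set// mulr1.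
rewrite big1 ?addr0// => i ij; rewrite indicE memNset ?mulr0// => iw.
by move: ij; rewrite (Qdisj iw jw) eqxx.
Qed.

Lemma step_out a s w : (forall j, j \in s -> ~ Q j w) -> step a s w = 0.
Proof.
move=> h; rewrite /step big_seq big1// => j js; rewrite indicE memNset ?mulr0//.
exact: h.
Qed.

Lemma stepP s w : (exists2 j, j \in s & Q j w) \/ (forall j, j \in s -> ~ Q j w).
Proof.
have [[j js jw]|h] := pselect (exists2 j, j \in s & Q j w); first by left; exists j.
by right => j js jw; apply: h; exists j.
Qed.

Lemma step_ge0 a s w : (forall j, 0 <= a j) -> 0 <= step a s w.
Proof. by move=> a0; apply: sumr_ge0 => j _; rewrite mulr_ge0// indicE. Qed.

Lemma measurable_step a s : measurable_fun setT (step a s).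
Proof.
by apply: measurable_sum => j; apply: measurable_funM.
Qed.

Lemma integral_step a s : (forall j, 0 <= a j) ->
  (\int[mu]_(w in B) (step a s w)%:E = (\sum_(j <- s) a j * t j)%:E)%E.
Proof.
move=> a0; rewrite /step; under eq_integral do rewrite -sumEFin.
rewrite ge0_integral_sum//; last 2 first.
- move=> j; apply: (measurable_funS measurableT) => //; apply/measurable_EFinP.
  by apply: measurable_funM => //; exact: measurable_indic.
- by move=> j w _; rewrite lee_fin mulr_ge0// indicE.
rewrite -sumEFin; apply: eq_bigr => j _.
under eq_integral do rewrite EFinM.
have mI : measurable_fun B (fun w => (\1_(Q j) w)%:E : \bar R).
  by apply: (measurable_funS measurableT) => //; apply/measurable_EFinP.
rewrite (ge0_integralZl mu mB mI); last 2 first.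
- by move=> w _; rewrite lee_fin indicE.
- by rewrite lee_fin.
rewrite integral_indic// EFinM -muQ; congr (_ * mu _)%E.
by apply/seteqP; split => [w []//|w wQ]; split => //; exact: (QB wQ).
Qed.

Definition cstep a s (w : Cn R d) : R[i] := (step a s w)%:C.

Lemma normc_real (r : R) : 0 <= r -> Normc.normc r%:C = r.
Proof. by move=> r0; rewrite /= expr0n/= addr0 sqrtr_sqr ger0_norm. Qed.

Lemma measurable_cstep a s : measurable_fun B (cstep a s).
Proof.
apply: (measurable_funS measurableT) => //.
apply: measurable_fun_complex => //=; exact: measurable_step.
Qed.

Lemma absB_cstep a s w : (forall j, 0 <= a j) -> absB (cstep a s) w = step a s w.
Proof.
move=> a0; rewrite /absB patchE; case: ifPn => wB.
  by rewrite /cstep normc_real// step_ge0.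
rewrite step_out// => j js jw; move/negP: wB; apply; rewrite inE; exact: (QB jw).
Qed.

Lemma Lp_norm_cstep a s p : uniq s -> (forall j, 0 <= a j) -> 1 <= p ->
  (Lp_norm p%:E (cstep a s) `^ p = (\sum_(j <- s) a j `^ p * t j)%:E)%E.
Proof.
move=> us a0 p1; have p0 : 0 < p by lra.
rewrite Lp_norm_absB ?lee_fin// -Lnorm_integral_ball ?gt_eqF//; last 2 first.
- by apply: measurable_absB; exact: measurable_cstep.
- by move=> w; exact: absB_ge0.
rewrite -integral_step; last by move=> j; exact: powR_ge0.
apply: eq_integral => w _; congr EFin; rewrite absB_cstep//.
have [[j js jw]|h] := stepP s w.
  by rewrite (step_in _ us js jw) (step_in (fun j => a j `^ p) us js jw).
by rewrite !step_out// powR0// gt_eqF.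
Qed.

Lemma Lp_norm_cstep_oo a s A : uniq s -> (forall j, 0 <= a j) ->
  (forall j, j \in s -> a j <= A) -> 0 <= A ->
  (Lp_norm +oo (cstep a s) <= A%:E)%E.
Proof.
move=> us a0 aA A0; rewrite Lp_norm_absB ?leey// unlock /= probability_setT lte01.
apply/ess_supP; apply: nearW => w /=; rewrite lee_fin absB_cstep// ger0_norm ?step_ge0//.
have [[j js jw]|h] := stepP s w; last by rewrite step_out.
by rewrite (step_in _ us js jw) aA.
Qed.

Lemma in_Lp_cstep a s (p : \bar R) : uniq s -> (forall j, 0 <= a j) -> (1 <= p)%E ->
  in_Lp p (cstep a s).
Proof.
move=> us a0; case: p => [p| |]// p1; (split; first exact: measurable_cstep).
  rewrite lee_fin in p1; apply: (@lty_poweRy _ _ p); first by rewrite gt_eqF//; lra.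
  by rewrite Lp_norm_cstep// ltry.
apply: le_lt_trans (@Lp_norm_cstep_oo a s (\sum_(j <- s) a j) us a0 _ _) _.
- by move=> j js; rewrite (bigD1_seq j)//= lerDl sumr_ge0.
- by rewrite sumr_ge0.
- by rewrite ltry.
Qed.

(** The test function is real and nonnegative, so the real part of K f is the integral of f Re k,
    bounded below box by box through [kQ]. *)
Lemma kernel_op_cstep_ge a s m z : uniq s -> (forall j, 0 <= a j) -> Q m z ->
  kap * \sum_(j <- s) a j * (Num.max (t m) (t j)) `^ (- x) * t j <=
  Normc.normc (kernel_op k (cstep a s) z).
Proof.
move=> us a0 zQ; have zB : B z := QB zQ.
apply: le_trans (le_trans (ler_norm _) (Re_le_normc _)).
rewrite /kernel_op /cintegral /=.
pose b j := kap * (a j * (Num.max (t m) (t j)) `^ (- x)).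
have b0 j : 0 <= b j by rewrite !mulr_ge0 ?powR_ge0// ltW.
have ReE w : complex.Re (cstep a s w * k z w) = step a s w * complex.Re (k z w).
  by rewrite complex_ReM /= mul0r subr0.
have -> : kap * (\sum_(j <- s) a j * (Num.max (t m) (t j)) `^ (- x) * t j) =
    fine (\int[mu]_(w in B) (step b s w)%:E)%E.
  by rewrite integral_step//= mulr_sumr; apply: eq_bigr => j _; rewrite /b !mulrA.
have le1 w : B w -> step b s w <= complex.Re (cstep a s w * k z w).
  move=> wB; rewrite ReE; have [[j js jw]|h] := stepP s w.
    rewrite !(step_in _ us js jw) /b mulrCA ler_wpM2l//.
    exact: kQ.
  by rewrite !step_out// mul0r.
have mRe : measurable_fun B (fun w => complex.Re (cstep a s w * k z w)).
  by apply: (measurable_Re_kernel mk) => //; exact: measurable_cstep.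
(* Finiteness is essential for a lower bound, since an infinite integral would have real value 0.
   For fixed z the kernel is bounded, as |1 - <z, w>| >= (1 - |z|^2) / 2. *)
have fin : (\int[mu]_(w in B) (complex.Re (cstep a s w * k z w))%:E < +oo)%E.
  pose r := (1 - nrm2 z) / 2.
  have r0 : 0 < r by rewrite divr_gt0// subr_gt0.
  apply: (@le_lt_trans _ _ (\int[mu]_(w in B) (step (fun j => a j * r `^ (- alpha)) s w)%:E)%E).
    apply: (ge0_le_integral mu mB).
    - by move=> w wB; rewrite lee_fin (le_trans _ (le1 w wB))// step_ge0.
    - exact/measurable_EFinP.
    - apply: (measurable_funS measurableT) => //; apply/measurable_EFinP.
      exact: measurable_step.
    - move=> w wB; rewrite lee_fin ReE.
      have -> : step (fun j => a j * r `^ (- alpha)) s w = step a s w * r `^ (- alpha).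
        by rewrite /step mulr_suml; apply: eq_bigr => j _; rewrite mulrAC.
      apply: ler_wpM2l; first exact: step_ge0.
      apply: le_trans (le_trans (ler_norm _) (Re_le_normc _)) _; rewrite kE//.
      have rD : r <= dist z w.
        apply: le_trans (dist_ge_defect z w); rewrite lerDl divr_ge0// subr_ge0.
        exact: ltW.
      rewrite !powRN lef_pV2 ?posrE ?powR_gt0// ?(lt_le_trans r0)//.
      by apply: ge0_ler_powR => //; rewrite ?nnegrE ?(ltW r0)// ltW// (lt_le_trans r0).
  by rewrite integral_step ?ltry// => j; rewrite mulr_ge0 ?powR_ge0.
have le2 : (\int[mu]_(w in B) (step b s w)%:E <=
    \int[mu]_(w in B) (complex.Re (cstep a s w * k z w))%:E)%E.
  apply: (ge0_le_integral mu mB).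
  - by move=> w _; rewrite lee_fin step_ge0.
  - apply: (measurable_funS measurableT) => //; apply/measurable_EFinP.
    exact: measurable_step.
  - exact/measurable_EFinP.
  - by move=> w wB; rewrite lee_fin le1.
have ge0 : (0 <= \int[mu]_(w in B) (step b s w)%:E)%E.
  by apply: integral_ge0 => w _; rewrite lee_fin step_ge0.
apply: fine_le => //.
- by rewrite ge0_fin_numE// integral_step ?ltry.
- by rewrite ge0_fin_numE// (le_trans ge0).
Qed.

Lemma Lp_bounded_nonneg p q (K : (Cn R d -> R[i]) -> (Cn R d -> R[i])) :
  Lp_bounded p q K -> exists2 C, 0 <= C & forall f, in_Lp p f ->
    in_Lp q (K f) /\ (Lp_norm q (K f) <= C%:E * Lp_norm p f)%E.
Proof.
move=> [C HC]; exists `|C| => // f fp; have [h1 h2] := HC f fp; split => //.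
apply: le_trans h2 _; apply: lee_wpmul2r; first exact: Lnorm_ge0.
by rewrite lee_fin ler_norm.
Qed.

Lemma Lp_norm_ge_step (q : R) (h : Cn R d -> R[i]) a s : measurable_fun B h -> 1 <= q ->
  uniq s -> (forall j, 0 <= a j) ->
  (forall j z, j \in s -> Q j z -> a j <= Normc.normc (h z)) ->
  ((\sum_(j <- s) a j `^ q * t j)%:E <= Lp_norm q%:E h `^ q)%E.
Proof.
move=> mh q1 us a0 ah; have q0 : 0 < q by lra.
rewrite Lp_norm_absB ?lee_fin// -Lnorm_integral_ball ?gt_eqF//; last 2 first.
- exact: measurable_absB.
- by move=> w; exact: absB_ge0.
rewrite -integral_step; last by move=> j; exact: powR_ge0.
apply: (ge0_le_integral mu mB).
- by move=> w _; rewrite lee_fin step_ge0// => j; exact: powR_ge0.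
- apply: (measurable_funS measurableT) => //; apply/measurable_EFinP.
  exact: measurable_step.
- apply: (measurable_funS measurableT) => //; apply/measurable_EFinP.
  by apply: measurable_powRf; exact: measurable_absB.
move=> w wB; rewrite lee_fin absBE//.
have [[j js jw]|hn] := stepP s w; last by rewrite step_out// powR_ge0.
rewrite (step_in (fun j => a j `^ q) us js jw).
by apply: ge0_ler_powR; rewrite ?nnegrE ?normc_ge0 ?(ltW q0)//; exact: ah.
Qed.

(** Were the essential supremum below v, the box Q_m would lie in a null set, against mu (Q_m) = t_m
    > 0. *)
Lemma Lp_norm_oo_ge (h : Cn R d -> R[i]) m v :
  (forall z, Q m z -> v <= Normc.normc (h z)) -> (v%:E <= Lp_norm +oo h)%E.
Proof.
move=> hv; rewrite leNgt; apply/negP; rewrite Lp_norm_absB ?leey// unlock /=.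
rewrite probability_setT lte01.
have [N [mN N0 sN]] := ess_sup_ge mu (abse \o (EFin \o absB h)).
set M := ess_sup _ _ => Mv.
have QN : Q m `<=` N.
  move=> z zQ; apply: sN => /=; rewrite -/M => zM.
  have := le_lt_trans zM Mv.
  by rewrite lte_fin ger0_norm ?absB_ge0// absBE ?ltNge ?hv//; exact: QB zQ.
have : (mu (Q m) <= mu N)%E by apply: le_measure; rewrite ?inE.
by rewrite N0 muQ lee_fin leNgt t0.
Qed.

Hypothesis x0 : 0 < x.

(** [fine p^-1] is 1/p for real p and 0 for p = +oo, so one formula serves both. *)
Lemma Lp_norm_cstep1 (p : \bar R) n : (1 <= p)%E ->
  (Lp_norm p (cstep (fun=> 1%R) [:: n]) <= (t n `^ fine (p^-1)%E)%:E)%E.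
Proof.
case: p => [p| |]// p1; last first.
  rewrite invey /= powRr0; apply: Lp_norm_cstep_oo => //.
rewrite lee_fin in p1; have p0 : 0 < p by lra.
rewrite inver gt_eqF//=; apply: (le_poweR_cancel p0).
- exact: Lnorm_ge0.
- by rewrite lee_fin powR_ge0.
rewrite Lp_norm_cstep// big_seq1 powR1 mul1r poweR_EFin -powRrM mulVf ?gt_eqF//.
by rewrite powRr1// ltW.
Qed.

Lemma Lp_norm_ge1 (q : \bar R) (h : Cn R d -> R[i]) n v : measurable_fun B h ->
  (1 <= q)%E -> 0 <= v -> (forall z, Q n z -> v <= Normc.normc (h z)) ->
  ((v * t n `^ fine (q^-1)%E)%:E <= Lp_norm q h)%E.
Proof.
move=> mh; case: q => [q| |]// q1 v0 hv; last first.
  by rewrite invey /= powRr0 mulr1; exact: Lp_norm_oo_ge hv.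
rewrite lee_fin in q1; have q0 : 0 < q by lra.
rewrite inver gt_eqF//=; apply: (le_poweR_cancel q0).
- by rewrite lee_fin mulr_ge0 ?powR_ge0.
- exact: Lnorm_ge0.
rewrite poweR_EFin powRM ?powR_ge0// -powRrM mulVf ?gt_eqF// powRr1 ?(ltW (t0 n))//.
apply: le_trans (@Lp_norm_ge_step q h (fun=> v) [:: n] mh q1 _ _ _) => //.
  by rewrite big_seq1.
by move=> j z; rewrite inE => /eqP ->; exact: hv.
Qed.

(** On Q_n the image of its indicator is at least kap t_n^(1 - x), whence kap t_n^(1 - x + 1/q) <= C
    t_n^(1/p). Letting t_n tend to 0 compares the exponents. *)
Lemma kernel_op_bounded_scaling (p q : \bar R) : (1 <= p)%E -> (1 <= q)%E ->
  Lp_bounded p q (kernel_op k) -> fine p^-1%E + x - 1 <= fine q^-1%E.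
Proof.
move=> p1 q1 /Lp_bounded_nonneg[C C0 HC].
set ip := fine _; set iq := fine _.
have tx n : t n `^ (1 - x) = t n `^ (- x) * t n.
  rewrite addrC powRD; last by rewrite (gt_eqF (t0 _)) implybT.
  by rewrite powRr1 ?(ltW (t0 n)).
have key n : kap * t n `^ (1 - x + iq) <= C * t n `^ ip.
  have fp : in_Lp p (cstep (fun=> 1) [:: n]) by exact: in_Lp_cstep.
  have [[mK _] h] := HC _ fp.
  have v0 : 0 <= kap * t n `^ (1 - x) by rewrite mulr_ge0 ?powR_ge0// ltW.
  have hv z : Q n z -> kap * t n `^ (1 - x) <=
      Normc.normc (kernel_op k (cstep (fun=> 1) [:: n]) z).
    move=> zQ; apply: le_trans (kernel_op_cstep_ge _ _ zQ) => //.
    by rewrite big_seq1 mul1r maxxx tx.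
  have := le_trans (Lp_norm_ge1 mK q1 v0 hv) h.
  move=> /le_trans/(_ (lee_wpmul2l _ (Lp_norm_cstep1 n p1))).
  rewrite lee_fin => /(_ C0); rewrite -EFinM lee_fin -/ip -/iq -mulrA -powRD//.
  by rewrite (gt_eqF (t0 _)) implybT.
rewrite leNgt; apply/negP => hlt.
pose e := ip + x - 1 - iq.
have e0 : 0 < e by rewrite /e; lra.
have C1 : 0 < C + 1 by lra.
have [n hn] := @t_small ((kap / (C + 1)) `^ e^-1) (powR_gt0 _ (divr_gt0 kap0 C1)).
have := key n; rewrite (_ : ip = e + (1 - x + iq)); last by rewrite /e; ring.
rewrite [in leRHS]powRD; last by rewrite (gt_eqF (t0 _)) implybT.
rewrite mulrA ler_pM2r ?powR_gt0// leNgt => /negP; apply.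
have te : t n `^ e < kap / (C + 1).
  have := gt0_ltr_powR e0 (ltW (t0 n)) (powR_ge0 _ _) hn.
  by rewrite -powRrM mulVf ?gt_eqF// powRr1// ltW// divr_gt0.
apply: (@le_lt_trans _ _ ((C + 1) * t n `^ e)).
  by rewrite ler_wpM2r ?powR_ge0//; lra.
by rewrite mulrC -ltr_pdivlMr.
Qed.

(** The normalized indicator of Q_N has L^1 norm 1, and its image is at least kap t_j^(-x) on Q_j
    for j < N. As x q = 1, each of these N boxes contributes kap^q to the q-th power of the norm. *)
Lemma kernel_op_unbounded_one (q : R) : 1 <= q -> x * q = 1 ->
  ~ Lp_bounded 1 q%:E (kernel_op k).
Proof.
move=> q1 xq /Lp_bounded_nonneg[C C0 HC]; have q0 : 0 < q by lra.
have key N : N%:R * kap `^ q <= C `^ q.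
  have a0 (j : nat) : 0 <= (t N)^-1 by rewrite invr_ge0 ltW.
  have fp : in_Lp 1 (cstep (fun=> (t N)^-1) [:: N]) by exact: in_Lp_cstep.
  have [[mK _] h] := HC _ fp.
  have f1 : Lp_norm 1 (cstep (fun=> (t N)^-1) [:: N]) = 1%E.
    have := @Lp_norm_cstep (fun=> (t N)^-1) [:: N] 1 isT a0 (lexx _).
    rewrite poweRe1 ?Lnorm_ge0// big_seq1 powRr1//; last exact: (a0 0%N).
    by rewrite mulVf// gt_eqF.
  rewrite f1 mule1 in h.
  have hb j z : j \in iota 0 N -> Q j z -> kap * t j `^ (- x) <=
      Normc.normc (kernel_op k (cstep (fun=> (t N)^-1) [:: N]) z).
    rewrite mem_iota /= => jN zQ; apply: le_trans (kernel_op_cstep_ge _ _ zQ) => //.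
    rewrite big_seq1 (max_idPl (t_le (ltnW jN))).
    by rewrite (_ : (t N)^-1 * _ * t N = t j `^ (- x))//; field; rewrite gt_eqF.
  have b0 j : 0 <= kap * t j `^ (- x) by rewrite mulr_ge0 ?powR_ge0// ltW.
  have h2 : (Lp_norm q%:E (kernel_op k (cstep (fun=> (t N)^-1)%R [:: N])) `^ q <=
      (C `^ q)%:E)%E.
    rewrite -poweR_EFin; apply: gt0_ler_poweR h; first exact: ltW.
    - by rewrite in_itv/= leey andbT; exact: Lnorm_ge0.
    - by rewrite in_itv/= leey andbT lee_fin.
  have := le_trans (Lp_norm_ge_step mK q1 (iota_uniq 0 N) b0 hb) h2.
  rewrite lee_fin (eq_bigr (fun=> kap `^ q)); last first.
    move=> j _; rewrite powRM ?powR_ge0 ?(ltW kap0)// -powRrM mulNr xq.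
    by rewrite powR_inv1 ?(ltW (t0 j))// -mulrA mulVf ?mulr1// gt_eqF.
  by rewrite big_const_seq count_predT size_iota iter_addr_0 mulr_natl.
have := key (Num.truncn (C `^ q / kap `^ q)).+1.
by rewrite -ler_pdivlMr ?powR_gt0// leNgt truncnS_gt.
Qed.

(** With 1/p = 1 - x the test function has norm at most N^(1 - x), while each of the N boxes
    contributes kap to its image on Q_N. Since x > 0, kap N eventually exceeds C N^(1 - x). *)
Lemma kernel_op_unbounded_sup (p : \bar R) : (1 < p)%E -> fine p^-1%E = 1 - x ->
  ~ Lp_bounded p +oo (kernel_op k).
Proof.
move=> p1 px /Lp_bounded_nonneg[C C0 HC].
pose a j := t j `^ (- (1 - x)).
have a0 j : 0 <= a j by exact: powR_ge0.
have key N : kap * N%:R <= C * N%:R `^ (1 - x).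
  have uN := iota_uniq 0 N.
  have fp : in_Lp p (cstep a (iota 0 N)) by apply: in_Lp_cstep => //; exact: ltW.
  have [_ h] := HC _ fp.
  have hv z : Q N z -> kap * N%:R <= Normc.normc (kernel_op k (cstep a (iota 0 N)) z).
    move=> zQ; apply: le_trans (kernel_op_cstep_ge uN a0 zQ).
    rewrite ler_pM2l// big_seq (eq_bigr (fun=> 1)) -?big_seq.
      by rewrite big_const_seq count_predT size_iota iter_addr_0.
    move=> j; rewrite mem_iota /= => jN; rewrite (max_idPr (t_le (ltnW jN))) /a.
    rewrite -powRD; last by rewrite (gt_eqF (t0 _)) implybT.
    rewrite (_ : - (1 - x) + - x = -1); last by ring.
    by rewrite powR_inv1 ?(ltW (t0 j))// mulVf// gt_eqF.
  have fN : (Lp_norm p (cstep a (iota 0 N)) <= (N%:R `^ (1 - x))%:E)%E.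
    case: p p1 px {fp h HC} => [p| |]// p1 px; last first.
      rewrite invey /= in px; rewrite -px powRr0.
      by apply: Lp_norm_cstep_oo => // j _; rewrite /a -px oppr0 powRr0.
    rewrite lte_fin in p1; have p0 : 0 < p by lra.
    rewrite inver gt_eqF//= in px; apply: (le_poweR_cancel p0).
    - exact: Lnorm_ge0.
    - by rewrite lee_fin powR_ge0.
    rewrite Lp_norm_cstep//; last exact: ltW.
    rewrite poweR_EFin -powRrM -px mulVf ?gt_eqF// powRr1//.
    rewrite (eq_bigr (fun=> 1)).
      by rewrite big_const_seq count_predT size_iota iter_addr_0.
    move=> j _; rewrite /a -powRrM -px mulNr mulVf ?gt_eqF//.
    by rewrite powR_inv1 ?(ltW (t0 j))// mulVf// gt_eqF.
  have := le_trans (Lp_norm_oo_ge hv) h.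
  move=> /le_trans/(_ (lee_wpmul2l _ fN)).
  by rewrite lee_fin => /(_ C0); rewrite -EFinM lee_fin.
have [n hn] : exists n, (C / kap) `^ x^-1 < n.+1%:R.
  by exists (Num.truncn ((C / kap) `^ x^-1)); exact: truncnS_gt.
have n0 : 0 < n.+1%:R :> R by rewrite ltr0n.
have := key n.+1; rewrite leNgt => /negP; apply.
have Ck : C / kap < n.+1%:R `^ x.
  have := gt0_ltr_powR x0 (powR_ge0 _ _) (ltW n0) hn.
  by rewrite -powRrM mulVf ?gt_eqF// powRr1// divr_ge0// ltW.
have nx : n.+1%:R = n.+1%:R `^ x * n.+1%:R `^ (1 - x) :> R.
  by rewrite -powRD ?(gt_eqF n0) ?implybT// addrC subrK powRr1// ltW.
rewrite [ltRHS](_ : _ = kap * n.+1%:R `^ x * n.+1%:R `^ (1 - x)); last first.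
  by rewrite -mulrA -nx.
by rewrite ltr_pM2r ?powR_gt0// mulrC -ltr_pdivrMr.
Qed.

End test_functions.

(** * Boxes near a boundary point *)

Section boxes.
Variables (R : realType).

Definition rect (a r : R) : set R[i] :=
  [set u | `|complex.Re u - a| < r /\ `|complex.Im u| < r].

Lemma rectE a r : @pair_complex R @^-1` rect a r =
  `]a - r, a + r[%classic `*` `]- r, r[%classic.
Proof.
by apply/seteqP; split => -[x y] /=; rewrite !in_itv/= -!ltr_distl -ltr_norml ?subr0.
Qed.

Lemma measurable_rect a r : measurable (rect a r).
Proof.
rewrite (_ : measurable _ = measurable (@pair_complex R @^-1` rect a r))//.
by rewrite rectE; apply: measurableX; exact: measurable_itv.
Qed.

Lemma complex_lebesgue_rect a r : 0 < r ->
  complex_lebesgue R (rect a r) = ((2 * r) ^+ 2)%:E.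
Proof.
move=> r0; rewrite /complex_lebesgue/= /transport /pushforward rectE.
rewrite /prod_measure product_measure1E//= !lebesgue_measure_itv/= !lte_fin.
rewrite ltrD2l gtrN// -!EFinB -EFinM; congr EFin; ring.
Qed.

Variable d : nat.
Hypothesis d0 : (0 < d)%N.
Local Notation mu := (@ball_measure R d).
Local Notation B := (@cball R d).
Variable c : R.
Hypotheses (c0 : 0 < c) (c4 : c <= 1 / 4) (dc : d%:R * c <= 1 / 4).

(** The shift to n + 1 ensures [delta n <= 1/4] from n = 0 on, as the box estimates require. *)
Definition theta n : R := 2^-1 ^+ n.+1.
Definition delta n : R := theta n ^+ 2.

Lemma theta_gt0 n : 0 < theta n. Proof. by rewrite exprn_gt0. Qed.
Lemma delta_gt0 n : 0 < delta n. Proof. by rewrite exprn_gt0// theta_gt0. Qed.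

Lemma deltaS n : delta n.+1 = delta n / 4.
Proof. by rewrite /delta /theta (exprS _ n.+1); field. Qed.

Lemma delta_le m n : (m <= n)%N -> delta n <= delta m.
Proof.
move=> /subnKC <-; elim: (n - m)%N => [|k IH]; first by rewrite addn0.
by rewrite addnS deltaS; have := delta_gt0 (m + k); lra.
Qed.

Lemma delta_lt m n : (m < n)%N -> delta n <= delta m / 4.
Proof. by move=> mn; rewrite -deltaS; exact: delta_le. Qed.

Lemma delta_le4 n : delta n <= 1 / 4.
Proof.
by apply: le_trans (delta_le (leq0n n)) _; rewrite /delta /theta expr1; lra.
Qed.

Definition box n : set (Cn R d) :=
  [set w | forall j : 'I_d,
     (if j == 0%N :> nat then rect (1 - delta n) (c * delta n) else rect 0 (c * theta n))
     (tnth w j)].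

Let j0 : 'I_d := Ordinal d0.

Lemma measurable_box_set n : measurable (box n).
Proof.
apply: (measurable_box (A := fun j : 'I_d => if j == 0%N :> nat then
  rect (1 - delta n) (c * delta n) else rect 0 (c * theta n))) => j.
by case: ifP => _; exact: measurable_rect.
Qed.

Lemma box_head n w : box n w ->
  `|complex.Re (tnth w j0) - (1 - delta n)| < c * delta n /\
  `|complex.Im (tnth w j0)| < c * delta n.
Proof. by move=> /(_ j0). Qed.

Lemma box_tail n w j : box n w -> j != j0 ->
  `|complex.Re (tnth w j)| < c * theta n /\ `|complex.Im (tnth w j)| < c * theta n.
Proof.
move=> /(_ j) + jj0; rewrite ifF; last first.
  by apply/negbTE; apply: contra jj0 => /eqP jE; apply/eqP/val_inj.
by rewrite /rect/= subr0.
Qed.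

(** The first coordinate contributes a square of area (2 c delta)^2 and each of the d - 1 others (2
    c theta)^2 = 4 c^2 delta, hence delta^(d+1). *)
Lemma Cn_lebesgue_box n :
  Cn_lebesgue R d (box n) = (((2 * c) ^+ 2) ^+ d * delta n ^+ d.+1)%:E.
Proof.
rewrite /Cn_lebesgue (tuple_measure_box _ (A := fun j : 'I_d => if j == 0%N :> nat then
  rect (1 - delta n) (c * delta n) else rect 0 (c * theta n))); last first.
  by move=> j; case: ifP => _; exact: measurable_rect.
transitivity (complex_lebesgue R (rect (1 - delta n) (c * delta n)) *
    \prod_(i < d | i != j0) ((2 * c) ^+ 2 * delta n)%:E)%E.
  rewrite (bigD1 j0)//; apply: (f_equal2 mule) => //; apply: eq_bigr => j jj0.
  rewrite ifF; last first.
    by apply/negbTE; apply: contra jj0 => /eqP jE; apply/eqP/val_inj.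
  rewrite complex_lebesgue_rect; last by rewrite mulr_gt0 ?theta_gt0.
  by rewrite /delta; congr EFin; ring.
rewrite complex_lebesgue_rect; last by rewrite mulr_gt0 ?delta_gt0.
rewrite prodEFin prodr_const cardC1 card_ord -EFinM; congr EFin.
have e (y : R) : y ^+ d = y * y ^+ d.-1 by rewrite -exprS prednK.
rewrite (exprS _ d) !e [((2 * c) ^+ 2 * delta n) ^+ d.-1]exprMn.
by move: (((2 * c) ^+ 2) ^+ d.-1) (delta n ^+ d.-1) => u v; ring.
Qed.

(** 2 theta_m theta_n <= delta_m + delta_n, and d c <= 1/4 absorbs the number of terms. F is later a
    squared modulus, and the real and imaginary parts of the products in <z, w>. *)
Lemma sum_tail_le (m n : nat) (z w : Cn R d) (F : R[i] -> R[i] -> R) :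
  (forall j, j != j0 -> `|F (tnth z j) (tnth w j)| <= 2 * c ^+ 2 * (theta m * theta n)) ->
  `|\sum_(j < d | j != j0) F (tnth z j) (tnth w j)| <= c / 4 * (delta m + delta n).
Proof.
move=> HF; apply: le_trans (ler_norm_sum _ _ _) _.
apply: le_trans (ler_sum _ HF) _.
rewrite sumr_const cardC1 card_ord -[leLHS]mulr_natl.
apply: (@le_trans _ _ (d%:R * (c ^+ 2 * (delta m + delta n)))).
  apply: ler_pM => //.
  - by rewrite !mulr_ge0 ?exprn_ge0// ltW// theta_gt0.
  - by rewrite ler_nat leq_pred.
  - rewrite -mulrA mulrCA ler_wpM2l ?exprn_ge0// ?(ltW c0)//.
    by rewrite /delta; have := sqr_ge0 (theta m - theta n); nra.
rewrite expr2 !mulrA ler_wpM2r ?addr_ge0 ?(ltW (delta_gt0 _))//.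
rewrite (_ : c / 4 = 1 / 4 * c); last by field.
by rewrite ler_wpM2r// ltW.
Qed.

Lemma sqr_lt_le (x y : R) : `|x| < y -> x ^+ 2 <= y ^+ 2.
Proof.
move=> xy; rewrite -(real_normK (num_real x)) lerXn2r ?nnegrE//; last exact: ltW.
by rewrite (le_trans (normr_ge0 _) (ltW xy)).
Qed.

(** The first coordinate contributes at most (1 - (1 - c) delta)^2 + c^2 delta^2 to |w|^2 and the
    tail at most c delta / 2; the linear term -2 (1 - c) delta wins because c and delta are at most
    1/4. *)
Lemma box_sub_ball n : box n `<=` B.
Proof.
move=> w wn; rewrite /cball/= (bigD1 j0)//=.
have [h1 h2] := box_head wn.
have hS : \sum_(j < d | j != j0) Normc.normc (tnth w j) ^+ 2 <= c / 4 * (delta n + delta n).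
  apply: le_trans (ler_norm _) _.
  apply: (@sum_tail_le n n w w (fun u _ => Normc.normc u ^+ 2)) => j jj0.
  have [h3 h4] := box_tail wn jj0.
  rewrite ger0_norm ?sqr_ge0// normc_sqr.
  by have := sqr_lt_le h3; have := sqr_lt_le h4; lra.
have dl4 := delta_le4 n; have dl0 := delta_gt0 n.
have h3 : complex.Re (tnth w j0) ^+ 2 <= (1 - delta n + c * delta n) ^+ 2.
  apply: sqr_lt_le; have := ler_normD (complex.Re (tnth w j0) - (1 - delta n)) (1 - delta n).
  rewrite subrK (ger0_norm (x := 1 - delta n)); last by lra.
  by move: h1; lra.
have h4 := sqr_lt_le h2.
rewrite normc_sqr.
have e1 : delta n ^+ 2 <= delta n / 4 by rewrite expr2 ler_pM2l//; lra.
have e2 : ((1 - c) ^+ 2 + c ^+ 2) * delta n ^+ 2 <= 1 * delta n ^+ 2.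
  have h5 : 0 <= c * (1 - c) by rewrite mulr_ge0 ?(ltW c0)//; have := c4; lra.
  by rewrite ler_wpM2r ?sqr_ge0//; lra.
have e3 : c * delta n <= 1 / 4 * delta n by rewrite ler_wpM2r// ltW.
lra.
Qed.

Lemma box_disj m n w : box m w -> box n w -> m = n.
Proof.
have lt m' n' : (m' < n')%N -> box m' w -> box n' w -> False.
  move=> /delta_lt hd /box_head[h1 _] /box_head[h2 _].
  have dn := delta_gt0 n'; have dm := delta_gt0 m'.
  have e1 : c * delta m' <= 1 / 4 * delta m' by rewrite ler_wpM2r// ltW.
  have e2 : c * delta n' <= 1 / 4 * delta n' by rewrite ler_wpM2r// ltW.
  move: h1 h2; rewrite !ltr_norml => /andP[h1 h1'] /andP[h2 h2']; lra.
by case: (ltngtP m n) => // h h1 h2; [case: (lt _ _ h h1 h2)|case: (lt _ _ h h2 h1)].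
Qed.

(** p and q are 1 minus the first real parts, a and b the first imaginary parts, S and T the tails
    of <z, w>; u and v are then the real and imaginary parts of 1 - <z, w>. The main term of u is p
    + q, close to de + ep, whereas every term of v carries a factor c. *)
Lemma box_arith (de ep p q a b S T : R) : 0 < de -> 0 < ep -> de <= 1 / 4 -> ep <= 1 / 4 ->
  `|p - de| < c * de -> `|q - ep| < c * ep -> `|a| < c * de -> `|b| < c * ep ->
  `|S| <= c / 4 * (de + ep) -> `|T| <= c / 4 * (de + ep) ->
  let u := 1 - ((1 - p) * (1 - q) + a * b) - S in
  let v := (1 - p) * b - a * (1 - q) - T in
  [/\ (de + ep) / 4 <= u, u <= 2 * (de + ep) & `|v| <= 5 / 4 * c * (de + ep)].
Proof.
move=> de0 ep0 de4 ep4 hp hq ha hb hS hT u v.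
have cd : c * de <= 1 / 4 * de by rewrite ler_wpM2r// ltW.
have ce : c * ep <= 1 / 4 * ep by rewrite ler_wpM2r// ltW.
have cde : c / 4 * (de + ep) <= 1 / 16 * (de + ep).
  by rewrite ler_wpM2r ?addr_ge0 ?(ltW de0) ?(ltW ep0)//; have := c4; lra.
have ab : `|a * b| <= 1 / 16 * (1 / 4 * ep).
  rewrite normrM; apply: ler_pM => //.
    by apply: le_trans (ltW ha) _; lra.
  by apply: le_trans (ltW hb) _; lra.
move: hp hq hS; rewrite !ltr_norml !ler_norml => /andP[p1 p2] /andP[q1 q2] /andP[s1 s2].
move: ab; rewrite ler_norml => /andP[ab1 ab2].
have p0 : 0 <= p by lra.
have q0 : 0 <= q by lra.
have pq0 : 0 <= p * q by rewrite mulr_ge0.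
have pq1 : p * q <= 5 / 16 * q by rewrite ler_wpM2r//; lra.
have pq2 : p * q <= p * (5 / 16) by rewrite ler_wpM2l//; lra.
split; [rewrite /u; lra|rewrite /u; lra|].
have v1 : `|(1 - p) * b| <= c * ep.
  rewrite normrM; apply: le_trans (ltW hb); rewrite ler_piMl// ler_norml; apply/andP; split; lra.
have v2 : `|a * (1 - q)| <= c * de.
  rewrite normrM; apply: le_trans (ltW ha); rewrite ler_piMr// ler_norml; apply/andP; split; lra.
rewrite (_ : 5 / 4 * c * (de + ep) = c * ep + c * de + c / 4 * (de + ep)); last by field.
rewrite -ler_norml. apply: le_trans (ler_normB ((1 - p) * b - a * (1 - q)) T) _; apply: lerD => //.
by apply: le_trans (ler_normB _ _) _; exact: lerD.
Qed.

(** The slope 5 c can be made as small as desired: a small c places 1 - <z, w> in any prescribed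
    sector, uniformly in m and n. *)
Lemma box_dist m n z w : box m z -> box n w ->
  [/\ 0 < complex.Re (1 - dotc z w),
      `|complex.Im (1 - dotc z w)| <= 5 * c * complex.Re (1 - dotc z w) &
      Normc.normc (1 - dotc z w) <= 6 * Num.max (delta m) (delta n)].
Proof.
move=> zm wn.
have [hz1 hz2] := box_head zm; have [hw1 hw2] := box_head wn.
pose S := \sum_(j < d | j != j0) complex.Re (tnth z j * conjc (tnth w j)).
pose T := \sum_(j < d | j != j0) complex.Im (tnth z j * conjc (tnth w j)).
have ht j : j != j0 ->
   `|complex.Re (tnth z j * conjc (tnth w j))| <= 2 * c ^+ 2 * (theta m * theta n) /\
   `|complex.Im (tnth z j * conjc (tnth w j))| <= 2 * c ^+ 2 * (theta m * theta n).
  move=> jj0; have [h3 h4] := box_tail zm jj0; have [h5 h6] := box_tail wn jj0.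
  have bnd (a b a' b' : R) : `|a| < c * theta m -> `|b| < c * theta m ->
     `|a'| < c * theta n -> `|b'| < c * theta n ->
     `|a * a'| + `|b * b'| <= 2 * c ^+ 2 * (theta m * theta n).
    move=> ha hb ha' hb'; rewrite !normrM.
    have := ler_pM (normr_ge0 a) (normr_ge0 a') (ltW ha) (ltW ha').
    have := ler_pM (normr_ge0 b) (normr_ge0 b') (ltW hb) (ltW hb').
    lra.
  case: (tnth z j) h3 h4 => a b; case: (tnth w j) h5 h6 => a' b' /= h5 h6 h3 h4.
  split.
    by rewrite mulrN opprK (le_trans (ler_normD _ _))// bnd.
  by rewrite mulrN (le_trans (ler_normD _ _))// normrN addrC bnd // addrC.
have hS : `|S| <= c / 4 * (delta m + delta n).
  by apply: (sum_tail_le (F := fun u v => complex.Re (u * conjc v))) => j /ht[].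
have hT : `|T| <= c / 4 * (delta m + delta n).
  by apply: (sum_tail_le (F := fun u v => complex.Im (u * conjc v))) => j /ht[].
have ReE : complex.Re (1 - dotc z w) =
    1 - (complex.Re (tnth z j0) * complex.Re (tnth w j0) +
         complex.Im (tnth z j0) * complex.Im (tnth w j0)) - S.
  transitivity (1 - complex.Re (dotc z w)); first by case: (dotc z w).
  rewrite /dotc complex_Re_sum (bigD1 j0)//= complex_ReM -/S.
  by case: (tnth w j0) => a b /=; ring.
have ImE : complex.Im (1 - dotc z w) =
    complex.Re (tnth z j0) * complex.Im (tnth w j0) -
    complex.Im (tnth z j0) * complex.Re (tnth w j0) - T.
  transitivity (- complex.Im (dotc z w)); first by case: (dotc z w) => a b /=; rewrite sub0r.
  rewrite /dotc complex_Im_sum (bigD1 j0)//= complex_ImM -/T.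
  by case: (tnth w j0) => a b /=; ring.
have := @box_arith (delta m) (delta n) (1 - complex.Re (tnth z j0)) (1 - complex.Re (tnth w j0))
  (complex.Im (tnth z j0)) (complex.Im (tnth w j0)) S T (delta_gt0 m) (delta_gt0 n)
  (delta_le4 m) (delta_le4 n).
have flip (r e : R) : `|1 - r - e| = `|r - (1 - e)|.
  by rewrite -normrN; congr (`|_|); ring.
rewrite !flip !subKr -ReE -ImE => /(_ hz1 hw1 hz2 hw2 hS hT)[h1 h2 h3].
have dm := delta_gt0 m; have dn := delta_gt0 n.
have h4 : delta m + delta n <= 2 * Num.max (delta m) (delta n).
  by have [] := leP (delta m) (delta n); lra.
have ur : 0 < complex.Re (1 - dotc z w) by lra.
split => //.
  apply: (le_trans h3).
  rewrite (_ : 5 / 4 * c * _ = 5 * c * ((delta m + delta n) / 4)); last by field.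
  by rewrite ler_wpM2l// mulr_ge0// ltW.
apply: (le_trans (normc_le_ReIm _)); rewrite ger0_norm; last exact: ltW.
have h5 : 5 / 4 * c * (delta m + delta n) <= 5 / 16 * (delta m + delta n).
  by rewrite ler_wpM2r ?addr_ge0 ?(ltW dm) ?(ltW dn)//; have := c4; lra.
lra.
Qed.

End boxes.

(** * Characterization of boundedness *)

Section characterization.
Variables (R : realType) (d : nat) (alpha : R).
Hypotheses (d0 : (0 < d)%N) (alpha_gt0 : 0 < alpha) (alpha_le : alpha <= d.+1%:R).
Local Notation mu := (@ball_measure R d).
Local Notation B := (@cball R d).
Local Notation dist z w := (Normc.normc (1 - dotc z w)).
Variable k : Cn R d -> Cn R d -> R[i].
Hypothesis mk : measurable_fun (B `*` B) (fun p => k p.1 p.2).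
Hypothesis kE : forall z w, B z -> B w -> Normc.normc (k z w) = dist z w `^ (- alpha).

Variables (eta kap0 : R).
Hypotheses (eta0 : 0 < eta) (kap00 : 0 < kap0).
Hypothesis kS : forall z w, B z -> B w ->
  `|complex.Im (1 - dotc z w)| <= eta * complex.Re (1 - dotc z w) ->
  kap0 * dist z w `^ (- alpha) <= complex.Re (k z w).

Let dR : 0 < d%:R :> R. Proof. by rewrite ltr0n. Qed.
(** The three entries serve, in order, the estimates in the first coordinate, the tail sums, and the
    sector of aperture eta. *)
Let c : R := Num.min (1 / 4) (Num.min (1 / 4 / d%:R) (eta / 5)).
Let c0 : 0 < c. Proof. by rewrite /c !lt_min !divr_gt0. Qed.
Let c4 : c <= 1 / 4. Proof. by rewrite /c ge_min lexx. Qed.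
Let dc : d%:R * c <= 1 / 4.
Proof. by rewrite mulrC -ler_pdivlMr// /c !ge_min lexx orbT. Qed.
Let ceta : 5 * c <= eta.
Proof. by rewrite mulrC -ler_pdivlMr// /c !ge_min lexx !orbT. Qed.

Let K : R := ((2 * c) ^+ 2) ^+ d / fine (Cn_lebesgue R d B).
Let Bpos : 0 < fine (Cn_lebesgue R d B).
Proof. by have /andP[K0 Koo] := @Cn_lebesgue_cball R d; rewrite fine_gt0// K0. Qed.
Let K0 : 0 < K.
Proof. by rewrite divr_gt0// !exprn_gt0// mulr_gt0. Qed.

Let Q := @box R d c.
Let t n : R := K * @delta R n ^+ d.+1.
Let t0 n : 0 < t n. Proof. by rewrite mulr_gt0// exprn_gt0// delta_gt0. Qed.

Let muQ n : mu (Q n) = (t n)%:E.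
Proof.
have /andP[m0 moo] := @Cn_lebesgue_cball R d.
have Kfin : Cn_lebesgue R d B \is a fin_num by rewrite ge0_fin_numE// ltW.
rewrite ball_measureE (_ : Q n `&` B = Q n); last first.
  apply/seteqP; split => [w []//|w wQ]; split => //.
  exact: (box_sub_ball d0 c0 c4 dc wQ).
rewrite (Cn_lebesgue_box d0 c0) -(fineK Kfin) inver gt_eqF// -EFinM.
by congr EFin; rewrite /t /K mulrAC.
Qed.

Let t_le m n : (m <= n)%N -> t n <= t m.
Proof.
move=> mn; rewrite ler_pM2l// lerXn2r ?nnegrE ?(ltW (delta_gt0 _ _))//.
exact: delta_le.
Qed.

Let t_small (e : R) : 0 < e -> exists n, t n < e.
Proof.
move=> e0; pose n := Num.truncn (K / e); exists n.
apply: (@le_lt_trans _ _ (K * theta R n)).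
  rewrite ler_pM2l// /delta -exprM -[leRHS]expr1.
  by apply: ler_wiXn2l; rewrite ?(ltW (theta_gt0 _ _))// exprn_ile1// invf_le1// ler1n.
rewrite /theta exprVn ltr_pdivrMr ?exprn_gt0// mulrC -ltr_pdivrMr//.
apply: (lt_le_trans (truncnS_gt _)); rewrite -natrX ler_nat.
exact: ltnW (ltn_expl _ (ltnSn 1)).
Qed.

Let x : R := alpha / d.+1%:R.
Let x0 : 0 < x. Proof. by rewrite divr_gt0. Qed.
(** 6^(-alpha) is the loss in [box_dist]; K^x compensates the factor K in t when powers of delta are
    rewritten as powers of t, since (d + 1) x = alpha. *)
Let kap : R := kap0 * 6 `^ (- alpha) * K `^ x.

Let kQ m n z w : Q m z -> Q n w ->
  kap * (Num.max (t m) (t n)) `^ (- x) <= complex.Re (k z w).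
Proof.
move=> zQ wQ; have zB := box_sub_ball d0 c0 c4 dc zQ.
have wB := box_sub_ball d0 c0 c4 dc wQ.
have [h1 h2 h3] := box_dist d0 c0 c4 dc zQ wQ.
apply: le_trans (kS zB wB _); last first.
  by apply: (le_trans h2); rewrite ler_wpM2r// ltW.
have D0 : 0 < dist z w by apply: dist_gt0.
set M := Num.max (@delta R m) (@delta R n) in h3.
have M0 : 0 < M by rewrite /M lt_max delta_gt0.
have -> : Num.max (t m) (t n) = K * M ^+ d.+1.
  have mono (a b : nat) : @delta R a <= @delta R b -> t a <= t b.
    by move=> ab; rewrite ler_pM2l// lerXn2r ?nnegrE ?(ltW (delta_gt0 _ _)).
  rewrite /M; have [/[dup] h /mono|/ltW/[dup] h /mono] := leP (@delta R m) (@delta R n).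
    by move/max_idPr => ->.
  by move/max_idPl => ->.
have eK : 6 `^ (- alpha) * (K `^ x * (K * M ^+ d.+1) `^ (- x)) = (6 * M) `^ (- alpha).
  have M0' := ltW M0; have K0' := ltW K0.
  rewrite (@powRM _ 6 M)// (@powRM _ K)// ?exprn_ge0//; congr (_ * _).
  rewrite mulrA -powRD; last by rewrite (gt_eqF K0) implybT.
  rewrite subrr powRr0 mul1r -powR_mulrn ?(ltW M0)// -powRrM; congr (_ `^ _).
  by rewrite /x; field; rewrite addrC natr1 pnatr_eq0.
rewrite /kap -2!mulrA ler_pM2l// eK.
rewrite !powRN lef_pV2 ?posrE ?powR_gt0 ?mulr_gt0//.
by apply: ge0_ler_powR; rewrite ?nnegrE ?(ltW alpha_gt0) ?(ltW D0)// mulr_ge0// ltW.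
Qed.

Lemma kernel_op_iff (p q : \bar R) : (1 <= p)%E -> (1 <= q)%E ->
  Lp_bounded p q (kernel_op k) <->
  [\/ p = 1%E /\ (q < (d.+1%:R / alpha)%:E)%E,
      (1 < p < crit_exponent d alpha)%E /\
        (p^-1 + (alpha / d.+1%:R)%:E - 1 <= q^-1)%E,
      p = crit_exponent d alpha /\ (q < +oo)%E
    | (crit_exponent d alpha < p)%E /\ (p <= +oo)%E].
Proof.
move=> p1 q1; split; last exact: (kernel_op_sufficient d0 alpha_gt0 alpha_le mk kE).
move=> bdd.
have mQ n : measurable (Q n) by exact: measurable_box_set.
have QB n : Q n `<=` B by exact: (box_sub_ball d0 c0 c4 dc).
have Qd m n w : Q m w -> Q n w -> m = n by exact: (box_disj d0 c4).
have kap_gt0 : 0 < kap by rewrite /kap !mulr_gt0 ?powR_gt0.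
have scal : fine p^-1%E + x - 1 <= fine q^-1%E.
  exact: (kernel_op_bounded_scaling alpha_gt0 mk kE mQ QB Qd muQ t0 t_small kap_gt0 kQ p1 q1 bdd).
have unb1 := kernel_op_unbounded_one alpha_gt0 mk kE mQ QB Qd muQ t0 t_le kap_gt0 kQ.
have unboo := kernel_op_unbounded_sup alpha_gt0 mk kE mQ QB Qd muQ t0 t_le kap_gt0 kQ x0.
have xE : x * (d.+1%:R / alpha) = 1.
  by rewrite /x; field; rewrite gt_eqF// addrC natr1 pnatr_eq0.
have q0r (r : R) : (1 <= r%:E)%E -> 0 < r by rewrite lee_fin => h; lra.
(* At p = 1 scaling gives x <= 1/q, and equality is excluded by [unb1]. For p > 1 only the position
   relative to the critical exponent matters; at that exponent [unboo] excludes q = +oo. *)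
move: p1; rewrite le_eqVlt => /predU1P[p1E|p1'].
  constructor 1; split=> //; rewrite -p1E inve1 /= in scal bdd.
  case: q q1 scal bdd => [q| |]// q1 scal bdd; last first.
    by rewrite invey /= addrAC subrr add0r leNgt x0 in scal.
  have q0 := q0r _ q1; rewrite inver gt_eqF//= in scal.
  rewrite lte_fin lt_neqAle; apply/andP; split.
    apply/eqP => qE; apply: (unb1 q _ _ bdd); first by rewrite -lee_fin.
    by rewrite qE.
  rewrite addrAC subrr add0r in scal.
  rewrite -[q]invrK (_ : d.+1%:R / alpha = x^-1); last by rewrite /x invf_div.
  by rewrite lef_pV2 ?posrE ?invr_gt0.
case: (ltgtP p (crit_exponent d alpha)) => pc.
- constructor 2; split; first by rewrite p1'.
  case: p p1' pc scal {bdd} => [p| |]// p1' pc scal.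
    have p0 : 0 < p by rewrite lte_fin in p1'; lra.
    rewrite inver gt_eqF//= in scal; rewrite inver gt_eqF// -EFinD.
    case: q q1 scal => [q| |]// q1 scal.
      have q0 := q0r _ q1; rewrite inver gt_eqF//= in scal.
      by rewrite inver gt_eqF// -lee_fin in scal *.
  by move: pc; rewrite ltNge leey.
- by constructor 4; rewrite leey.
- constructor 3; split=> //; rewrite ltNge leye_eq; apply/negP => /eqP qoo.
  rewrite qoo in bdd; apply: (unboo p p1' _ bdd).
  rewrite pc /crit_exponent /x; have [->|aE] := eqVneq alpha d.+1%:R.
    by rewrite subrr inve0 gt0_muley ?lte_fin// invey divff ?pnatr_eq0// subrr.
  have da : d.+1%:R - alpha != 0 by rewrite subr_eq0 eq_sym.
  rewrite inver (negbTE da) -EFinM inver mulf_eq0 invr_eq0 (negbTE da) pnatr_eq0/=.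
  by rewrite invf_div mulrBl divff ?pnatr_eq0.
Qed.

End characterization.

(** * The two kernels *)

Section kernels.
Variables (R : realType) (d : nat) (alpha : R).
Local Notation B := (@cball R d).
Local Notation dist z w := (Normc.normc (1 - dotc z w)).
Implicit Types (z w : Cn R d) (u : R[i]).

Lemma real_complexV (r : R) : (r%:C)^-1 = (r^-1)%:C :> R[i].
Proof. by rewrite -fmorphV. Qed.

Definition plus_kernel z w : R[i] := (dist z w `^ (- alpha))%:C.

Lemma Kop_plusE : @Kop_plus R d alpha = kernel_op plus_kernel.
Proof.
apply/funext => f; apply/funext => z; rewrite /Kop_plus /kernel_op; congr cintegral.
by apply/funext => w; rewrite real_complexV -powRN.
Qed.

Lemma measurable_plus_kernel :
  measurable_fun (B `*` B) (fun p => plus_kernel p.1 p.2).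
Proof.
apply: (measurable_funS measurableT) => //; apply: measurable_fun_complex => //=.
exact: measurable_powRf (@measurable_dist R d).
Qed.

Lemma normc_plus_kernel z w : Normc.normc (plus_kernel z w) = dist z w `^ (- alpha).
Proof. by rewrite normc_real ?powR_ge0. Qed.

(** The unsigned argument: [carg] is plus or minus it, so the cosine needs only this and the sine
    only a further sign. *)
Definition arg_cos (u : R[i]) : R := acos (complex.Re u / Normc.normc u).

Lemma cos_carg u : cos (alpha * carg u) = cos (alpha * arg_cos u).
Proof. by rewrite /carg; case: ifP => // _; rewrite mulrN cosN. Qed.

Lemma sin_carg u : sin (alpha * carg u) =
  (if 0 <= complex.Im u then 1 else -1) * sin (alpha * arg_cos u).
Proof. by rewrite /carg; case: ifP => // _; rewrite ?mul1r// mulrN sinN mulN1r. Qed.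

(** Polar form of (1 - <z, w>)^(-alpha), in which the modulus and the measurability can be read
    off. *)
Definition cpow_kernel z w : R[i] :=
  let u := 1 - dotc z w in
  (dist z w `^ (- alpha) * cos (alpha * carg u)) +i*
  (- (dist z w `^ (- alpha) * sin (alpha * carg u))).

Lemma cpowV u : 0 < Normc.normc u -> (cpow u alpha)^-1 =
  (Normc.normc u `^ (- alpha) * cos (alpha * carg u)) +i*
  (- (Normc.normc u `^ (- alpha) * sin (alpha * carg u))).
Proof.
move=> u0; apply: mulr1_eq; rewrite /cpow /cexp /clog /=.
rewrite !mul0r subr0 addr0 -powR_expR// powRN.
have D0 : Normc.normc u `^ alpha != 0 by rewrite gt_eqF// powR_gt0.
have cs := cos2Dsin2 (alpha * carg u).
move: (Normc.normc u `^ alpha) D0 => D D0.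
apply/eqP; rewrite eq_complex /=; apply/andP; split; apply/eqP.
  rewrite -cs; field.
  exact: D0.
by field.
Qed.

(** Continuity covers the open interval; the endpoint 1 is added because the ratio Re u / |u|
    attains it for positive u. The value -1 does not occur, as Re u > 0. *)
Lemma measurable_acos : measurable_fun [set r : R | -1 < r <= 1] acos.
Proof.
rewrite (_ : [set r : R | -1 < r <= 1] = `]-1, 1[%classic `|` [set 1]).
  apply/measurable_funU => //.
  split; last exact: measurable_fun_set1.
  apply: open_continuous_measurable_fun; first by apply: interval_open.
  by move=> r; rewrite inE /= in_itv/=; exact: continuous_acos.
apply/seteqP; split => r /=; rewrite in_itv/=.
  move=> /andP[r1]; rewrite le_eqVlt => /predU1P[->|r2]; first by right.
  by left; rewrite r1.
by case=> [/andP[-> /ltW]|->]//; rewrite lexx andbT; lra.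
Qed.

Lemma ratio_bounds u : 0 < complex.Re u -> 0 < complex.Re u / Normc.normc u <= 1.
Proof.
move=> u0; have n0 : 0 < Normc.normc u.
  by apply: lt_le_trans u0 _; exact: le_trans (ler_norm _) (Re_le_normc _).
rewrite divr_gt0//= ler_pdivrMr// mul1r.
exact: le_trans (ler_norm _) (Re_le_normc _).
Qed.

(** The restriction to z in the ball guarantees 1 - <z, w> nonzero, as inversion of the power
    requires; [Lp_bounded_eq] transfers boundedness from agreement on the ball. *)
Lemma KopE f z : B z -> @Kop R d alpha f z = kernel_op cpow_kernel f z.
Proof.
move=> zB; rewrite /Kop /kernel_op /cintegral; congr (_ +i* _);
rewrite /Rintegral; congr fine; apply: eq_integral => w; rewrite inE => wB;
by rewrite cpowV// dist_gt0.
Qed.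

Lemma normc_cpow_kernel z w : Normc.normc (cpow_kernel z w) = dist z w `^ (- alpha).
Proof.
rewrite /cpow_kernel /= sqrrN !exprMn -mulrDr cos2Dsin2 mulr1.
by rewrite sqrtr_sqr ger0_norm// powR_ge0.
Qed.

Let mBB : measurable (B `*` B).
Proof. by apply: measurableX; exact: measurable_cball. Qed.

Lemma measurable_arg_cos :
  measurable_fun (B `*` B) (fun p => arg_cos (1 - dotc p.1 p.2)).
Proof.
have mS : measurable [set r : R | -1 < r <= 1].
  rewrite (_ : [set r : R | -1 < r <= 1] = `]-1, 1]%classic); first exact: measurable_itv.
  by apply/seteqP; split => r /=; rewrite in_itv.
apply: (measurable_comp mS _ measurable_acos).
  move=> _ [[z w] [zB wB] <-] /=.
  have /andP[r0 r1] := ratio_bounds (Re_dist_gt0 zB wB).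
  by rewrite r1 andbT (lt_trans _ r0)// ltrN10.
apply: (measurable_funS measurableT) => //; apply: measurable_funM.
  exact: (@measurable_Re_dist R d).
rewrite (_ : (fun p => _) = fun p : Cn R d * Cn R d => dist p.1 p.2 `^ (-1)).
  exact: measurable_powRf (@measurable_dist R d).
by apply/funext => p; rewrite powR_inv1 ?normc_ge0.
Qed.

Lemma measurable_cpow_kernel :
  measurable_fun (B `*` B) (fun p => cpow_kernel p.1 p.2).
Proof.
have mD : measurable_fun (B `*` B) (fun p => dist p.1 p.2 `^ (- alpha)).
  apply: (measurable_funS measurableT) => //.
  exact: measurable_powRf (@measurable_dist R d).
have ma : measurable_fun (B `*` B) (fun p => alpha * arg_cos (1 - dotc p.1 p.2)).
  by apply: measurable_funM => //; exact: measurable_arg_cos.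
apply: measurable_fun_complex => //=.
  apply: measurable_funM => //; under eq_fun do rewrite cos_carg.
  exact: (measurableT_comp (continuous_measurable_fun (@continuous_cos R)) ma).
apply: measurable_funN; apply: measurable_funM => //.
under eq_fun do rewrite sin_carg.
apply: measurable_funM; last first.
  exact: (measurableT_comp (continuous_measurable_fun (@continuous_sin R)) ma).
apply: (measurable_funS measurableT) => //.
apply: measurable_fun_ifT => //.
rewrite (_ : (fun p => _) = (fun p => (cst 0 p <= complex.Im (1 - dotc p.1 p.2)))).
  by apply: measurable_fun_ler => //; exact: (@measurable_Im_dist R d).
by [].
Qed.

Lemma plus_kernel_sector z w :
  `|complex.Im (1 - dotc z w)| <= 1 * complex.Re (1 - dotc z w) ->
  1 * dist z w `^ (- alpha) <= complex.Re (plus_kernel z w).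
Proof. by rewrite !mul1r /=. Qed.

(* Close to the positive axis the argument is at most 1/(d + 1), so alpha times
   it stays in [0, 1], where the cosine is at least cos 1. *)
Lemma cpow_kernel_sector : 0 < alpha -> alpha <= d.+1%:R ->
  exists2 eta : R, 0 < eta & forall z w, B z -> B w ->
  `|complex.Im (1 - dotc z w)| <= eta * complex.Re (1 - dotc z w) ->
  cos 1 * dist z w `^ (- alpha) <= complex.Re (cpow_kernel z w).
Proof.
move=> a0 ad; pose tau : R := d.+1%:R^-1.
have N0 : 0 < d.+1%:R :> R by rewrite ltr0n.
have tau0 : 0 < tau by rewrite invr_gt0.
have tau1 : tau <= 1 by rewrite invf_le1// ler1n.
have pi1 : 1 <= pi :> R by apply: le_trans (pi_ge2 R); rewrite ler1n.
have itv (r : R) : 0 <= r -> r <= pi -> r \in `[0, pi] by move=> *; rewrite in_itv/=; apply/andP.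
have ct1 : cos tau < 1.
  by rewrite -[ltRHS]cos0 ltr_cos// itv ?pi_ge0// ?(ltW tau0)// (le_trans tau1).
(* In this sector |u| <= (2 - cos tau) Re u, and cos tau (2 - cos tau) = 1 - (1 - cos tau)^2 <= 1,
   so Re u / |u| >= cos tau. *)
exists (1 - cos tau); first by rewrite subr_gt0.
move=> z w zB wB him.
have u0 := Re_dist_gt0 zB wB.
have /andP[r0 r1] := ratio_bounds u0.
set u := 1 - dotc z w in him u0 r0 r1 *.
have D0 : 0 < Normc.normc u by apply: dist_gt0.
have rt : cos tau <= complex.Re u / Normc.normc u.
  rewrite ler_pdivlMr//.
  have ct0 : 0 <= cos tau.
    apply: cos_ge0_pihalf; apply/andP; split; have := pihalf_ge1 R; lra.
  apply: (@le_trans _ _ (cos tau * (complex.Re u + (1 - cos tau) * complex.Re u))).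
    rewrite ler_wpM2l//; apply: le_trans (normc_le_ReIm u) _.
    by rewrite (ger0_norm (ltW u0)) lerD2l.
  by have := mulr_ge0 (sqr_ge0 (1 - cos tau)) (ltW u0); lra.
have rN1 : -1 <= complex.Re u / Normc.normc u <= 1 by rewrite r1 andbT; lra.
have [/andP[c0 cpi] cK] := acos_def rN1.
have ct : arg_cos u <= tau.
  rewrite leNgt; apply/negP => h; move: rt; rewrite leNgt => /negP; apply.
  by rewrite -cK ltr_cos// itv// ?(ltW tau0)// (le_trans tau1).
have at1 : alpha * arg_cos u <= 1.
  apply: (@le_trans _ _ (d.+1%:R * tau)); last by rewrite mulfV// gt_eqF.
  by apply: ler_pM => //; exact: ltW.
have at0 : 0 <= alpha * arg_cos u by rewrite mulr_ge0// ltW.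
rewrite /cpow_kernel /= -/u cos_carg mulrC ler_wpM2l ?powR_ge0//.
rewrite leNgt; apply/negP; rewrite ltr_cos ?itv//; last exact: le_trans pi1.
by rewrite ltNge at1.
Qed.

Lemma Lp_bounded_eq (p q : \bar R) (K1 K2 : (Cn R d -> R[i]) -> (Cn R d -> R[i])) :
  (1 <= q)%E -> (forall f z, B z -> K1 f z = K2 f z) ->
  Lp_bounded p q K1 -> Lp_bounded p q K2.
Proof.
move=> q1 K12 [C HC]; exists C => f fp; have [[mK h1] h2] := HC f fp.
have NE : Lp_norm q (K2 f) = Lp_norm q (K1 f).
  rewrite !Lp_norm_absB//; congr Lnorm; apply/funext => z /=; congr EFin.
  by rewrite /absB !patchE; case: ifPn => // /set_mem zB; rewrite K12.
split; last by rewrite NE.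
split; last by rewrite NE.
by apply: eq_measurable_fun mK => z /set_mem zB; rewrite K12.
Qed.

End kernels.

Theorem theorem2 (R : realType) (d : nat) (alpha : R) (p q : \bar R)
    (hd : (1 <= d)%N) (alpha_gt0 : 0 < alpha) (alpha_le : alpha <= d.+1%:R)
    (hp : (1 <= p)%E) (hq : (1 <= q)%E) :
  (Lp_bounded p q (@Kop R d alpha) <-> Lp_bounded p q (@Kop_plus R d alpha)) /\
  (Lp_bounded p q (@Kop_plus R d alpha) <->
    [\/ p = 1%E /\ (q < (d.+1%:R / alpha)%:E)%E,
        (1 < p < crit_exponent d alpha)%E /\
          (p^-1 + (alpha / d.+1%:R)%:E - 1 <= q^-1)%E,
        p = crit_exponent d alpha /\ (q < +oo)%E
      | (crit_exponent d alpha < p)%E /\ (p <= +oo)%E]).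
Proof.
(* The positive kernel equals its own modulus, so both sector constants can be 1. *)
have Kplus := kernel_op_iff hd alpha_gt0 alpha_le (@measurable_plus_kernel R d alpha)
  (fun z w _ _ => normc_plus_kernel alpha z w) ltr01 ltr01
  (fun z w _ _ => @plus_kernel_sector R d alpha z w) hp hq.
have [eta eta0 sector] := cpow_kernel_sector alpha_gt0 alpha_le.
have K := kernel_op_iff hd alpha_gt0 alpha_le (@measurable_cpow_kernel R d alpha)
  (fun z w _ _ => normc_cpow_kernel alpha z w) eta0 (cos1_gt0 R) sector hp hq.
have KE : Lp_bounded p q (@Kop R d alpha) <-> Lp_bounded p q (kernel_op (@cpow_kernel R d alpha)).
  by split; apply: Lp_bounded_eq => // f z zB; rewrite KopE.
rewrite Kop_plusE; split => //.
exact: iff_trans KE (iff_trans K (iff_sym Kplus)).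
Qed.
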